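(* Let $\Phi:\mathbb{R}^{d}\rightrightarrows\mathbb{R}^{d}$ be a cusco map. The following are equivalent: (i) there exists a locally Lipschitz function $\varphi:\mathbb{R}^d\to\mathbb{R}$ such that $\Phi=\partial\varphi$, i.e. $\Phi(x)=\partial\varphi(x)$ for all $x\in\mathbb{R}^d$, where $\partial\varphi$ is the Clarke subdifferential of $\varphi$; (ii) there exists a measurable selection $f$ of $\Phi$ (i.e. a measurable function $f:\mathbb{R}^d\to\mathbb{R}^d$ with $f(x)\in\Phi(x)$ for all $x\in\mathbb{R}^d$) such that $\Phi(x)=F_f(x)$ for all $x\in\mathbb{R}^d$ and $f=(f_1,\dots,f_d)$ satisfies the nonsmooth Poincaré condition: $\partial_i f_j=\partial_j f_i$ for all $i,j\in\{1,\dots,d\}$ in the sense of distributions, that is, $$\int_{\mathbb{R}^d}f_j(x)\frac{\partial\psi}{\partial x_i}(x)\,dx=\int_{\mathbb{R}^d}f_i(x)\frac{\partial\psi}{\partial x_j}(x)\,dx$$ for every $i,j\in\{1,\dots,d\}$ and every compactly supported $\mathcal{C}^\infty$ function $\psi:\mathbb{R}^d\to\mathbb{R}$.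
   Context: A set-valued map $\Phi:\mathbb{R}^{d}\rightrightarrows\mathbb{R}^{d}$ (assigning to each point a subset of $\mathbb{R}^d$) is called cusco if it is upper semicontinuous and has nonempty compact convex values. $B_\delta(x)$ is the open ball of center $x$ and radius $\delta$, $\mathcal{N}$ is the family of Lebesgue null subsets of $\mathbb{R}^d$, and $\overline{\mathrm{co}}$ is the closed convex hull. Measurable means Lebesgue measurable. The Filippov regularization of a measurable function $f:\mathbb{R}^d\to\mathbb{R}^d$ is $$F_f(x):=\bigcap_{N\in\mathcal{N}}\bigcap_{\delta>0}\overline{\mathrm{co}}\,f(B_\delta(x)\setminus N),\quad x\in\mathbb{R}^d.$$ The Clarke subdifferential of a locally Lipschitz function $\varphi:\mathbb{R}^d\to\mathbb{R}$ at $x$ is $\partial\varphi(x)=\{v\in\mathbb{R}^d:\ \langle v,h\rangle\le\varphi^\circ(x;h)\ \text{for all }h\in\mathbb{R}^d\}$, where $\varphi^\circ(x;h)=\limsup_{y\to x,\,t\to0^+}\frac{\varphi(y+th)-\varphi(y)}{t}$. *)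

(* Defs.v *)
From HB Require Import structures.
From mathcomp Require Import all_boot all_order all_algebra.
From mathcomp Require Import all_classical all_reals all_analysis.

Set Implicit Arguments.
Unset Strict Implicit.
Unset Printing Implicit Defensive.

Import Order.TTheory GRing.Theory Num.Theory.
Import numFieldNormedType.Exports.

Local Open Scope classical_set_scope.
Local Open Scope ring_scope.

(* R^d is 'rV[R]_d.  Its library topology is the usual one, but the library
   norm and the library balls are those of the max norm; the Euclidean ones are
   defined here. *)
Section Euclidean.
Context {R : realType} {d : nat}.
Implicit Types (u v x : 'rV[R]_d) (r : R).

Definition dotv u v : R := \sum_(i < d) u 0 i * v 0 i.

Definition enorm u : R := Num.sqrt (dotv u u).

Definition eball x r : set 'rV[R]_d := [set y | enorm (y - x) < r].

Definition basisv (i : 'I_d) : 'rV[R]_d := delta_mx 0 i.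

End Euclidean.

(* The measurable sets of the Lebesgue measure on R^d are the Caratheodory
   measurable sets of the outer measure obtained by covering with countably
   many boxes, so that the measure is complete. *)
Section LebesgueMeasure.
Context (R : realType) (d : nat).
Local Open Scope ereal_scope.

Definition box (p : 'rV[R]_d * 'rV[R]_d) : set 'rV[R]_d :=
  [set x | forall i, (p.1 0 i < x 0 i <= p.2 0 i)%R].

Definition box_volume (p : 'rV[R]_d * 'rV[R]_d) : R :=
  (\prod_(i < d) Num.max 0 (p.2 0 i - p.1 0 i))%R.

Definition lebesgue_outer (A : set 'rV[R]_d) : \bar R :=
  ereal_inf [set \esum_(p in D) (box_volume p)%:E | D in
    [set D | countable D /\ A `<=` \bigcup_(p in D) box p]].

Lemma box_volume_ge0 p : 0 <= (box_volume p)%:E.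
Proof. by rewrite lee_fin prodr_ge0 // => i _; rewrite le_max lexx. Qed.

Lemma lebesgue_outer_ge0 A : 0 <= lebesgue_outer A.
Proof.
apply: le_ereal_inf_tmp => _ [D _ <-].
by apply: esum_ge0 => p _; exact: box_volume_ge0.
Qed.

Lemma lebesgue_outer0 : lebesgue_outer set0 = 0.
Proof.
apply/eqP; rewrite eq_le lebesgue_outer_ge0 andbT.
apply: ereal_inf_lbound; exists set0; last by rewrite esum_set0.
by split => //; exact: countable0.
Qed.

Lemma le_lebesgue_outer :
  {homo lebesgue_outer : A B / A `<=` B >-> A <= B}.
Proof.
move=> A B AB; apply/ereal_inf_le_tmp => _ [D [cD BD] <-].
by exists D => //; split => //; exact: subset_trans BD.
Qed.

Lemma lebesgue_outer_sigma_subadditive : sigma_subadditive lebesgue_outer.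
Proof.
move=> A; have [[i ioo]|] := pselect (exists i, lebesgue_outer (A i) = +oo).
  rewrite (eseries_pinfty _ _ ioo) ?leey// => n _.
  by rewrite -ltNye (lt_le_trans _ (lebesgue_outer_ge0 _)).
rewrite -forallNE => Aoo.
suff add2e (e : {posnum R}) : lebesgue_outer (\bigcup_n A n) <=
    \sum_(i <oo) lebesgue_outer (A i) + e%:num%:E.
  by apply/lee_addgt0Pr => _/posnumP[].
rewrite (le_trans _ (epsilon_trick _ _ _))//; last first.
  by move=> n; exact: lebesgue_outer_ge0.
pose P n D := [/\ countable D, A n `<=` \bigcup_(p in D) box p &
  \esum_(p in D) (box_volume p)%:E <=
    lebesgue_outer (A n) + (e%:num / (2 ^ n.+1)%:R)%:E].
have [G PG] : {G : (set ('rV[R]_d * 'rV[R]_d))^nat & forall n, P n (G n)}.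
  apply: (@choice _ _ P) => n; rewrite /P.
  have Anfin : lebesgue_outer (A n) \is a fin_num.
    by rewrite ge0_fin_numE ?lebesgue_outer_ge0// ltey; exact/eqP/Aoo.
  have en1 : (0 < e%:num / (2 ^ n.+1)%:R)%R by [].
  have [_ [D [cD AD] <-] /ltW lD] := lb_ereal_inf_adherent en1 Anfin.
  by exists D.
apply: (@le_trans _ _ (\esum_(p in \bigcup_n G n) (box_volume p)%:E)).
  apply: ereal_inf_lbound; exists (\bigcup_n G n) => //; split.
    by apply: bigcup_countable => // n _; have [] := PG n.
  move=> x [n _ Anx]; have [_ /(_ _ Anx) [p Gp px] _] := PG n.
  by exists p => //; exists n.
rewrite seqDU_bigcup_eq esum_bigcupT; [|exact: trivIset_seqDU|]; last first.
  by move=> p; exact: box_volume_ge0.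
rewrite nneseries_esumT; last first.
  by move=> n; apply: adde_ge0; [exact: lebesgue_outer_ge0|rewrite lee_fin].
apply: le_esum => n _; have [_ _] := PG n; apply: le_trans.
rewrite esum_mkcond [leRHS]esum_mkcond; apply: le_esum => p _.
case: ifPn => [|_]; last by case: ifPn => // _; exact: box_volume_ge0.
by rewrite inE => Gnp; rewrite mem_set//; exact: subset_seqDU Gnp.
Qed.

HB.instance Definition _ := isOuterMeasure.Build R 'rV[R]_d lebesgue_outer
  lebesgue_outer0 lebesgue_outer_ge0 le_lebesgue_outer
  lebesgue_outer_sigma_subadditive.

Definition rVlebesgue : measurableType _ := caratheodory_type lebesgue_outer.

Definition lebesgue_rV : set rVlebesgue -> \bar R := lebesgue_outer.

Let lebesgue_rV_sigma_additive : semi_sigma_additive lebesgue_rV.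
Proof. exact: caratheodory_measure_sigma_additive. Qed.

HB.instance Definition _ := isMeasure.Build _ _ _ lebesgue_rV
  lebesgue_outer0 lebesgue_outer_ge0 lebesgue_rV_sigma_additive.

End LebesgueMeasure.

Section SetValuedMaps.
Context {R : realType} {d : nat}.
Local Notation E := 'rV[R]_d.

(* Values in R^d carry the Borel sigma-algebra. *)
Definition lebesgue_measurable (f : E -> E) : Prop :=
  measurable_fun [set: rVlebesgue R d] (f : _ -> g_sigma_algebraType (@open E)).

Definition upper_semicontinuous_map (Phi : E -> set E) : Prop :=
  forall x (V : set E), open V -> Phi x `<=` V ->
    \forall y \near x, Phi y `<=` V.

Definition cusco (Phi : E -> set E) : Prop :=
  upper_semicontinuous_map Phi /\
  forall x, [/\ Phi x !=set0, compact (Phi x) & convex_set (Phi x)].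

Definition closed_convex_hull (A : set E) : set E :=
  smallest [set C : set E | closed C /\ convex_set C] A.

Definition filippov (f : E -> E) (x : E) : set E :=
  \bigcap_(N in (@lebesgue_rV R d).-negligible)
    \bigcap_(r in [set r : R | 0 < r])
      closed_convex_hull (f @` (eball x r `\` N)).

End SetValuedMaps.

Section Clarke.
Context {R : realType} {d : nat}.
Implicit Types (phi : 'rV[R]_d -> R) (x h : 'rV[R]_d).

(* Local Lipschitz continuity does not depend on the choice of the norm. *)
Definition locally_lipschitz phi : Prop :=
  forall x, exists2 U, nbhs x U & exists k : R, k.-lipschitz_U phi.

Definition clarke_derivative phi x h : \bar R :=
  limf_esup
    (fun p : 'rV[R]_d * R => ((phi (p.1 + p.2 *: h) - phi p.1) / p.2)%:E)
    (filter_prod (nbhs x) (0^'+)).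

Definition clarke_subdifferential phi x : set 'rV[R]_d :=
  [set v | forall h, ((dotv v h)%:E <= clarke_derivative phi x h)%E].

End Clarke.

Section Poincare.
Context {R : realType} {d : nat}.
Implicit Types psi : 'rV[R]_d -> R.

Definition partial (i : 'I_d) psi : 'rV[R]_d -> R := 'D_(basisv i) psi.

Definition iter_partial (s : seq 'I_d) psi : 'rV[R]_d -> R :=
  foldr partial psi s.

(* C^oo: the partial derivatives of all orders exist and are continuous. *)
Definition smooth psi : Prop := forall s : seq 'I_d,
  continuous (iter_partial s psi) /\
  forall i x, derivable (iter_partial s psi) x (basisv i).

Definition compactly_supported psi : Prop :=
  compact (closure [set x | psi x != 0]).

Definition nonsmooth_poincare (f : 'rV[R]_d -> 'rV[R]_d) : Prop :=
  forall (i j : 'I_d) psi, smooth psi -> compactly_supported psi ->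
    (\int[@lebesgue_rV R d]_x (f x 0 j * partial i psi x)%:E =
     \int[@lebesgue_rV R d]_x (f x 0 i * partial j psi x)%:E)%E.

End Poincare.

(* Main.v *)
From HB Require Import structures.
Require Import Defs.
From mathcomp Require Import all_boot all_order all_algebra.
From mathcomp Require Import all_classical all_reals all_analysis.
From mathcomp Require Import measurable_realfun.
From mathcomp Require Import ring lra.

Set Implicit Arguments.
Unset Strict Implicit.
Unset Printing Implicit Defensive.

Import Order.TTheory GRing.Theory Num.Theory.
Import numFieldNormedType.Exports.

Local Open Scope classical_set_scope.
Local Open Scope ring_scope.

(** The theorem is about weak gradients.  A locally bounded measurable field f
    is a weak gradient of phi when the integral of phi times the i-th partial
    derivative of psi is minus the integral of f_i psi, for all test functions
    psi.  If phi is continuous and f is such a weak gradient, the values of f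
    near a point and the difference quotients of phi near that point control
    each other: from f(y).h <= c for almost all y near x one gets
    phi(y + th) - phi(y) <= ct for y near x and small t > 0
    ([ae_le_difference_quotient]), and conversely
    ([difference_quotient_le_ae]).  Both directions are seen on the
    mollifications of phi, whose gradients are the mollifications of f.  Now
    F_f(x) is an intersection of closed convex hulls of the values of f near x
    off null sets, so by separation it is cut out by the half-spaces that
    contain almost all values of f near x, whereas the Clarke subdifferential is cut
    out by the half-spaces given by bounds on difference quotients near x.
    Hence F_f is the Clarke subdifferential of phi whenever f is a weak
    gradient of phi, and the two implications ask respectively for a potential
    of a given field and for a well-chosen weak gradient of a given function.

    From the field to the function.  The distributional condition says that
    the mollified fields have symmetric Jacobian matrices, so integration along
    the rays from the origin provides smooth potentials of them
    ([closed_field_potential]).  As f is locally bounded, being a selection of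
    a cusco map, these potentials vanishing at 0 are equi-Lipschitz on bounded
    sets.  A limit of them along an ultrafilter is uniform on bounded sets, it
    is locally Lipschitz, and f is a weak gradient of it ([weak_potential]).

    From the function to the field.  A weak gradient of phi that is a selection
    of the Clarke subdifferential is found without differentiating phi: the
    fields satisfying quantitative versions of both requirements at scale 1/(n+1)
    form a decreasing sequence of convex sets ([approx_grad]), which are
    nonempty because they contain the gradient of the n-th mollification of
    phi.  Nearly minimizing a quadratic energy over each of them yields, by the
    parallelogram identity, a sequence with geometrically small L^2 increments
    on every cube, hence convergent almost everywhere; its limit satisfies both
    requirements, outside a null set where any selection will do
    ([clarke_measurable_selection]).  A weak gradient satisfies the
    distributional condition because second partial derivatives commute, and
    its Filippov regularization stays inside Phi by upper semicontinuity.

    The rest develops what these arguments need on R^d: measurability and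
    volume of boxes, invariance under translations, Fubini, mollifiers,
    integration by parts, and separation of a point from a closed convex set. *)

(** * Boxes and the measurable sets of R^d *)

Section BoxCovers.
Context {R : realType} {d : nat}.
Local Notation E := 'rV[R]_d.
Local Notation outer := (@lebesgue_outer R d).
Local Open Scope ereal_scope.

Lemma outer_box_le (p : E * E) : outer (box p) <= (box_volume p)%:E.
Proof.
apply: ereal_inf_lbound; exists [set p]; last first.
  by rewrite esum_set1//; exact: box_volume_ge0.
by split; [exact: countable1|rewrite bigcup_set1].
Qed.

Lemma outer_le_series (P : pred nat) (p : nat -> E * E) (A : set E) :
  A `<=` \bigcup_(n in [set n | P n]) box (p n) ->
  outer A <= \sum_(n <oo | P n) (box_volume (p n))%:E.
Proof.
move=> AP; pose B n := if P n then box (p n) else set0.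
have AB : A `<=` \bigcup_n B n.
  by move=> x /AP[n /= Pn pnx]; exists n => //; rewrite /B Pn.
apply: le_trans (le_outer_measure (@lebesgue_outer R d) _ _ AB) _.
apply: le_trans (outer_measure_sigma_subadditive _ B) _.
rewrite [leRHS]eseries_mkcond; apply: lee_nneseries => n _.
  by move=> _; exact: outer_measure_ge0.
rewrite /B; case: ifP => _; first exact: outer_box_le.
by rewrite outer_measure0.
Qed.

(** Turns the covers by countable sets of boxes in the definition of the outer
    measure into sequences; the predicate [P] accommodates finite covers. *)
Lemma outer_cover (A : set E) (x : \bar R) : outer A < x ->
  exists (P : pred nat) (p : nat -> E * E),
    A `<=` \bigcup_(n in [set n | P n]) box (p n) /\
    \sum_(n <oo | P n) (box_volume (p n))%:E < x.
Proof.
move=> /ereal_inf_lt[_ [D [cD AD] <-]] Dx.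
have /countable_injP[f finj] := cD.
pose P n := `[< exists2 q, D q & f q = n >].
have /choice[p Hp] : forall n, exists q : E * E, P n -> D q /\ f q = n.
  move=> n; have [/asboolP[q Dq fq]|nP] := boolP (P n); first by exists q.
  by exists (0%R, 0%R).
exists P, p; split.
  move=> y /AD[q Dq qy]; exists (f q); first by apply/asboolP; exists q.
  have [|Dp fp] := Hp (f q); first by apply/asboolP; exists q.
  by rewrite (finj _ _ _ _ fp) ?inE.
rewrite nneseries_esum; last by move=> n _; exact: box_volume_ge0.
rewrite (_ : \esum_(i in _) _ = \esum_(q in D) (box_volume q)%:E)//.
rewrite (reindex_esum D [set n | P n] f)//; last first.
  split => //.
  - by move=> q Dq /=; apply/asboolP; exists q.
  - by move=> n /= /asboolP[q Dq <-]; exists q.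
apply: eq_esum => q Dq; have [|Dp fp] := Hp (f q).
  by apply/asboolP; exists q.
by rewrite (finj _ _ _ _ fp) ?inE.
Qed.

End BoxCovers.

Section BoxMeasurability.
Context {R : realType} {d : nat}.
Local Notation E := 'rV[R]_d.
Local Notation outer := (@lebesgue_outer R d).

Definition low_half (i : 'I_d) (a : R) (p : E * E) : E * E :=
  (p.1, \row_j if j == i then Num.min (p.2 0 j) a else p.2 0 j).

Definition high_half (i : 'I_d) (a : R) (p : E * E) : E * E :=
  (\row_j if j == i then Num.max (p.1 0 j) a else p.1 0 j, p.2).

Lemma box_low_half i a p : box p `&` [set x | x 0 i <= a] `<=` box (low_half i a p).
Proof.
move=> x [px /= xa] j; rewrite /= mxE; have /andP[-> /= p2] := px j.
by case: eqP => // ->; rewrite le_min xa andbT; have /andP[] := px i.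
Qed.

Lemma box_high_half i a p :
  box p `&` ~` [set x | x 0 i <= a] `<=` box (high_half i a p).
Proof.
move=> x [px /= /negP]; rewrite -ltNge => xa j; rewrite /= mxE.
have /andP[p1 ->] := px j; rewrite andbT.
by case: eqP => [ji|//]; rewrite gt_max p1 ji.
Qed.

Lemma box_volume_half i a p :
  box_volume (low_half i a p) + box_volume (high_half i a p) = box_volume p.
Proof.
rewrite /box_volume (bigD1 i)//= [X in _ + X](bigD1 i)//= [RHS](bigD1 i)//=.
rewrite (eq_bigr (fun j => Num.max 0 (p.2 0 j - p.1 0 j))); last first.
  by move=> j /negbTE ji; rewrite mxE ji.
rewrite [X in _ + _ * X](eq_bigr (fun j => Num.max 0 (p.2 0 j - p.1 0 j))).
  rewrite -mulrDl; congr (_ * _); rewrite !mxE eqxx.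
  set b := p.2 0 i; set l := p.1 0 i.
  case: (leP b a) => ba; case: (leP l a) => la.
  - by rewrite [X in _ + X]max_l ?addr0// subr_le0.
  - rewrite [Num.max 0 (b - l)]max_l ?addr0//; last first.
      by rewrite subr_le0 ltW// (le_lt_trans ba).
  - rewrite !max_r ?subr_ge0 ?(ltW ba)//; first by rewrite addrC subrKA.
    by rewrite (le_trans la) ?(ltW ba).
  - by rewrite [X in X + _]max_l ?add0r// subr_le0 ltW.
by move=> j /negbTE ji; rewrite mxE ji.
Qed.

(** A hyperplane orthogonal to a coordinate axis cuts each box of a cover into
    two boxes whose volumes add up, so it splits outer measure additively. *)
Lemma halfspace_caratheodory i a : outer.-caratheodory [set x : E | x 0 i <= a].
Proof.
apply: le_caratheodory_measurable => X; rewrite leNgt; apply/negP.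
move=> /outer_cover[P [p [XP]]]; apply/negP; rewrite -leNgt.
under eq_eseriesr do rewrite -(box_volume_half i a) EFinD.
rewrite nneseriesD; [|by move=> *; exact: box_volume_ge0..].
apply: leeD; apply: outer_le_series => x [/XP[n Pn pnx] xa]; exists n => //.
  exact: box_low_half.
exact: box_high_half.
Qed.

Local Notation mE := (rVlebesgue R d).

Lemma measurable_coord (i : 'I_d) : measurable_fun [set: mE] (fun x : E => x 0 i).
Proof.
apply: (measurability _ (RGenOInfty.measurableE R)) => _ [_ [a ->] <-].
rewrite setTI (_ : _ @^-1` _ = ~` [set x : E | x 0 i <= a]).
  exact/caratheodory_measurable_setC/halfspace_caratheodory.
by apply/seteqP; split=> x /=; rewrite in_itv/= andbT ltNge => /negP.
Qed.

Lemma measurable_box p : measurable (box p : set mE).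
Proof.
rewrite (_ : box p = \big[setI/setT]_(i < d)
    ((fun x : E => x 0 i) @^-1` `]p.1 0 i, p.2 0 i])).
  apply: bigsetI_measurable => i _; rewrite -[X in measurable X]setTI.
  exact: measurable_coord.
apply/seteqP; split => x.
  move=> px; rewrite -bigcap_seq => i _ /=; rewrite in_itv/=; exact: px.
by rewrite -bigcap_seq => px i; have /= := px i; rewrite in_itv/= mem_index_enum; apply.
Qed.

(** Boxes with rational corners are countably many, which is what makes open
    sets measurable. *)
Lemma open_bigcup_box (U : set E) : open U ->
  U = \bigcup_(q in [set q : 'rV[rat]_d * 'rV[rat]_d |
      box (map_mx ratr q.1, map_mx ratr q.2) `<=` U])
    box (map_mx ratr q.1, map_mx ratr q.2).
Proof.
move=> oU; apply/seteqP; split=> x; last by move=> [q qU /qU].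
move=> Ux; have /nbhs_ballP[e /= e0 eU] := open_nbhs_nbhs (conj oU Ux).
have /choice[l Hl] : forall i : 'I_d, exists q : rat,
    ratr q \in `]x 0 i - e / 2, x 0 i[.
  move=> i; apply: rat_in_itvoo; lra.
have /choice[r Hr] : forall i : 'I_d, exists q : rat,
    ratr q \in `]x 0 i, x 0 i + e / 2[.
  move=> i; apply: rat_in_itvoo; lra.
exists (\row_i l i, \row_i r i).
  move=> y /= yb; apply: eU; split => // i j; rewrite ord1.
  have := yb j; rewrite /= !mxE; have := Hl j; have := Hr j.
  rewrite !in_itv/= => /andP[r1 r2] /andP[l1 l2] /andP[y1 y2].
  by rewrite /ball/= ltr_norml; apply/andP; split; lra.
move=> j; rewrite /= !mxE; have := Hl j; have := Hr j.
by rewrite !in_itv/= => /andP[r1 r2] /andP[l1 l2]; rewrite l2 ltW.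
Qed.

Lemma open_measurable_rV (U : set E) : open U -> measurable (U : set mE).
Proof.
move=> /open_bigcup_box ->; rewrite bigcup_mkcond.
apply: countable_bigcupT_measurable; first exact: countableP.
by move=> q; case: ifP => // _; exact: measurable_box.
Qed.

Lemma continuous_measurable_rV (g : E -> R) :
  continuous g -> measurable_fun [set: mE] g.
Proof.
move=> cg; apply: (measurability _ (RGenOpens.measurableE R)).
move=> _ [_ [a [b ->]] <-]; rewrite setTI; apply: open_measurable_rV.
apply: open_comp; last exact: interval_open.
by move=> x _; exact: cg.
Qed.

Lemma negligible_measurable (N : set mE) :
  (@lebesgue_rV R d).-negligible N -> measurable N.
Proof. exact: measure_is_complete_caratheodory. Qed.
End BoxMeasurability.

Section BoxVolume.
Context {R : realType}.
Local Open Scope ereal_scope.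

(** Weighted covers: if weighted boxes pile up to at least 1 on a box, their
    weighted volume is at least that of the box.  Allowing weights makes an
    induction on the dimension possible, because the slice of a cover by a
    hyperplane is again a weighted cover, and integrating the inequality for
    the slices over the first coordinate gives the next dimension. *)
Lemma ge0_le_series_volume (d : nat) (a b : 'I_d -> R) (c : nat -> R)
    (l r : nat -> 'I_d -> R) :
  (forall i, a i <= b i)%R -> (forall n, 0 <= c n)%R ->
  (forall x : 'I_d -> R, (forall i, a i < x i <= b i)%R ->
    1 <= \sum_(n <oo) (c n * [forall i, (l n i < x i <= r n i)%R]%:R)%:E) ->
  (\prod_(i < d) (b i - a i))%:E <=
    \sum_(n <oo) (c n * \prod_(i < d) Num.max 0 (r n i - l n i))%:E.
Proof.
elim: d a b c l r => [|d IH] a b c l r ab c0 cov.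
  rewrite big_ord0; apply: le_trans (cov (fun=> 0%R) _) _; first by case.
  apply: lee_nneseries => n _; first by move=> _; rewrite lee_fin mulr_ge0.
  by rewrite big_ord0 lee_fin ler_wpM2l// lern1 leq_b1.
pose V n := (\prod_(i < d) Num.max 0 (r n (lift ord0 i) - l n (lift ord0 i)))%R.
have V0 n : (0 <= V n)%R by apply: prodr_ge0 => i _; rewrite le_max lexx.
set P := (\prod_(i < d) (b (lift ord0 i) - a (lift ord0 i)))%R.
(* The slice at height t carries the weight of each box whose first side contains t. *)
have slice (t : R) : t \in `]a ord0, b ord0] ->
    P%:E <= \sum_(n <oo) (c n * V n * \1_(`]l n ord0, r n ord0]) t)%:E.
  move=> tab.
  apply: le_trans (IH _ _ (fun n => c n * \1_(`]l n ord0, r n ord0]) t)%R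
    (fun n i => l n (lift ord0 i)) (fun n i => r n (lift ord0 i)) _ _ _) _ => //.
  - by move=> n; rewrite mulr_ge0.
  - move=> x xab; pose y i := oapp x t (unlift ord0 i).
    apply: le_trans (cov y _) _.
      move=> i; rewrite /y; case: unliftP => [j ->|->] /=; first exact: xab.
      by move: tab; rewrite in_itv.
    apply: lee_nneseries => n _.
      by move=> _; rewrite lee_fin mulr_ge0.
    rewrite lee_fin -mulrA ler_wpM2l// indicE -natrM mulnb ler_nat.
    case: forallP => // H; rewrite leqNgt ltnS leqn0 eqb0 negbK; apply/andP; split.
      by have := H ord0; rewrite /y unlift_none/= inE/= in_itv.
    by apply/forallP => i; have := H (lift ord0 i); rewrite /y liftK.
  - apply: lee_nneseries => n _; last by rewrite lee_fin mulrAC.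
    by move=> _; rewrite lee_fin !mulr_ge0// V0.
rewrite big_ord_recl -/P.
have mI (u v : R) : measurable (`]u, v]%classic : set R) by exact: measurable_itv.
have -> : ((b ord0 - a ord0) * P)%:E =
    \int[@lebesgue_measure R]_(t in `]a ord0, b ord0]) (cst P%:E t).
  rewrite integral_cst//= lebesgue_measure_itv/= lte_fin mulrC EFinM.
  case: ltP => [_|ba]; first by rewrite EFinB.
  by have -> : b ord0 = a ord0; [apply/eqP; rewrite eq_le ba ab|rewrite subrr].
apply: (@le_trans _ _ (\int[@lebesgue_measure R]_(t in `]a ord0, b ord0])
   (\sum_(n <oo) (c n * V n * \1_(`]l n ord0, r n ord0]) t)%:E))).
  apply: ge0_le_integral => //.
  - by move=> t _; rewrite lee_fin prodr_ge0// => i _; rewrite subr_ge0.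
  - apply: ge0_emeasurable_sum => n *; first by rewrite lee_fin !mulr_ge0.
    by apply/measurable_EFinP; apply: measurable_funM => //.
rewrite integral_nneseries//; last 2 first.
- by move=> n; apply/measurable_EFinP; apply: measurable_funM.
- by move=> n t _; rewrite lee_fin !mulr_ge0.
apply: lee_nneseries => n _; first by move=> _; apply: integral_ge0 => t _; rewrite lee_fin !mulr_ge0.
under eq_integral do rewrite EFinM.
rewrite ge0_integralZl//; last 2 first.
- by apply/measurable_EFinP.
- by rewrite lee_fin mulr_ge0.
rewrite big_ord_recl -/(V n) [in leRHS](mulrC (Num.max _ _)) mulrA [leRHS]EFinM.
apply: lee_wpmul2l; first by rewrite lee_fin mulr_ge0.
rewrite integral_indic//= (le_trans (measureIl _ _ _))//.
rewrite /= lebesgue_measure_itv/= lte_fin.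
by case: ltP => lr; rewrite ?EFinB lee_fin le_max lexx ?orbT.
Qed.

Lemma lebesgue_box (d : nat) (p : 'rV[R]_d * 'rV[R]_d) :
  (forall i, p.1 0 i <= p.2 0 i)%R ->
  lebesgue_rV (box p) = (box_volume p)%:E.
Proof.
move=> p12; apply/eqP; rewrite eq_le; apply/andP; split; first exact: outer_box_le.
rewrite leNgt; apply/negP => /outer_cover[P [q [pq]]]; apply/negP; rewrite -leNgt.
rewrite (_ : box_volume p = \prod_(i < d) (p.2 0 i - p.1 0 i))%R; last first.
  by apply: eq_bigr => i _; rewrite max_r// subr_ge0.
apply: le_trans (@ge0_le_series_volume d _ _ (fun n => (P n)%:R)
    (fun n i => (q n).1 0%R i) (fun n i => (q n).2 0%R i) _ _ _) _ => //.
  move=> x xp; have [|n /= Pn qx] := pq (\row_i x i).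
    by move=> i; rewrite mxE.
  apply: le_trans (nneseries_lim_ge n.+1 _); last first.
    by move=> *; rewrite lee_fin mulr_ge0.
  rewrite big_mkord big_ord_recr/= Pn mul1r (_ : [forall i, _] = true); last first.
    by apply/forallP => i; have := qx i; rewrite mxE.
  by rewrite leeDr// sume_ge0// => *; rewrite lee_fin mulr_ge0.
rewrite [leRHS]eseries_mkcond; apply: lee_nneseries => n _.
  by move=> _; rewrite lee_fin mulr_ge0// prodr_ge0// => i _; rewrite le_max lexx.
by case: (P n); rewrite ?mul1r ?mul0r.
Qed.

End BoxVolume.

(** * Translations, cubes and integrals of bounded functions with bounded support *)

Section Shift.
Context {R : realType} {d : nat}.
Local Notation E := 'rV[R]_d.
Local Notation mE := (rVlebesgue R d).
Local Notation outer := (@lebesgue_outer R d).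
Local Open Scope ereal_scope.

(** A cover translates to a cover of the same volume. *)
Lemma outer_shift_le (a : E) (A : set E) : outer [set x | A (x + a)%R] <= outer A.
Proof.
rewrite leNgt; apply/negP => /outer_cover[P [p [AP]]]; apply/negP; rewrite -leNgt.
pose q n : E * E := ((p n).1 - a, (p n).2 - a)%R.
apply: (@le_trans _ _ (\sum_(n <oo | P n) (box_volume (q n))%:E)).
  apply: outer_le_series => x /= /AP[n /= Pn pnx]; exists n => // i.
  have := pnx i; rewrite /= !mxE => /andP[h1 h2].
  by rewrite ltrBlDr h1 lerBrDr h2.
rewrite le_eqVlt; apply/orP; left; apply/eqP; apply: eq_eseriesr => n _.
congr EFin; apply: eq_bigr => i _; rewrite !mxE; congr (Num.max 0 _)%R.
by lra.
Qed.

Lemma outer_shift (a : E) (A : set E) : outer [set x | A (x + a)%R] = outer A.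
Proof.
apply/eqP; rewrite eq_le outer_shift_le/=.
rewrite [X in outer X <= _](_ : A = [set x | [set y | A (y + a)%R] (x - a)%R]).
  exact: outer_shift_le.
by apply/seteqP; split => x /=; rewrite subrK.
Qed.

Definition shiftv (a : E) : mE -> mE := fun x : E => (x + a)%R.

Lemma measurable_shift (a : E) : measurable_fun [set: mE] (shiftv a).
Proof.
move=> _ A mA; rewrite setTI.
suff: outer.-caratheodory (shiftv a @^-1` A) by [].
move=> X.
have key (B : set E) : outer (X `&` shiftv a @^-1` B) =
    outer ([set x | X (x - a)%R] `&` B).
  rewrite -(outer_shift a (_ `&` B)); congr outer.
  by apply/seteqP; split => x /=; rewrite /shiftv addrK.
rewrite -(outer_shift (- a)%R X) preimage_setC 2!key; exact: mA.
Qed.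

End Shift.

Section Cubes.
Context {R : realType} {d : nat}.
Local Notation E := 'rV[R]_d.
Local Notation mE := (rVlebesgue R d).
Local Notation mu := (@lebesgue_rV R d).

Lemma le_coord_norm (x : E) i : `|x 0 i| <= `|x|.
Proof.
rewrite [leRHS]/Num.norm /= mx_normrE.
by apply/bigmax_geP; right => /=; exists (0, i).
Qed.

Lemma norm_le_coord (x : E) (r : R) : 0 <= r -> (forall i, `|x 0 i| <= r) -> `|x| <= r.
Proof.
move=> r0 xr; rewrite [leLHS]/Num.norm /= mx_normrE.
by apply/bigmax_leP; split => // -[i j] _; rewrite ord1; exact: xr.
Qed.

Definition cube (r : R) : set E := [set x | `|x| <= r].

Lemma compact_cube r : compact (cube r).
Proof.
apply: bounded_closed_compact.
  exists r; split; first exact: num_real.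
  by move=> M rM x /= xr; rewrite (le_trans xr)// ltW.
apply: (@closed_comp _ _ (fun x : E => `|x|) [set t : R | t <= r]); last exact: closed_le.
by move=> x _; exact: norm_continuous.
Qed.

Lemma measurable_norm_rV : measurable_fun [set: mE] (fun x : E => `|x|).
Proof. by apply: continuous_measurable_rV => x; exact: norm_continuous. Qed.

Lemma measurable_cube r : measurable (cube r : set mE).
Proof.
rewrite (_ : cube r = (fun x : E => `|x|) @^-1` `]-oo, r]).
  by rewrite -[X in measurable X]setTI; exact: measurable_norm_rV.
by apply/seteqP; split => x /=; rewrite in_itv.
Qed.

Lemma lebesgue_cube_lty r : (mu (cube r) < +oo)%E.
Proof.
pose p : E * E := (const_mx (- r - 1), const_mx r).
apply: (@le_lt_trans _ _ (box_volume p)%:E); last exact: ltry.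
apply: le_trans (outer_box_le p); apply: (le_outer_measure (@lebesgue_outer R d)).
move=> x /= xr i; rewrite /= !mxE.
have := le_trans (le_coord_norm x i) xr; rewrite ler_norml => /andP[h1 ->].
by rewrite andbT (lt_le_trans _ h1)// ltrBlDr ltrDl.
Qed.

Lemma lebesgue_rV_sigma_finite : sigma_finite [set: mE] mu.
Proof.
exists (fun n => cube n%:R) => [|n]; last first.
  by split; [exact: measurable_cube|exact: lebesgue_cube_lty].
apply/esym/seteqP; split => // x _; exists (Num.bound `|x|) => //.
by rewrite /cube/= ltW// archi_boundP.
Qed.

HB.instance Definition _ := @Measure_isSigmaFinite.Build _ _ _ mu lebesgue_rV_sigma_finite.

End Cubes.

Section TameFunctions.
Context {R : realType} {d : nat}.
Local Notation E := 'rV[R]_d.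
Local Notation mE := (rVlebesgue R d).
Local Notation mu := (@lebesgue_rV R d).
Implicit Types u v g : E -> R.

(** Locally bounded measurable functions: the multipliers of the integrable
    functions with bounded support used below. *)
Record lbm g : Prop := Lbm {
  lbm_measurable : measurable_fun [set: mE] g;
  lbm_bounded : forall r, exists M : R, forall x, `|x| <= r -> `|g x| <= M }.

(** Vanishing outside a cube is equivalent to having a compact closed support,
    see [compactly_supportedP], and is stable under the operations used here
    without any topology. *)
Definition csupp g := exists r : R, forall x, r < `|x| -> g x = 0.

(** The functions that are integrated below; they form a module over [lbm], so
    that integrability is checked by algebraic rules alone. *)
Record tame g : Prop := Tame { tame_lbm : lbm g; tame_csupp : csupp g }.

Lemma lbm_cst c : lbm (cst c).
Proof. by split; [exact: measurable_cst|move=> r; exists `|c|]. Qed.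

Lemma lbmD u v : lbm u -> lbm v -> lbm (u \+ v).
Proof.
move=> [mu_ bu] [mv bv]; split; first exact: measurable_funD.
move=> r; have [M uM] := bu r; have [N vN] := bv r; exists (M + N) => x xr.
by rewrite (le_trans (ler_normD _ _))// lerD ?uM ?vN.
Qed.

Lemma lbmM u v : lbm u -> lbm v -> lbm (u \* v).
Proof.
move=> [mu_ bu] [mv bv]; split; first exact: measurable_funM.
move=> r; have [M uM] := bu r; have [N vN] := bv r; exists (M * N) => x xr.
by rewrite normrM ler_pM ?uM ?vN.
Qed.

Lemma lbmZ c u : lbm u -> lbm (fun x => c * u x).
Proof. by move=> lu; apply: (lbmM (lbm_cst c) lu). Qed.

Lemma lbmN u : lbm u -> lbm (\- u).
Proof.
move=> /(lbmZ (-1)); congr lbm; apply/funext => x; exact: mulN1r.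
Qed.

Lemma lbmB u v : lbm u -> lbm v -> lbm (u \- v).
Proof. by move=> lu /lbmN; exact: lbmD. Qed.

Lemma lbm_sum (I : Type) (s : seq I) (h : I -> E -> R) :
  (forall i, lbm (h i)) -> lbm (fun x => \sum_(i <- s) h i x).
Proof.
move=> lh; elim: s => [|i s IH].
  by under eq_fun do rewrite big_nil; exact: lbm_cst.
by under eq_fun do rewrite big_cons; exact: lbmD.
Qed.

Lemma lbm_shift a u : lbm u -> lbm (fun x => u (x + a)).
Proof.
move=> [mu_ bu]; split.
  exact: (measurableT_comp mu_ (measurable_shift a)).
move=> r; have [M uM] := bu (r + `|a|); exists M => x xr; apply: uM.
by rewrite (le_trans (ler_normD _ _))// lerD.
Qed.

Lemma lbm_norm u : lbm u -> lbm (fun x => `|u x|).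
Proof.
move=> [mu_ bu]; split; first exact: measurableT_comp.
by move=> r; have [M uM] := bu r; exists M => x xr; rewrite normr_id uM.
Qed.

Lemma continuous_bounded_cube g r : continuous g ->
  exists M : R, forall x, `|x| <= r -> `|g x| <= M.
Proof.
move=> cg; have : compact [set g x | x in cube r].
  by apply: continuous_compact; [exact: continuous_subspaceT|exact: compact_cube].
move=> /compact_bounded[M [_ /(_ (M + 1))]]; rewrite ltrDl ltr01 => /(_ isT) gM.
by exists (M + 1) => x xr; apply: gM; exists x.
Qed.

Lemma continuous_lbm g : continuous g -> lbm g.
Proof.
move=> cg; split; first exact: continuous_measurable_rV.
by move=> r; exact: continuous_bounded_cube.
Qed.

Lemma csuppMl u v : csupp u -> csupp (u \* v).
Proof. by move=> [r ur]; exists r => x /ur ux; rewrite /= ux mul0r. Qed.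

Lemma csuppMr u v : csupp v -> csupp (u \* v).
Proof. by move=> [r ur]; exists r => x /ur ux; rewrite /= ux mulr0. Qed.

Lemma csuppD u v : csupp u -> csupp v -> csupp (u \+ v).
Proof.
move=> [r ur] [s vs]; exists (Num.max r s) => x.
by rewrite gt_max => /andP[/ur ux /vs vx]; rewrite /= ux vx addr0.
Qed.

Lemma csuppZ c u : csupp u -> csupp (fun x => c * u x).
Proof. by move=> [r ur]; exists r => x /ur ->; rewrite mulr0. Qed.

Lemma csupp_shift a u : csupp u -> csupp (fun x => u (x + a)).
Proof.
move=> [r ur]; exists (r + `|a|) => x xr; apply: ur; rewrite -ltrBrDr in xr.
by rewrite (lt_le_trans xr)// lerBlDr -{1}(addrK a x) (le_trans (ler_normB _ _)).
Qed.

Lemma tameD u v : tame u -> tame v -> tame (u \+ v).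
Proof. by move=> [? ?] [? ?]; split; [exact: lbmD|exact: csuppD]. Qed.

Lemma tameZ c u : tame u -> tame (fun x => c * u x).
Proof. by move=> [? ?]; split; [exact: lbmZ|exact: csuppZ]. Qed.

Lemma tameN u : tame u -> tame (\- u).
Proof.
move=> /(tameZ (-1)); congr tame; apply/funext => x; exact: mulN1r.
Qed.

Lemma tameB u v : tame u -> tame v -> tame (u \- v).
Proof. by move=> lu /tameN; exact: tameD. Qed.

Lemma tame_lbmM u v : lbm u -> tame v -> tame (u \* v).
Proof. by move=> ? [? ?]; split; [exact: lbmM|exact: csuppMr]. Qed.

Lemma tame_shift a u : tame u -> tame (fun x => u (x + a)).
Proof. by move=> [? ?]; split; [exact: lbm_shift|exact: csupp_shift]. Qed.

Lemma tame_norm u : tame u -> tame (fun x => `|u x|).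
Proof.
by move=> [? [r ur]]; split; [exact: lbm_norm|exists r => x /ur ->; rewrite normr0].
Qed.

Lemma tame0 : tame (cst 0).
Proof. by split; [exact: lbm_cst|exists 0]. Qed.

Lemma tame_cube r : tame (\1_(cube r)).
Proof.
split; last first.
  exists r => x xr; rewrite indicE memNset//= /cube/=; apply/negP.
  by rewrite -ltNge.
split; first by apply: measurable_indic; exact: measurable_cube.
by move=> s; exists 1 => x _; rewrite indicE; case: (_ \in _); rewrite ?normr1// normr0.
Qed.

Lemma tame_integrable u : tame u -> mu.-integrable [set: mE] (EFin \o u).
Proof.
move=> [[mu_ bu] [r ur]].
apply: (@eq_integrable _ _ _ mu setT measurableT ((EFin \o u) \_ (cube r))).
  move=> x _ /=; rewrite patchE; case: ifPn => //; rewrite notin_setE /cube/= => /negP.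
  by rewrite -ltNge => /ur ->.
apply/(integrable_mkcond _ (measurable_cube r)).1.
apply: measurable_bounded_integrable => //.
- exact: measurable_cube.
- exact: lebesgue_cube_lty.
- exact: measurable_funTS.
- have [M uM] := bu r; exists M; split; first exact: num_real.
  by move=> N MN x /= xr; rewrite (le_trans (uM _ xr))// ltW.
Qed.

Definition integ u : R := (\int[mu]_x u x)%R.

Lemma integE u : tame u -> (\int[mu]_x (u x)%:E)%E = (integ u)%:E.
Proof.
by move=> tu; rewrite fineK//; apply: integrable_fin_num => //; exact: tame_integrable.
Qed.

Lemma integD u v : tame u -> tame v -> integ (u \+ v) = integ u + integ v.
Proof.
by move=> *; apply: RintegralD => //; exact: tame_integrable.
Qed.

Lemma integZ c u : tame u -> integ (fun x => c * u x) = c * integ u.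
Proof. by move=> *; apply: RintegralZl => //; exact: tame_integrable. Qed.

Lemma integB u v : tame u -> tame v -> integ (u \- v) = integ u - integ v.
Proof. by move=> *; apply: RintegralB => //; exact: tame_integrable. Qed.

Lemma integN u : tame u -> integ (\- u) = - integ u.
Proof.
move=> tu; rewrite -mulN1r -integZ//; congr integ.
by apply/funext => x; rewrite mulN1r.
Qed.

Lemma integ0 : integ (cst 0) = 0.
Proof. by rewrite /integ /Rintegral integral0. Qed.

Lemma integ_sum (I : Type) (s : seq I) (h : I -> E -> R) :
  (forall i, tame (h i)) ->
  tame (fun x => \sum_(i <- s) h i x) /\
  integ (fun x => \sum_(i <- s) h i x) = \sum_(i <- s) integ (h i).
Proof.
move=> th; elim: s => [|i s [tS IH]].
  under eq_fun do rewrite big_nil; rewrite big_nil; split; first exact: tame0.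
  exact: integ0.
under eq_fun do rewrite big_cons; rewrite big_cons; split; first exact: tameD.
by rewrite -IH; exact: integD.
Qed.

Lemma le_integ u v : tame u -> tame v -> (forall x, u x <= v x) -> integ u <= integ v.
Proof.
by move=> *; apply: le_Rintegral => //; exact: tame_integrable.
Qed.

Lemma integ_abs_le u : tame u -> `|integ u| <= integ (fun x => `|u x|).
Proof. by move=> tu; apply: le_normr_Rintegral => //; exact: tame_integrable. Qed.

Lemma ae_le_integ u v (N : set mE) : mu.-negligible N -> tame u -> tame v ->
  (forall x, ~ N x -> u x <= v x) -> integ u <= integ v.
Proof.
move=> nN tu tv uv; have mN := negligible_measurable nN.
(* Both integrals are unchanged when the functions are set to 0 on N. *)
have li : lbm (\1_(~` N)).
  split; first by apply: measurable_indic; exact: measurableC.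
  by move=> r; exists 1 => x _; rewrite indicE; case: (_ \in _); rewrite ?normr1// normr0.
have tN w : tame w -> tame (fun x => w x * \1_(~` N) x).
  by move=> [lw cw]; split; [exact: lbmM|exact: csuppMl].
have eqN w : tame w -> integ w = integ (fun x => w x * \1_(~` N) x).
  move=> tw; have [[mw' _] _] := tN _ tw; have [[mw _] _] := tw.
  rewrite /integ /Rintegral; congr fine.
  have := @ae_eq_integral _ mE R mu setT (EFin \o (fun x => w x * \1_(~` N) x)) (EFin \o w).
  apply; [by []|exact/measurable_EFinP|exact/measurable_EFinP|].
  apply: negligibleS nN => x /= xN; apply: contrapT => nNx; apply: xN => _.
  by rewrite /= indicE mem_set//= mulr1.
rewrite (eqN _ tu) (eqN _ tv); apply: le_integ; [exact: tN|exact: tN|] => x.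
have [/set_mem Nx|/negP Nx] := boolP (x \in N); first by rewrite !indicE memNset/= ?mulr0//; apply.
by rewrite ler_wpM2r// uv// => /mem_set.
Qed.

Lemma integ_shift a u : tame u -> integ (fun x => u (x + a)) = integ u.
Proof.
move=> tu; rewrite /integ /Rintegral; congr fine; apply/esym.
have mu_ : measurable_fun [set: mE] (EFin \o u).
  by apply/measurable_EFinP; case: tu => [[]].
have := @integral_pushforward _ _ mE mE R _ (measurable_shift a) mu setT _ mu_
  (tame_integrable (tame_shift a tu)) measurableT.
apply: etrans; apply: eq_measure_integral; first exact: measurable_shift.
by move=> ? A mA _; exact: (esym (outer_shift a A)).
Qed.

(** Dominated convergence, the dominating function being a multiple of the
    indicator of a cube. *)
Lemma integ_cvg (u_ : nat -> E -> R) u (r M : R) (N : set mE) :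
  mu.-negligible N ->
  (forall n, measurable_fun [set: mE] (u_ n)) -> measurable_fun [set: mE] u ->
  (forall n x, `|x| <= r -> `|u_ n x| <= M) ->
  (forall n x, r < `|x| -> u_ n x = 0) ->
  (forall x, ~ N x -> u_ n x @[n --> \oo] --> u x) ->
  integ (u_ n) @[n --> \oo] --> integ u.
Proof.
move=> nN mu_ mu0 uM ur uu.
have [|||||uI _ h] := @dominated_convergence _ mE R mu setT measurableT
   (fun n => EFin \o u_ n) (EFin \o u) (EFin \o (fun x => `|M| * \1_(cube r) x)).
- by move=> n; exact/measurable_EFinP.
- exact/measurable_EFinP.
- apply: negligibleS nN => x /= xN; apply: contrapT => nNx; apply: xN => _.
  by apply: cvg_EFin; [exact: nearW|exact: uu].
- by apply: tame_integrable; apply: tameZ; exact: tame_cube.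
- apply: aeW => x n _ /=; rewrite lee_fin indicE.
  have [xr|xr] := leP `|x| r.
    by rewrite mem_set//= mulr1 (le_trans (uM _ _ xr))// ler_norm.
  by rewrite ur// normr0 mulr_ge0.
apply: fine_cvg; rewrite fineK//.
exact: integrable_fin_num.
Qed.

End TameFunctions.

(** * Fubini, outer approximation and the sign of a function from its integrals *)

Section ContinuousReal.
Context {R : realType} {T : topologicalType}.
Implicit Types f g : T -> R.

Lemma contD f g : continuous f -> continuous g -> continuous (fun x => f x + g x).
Proof. by move=> cf cg x; apply: continuousD; [exact: cf|exact: cg]. Qed.

Lemma contB f g : continuous f -> continuous g -> continuous (fun x => f x - g x).
Proof. by move=> cf cg x; apply: continuousB; [exact: cf|exact: cg]. Qed.

Lemma contM f g : continuous f -> continuous g -> continuous (fun x => f x * g x).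
Proof. by move=> cf cg x; apply: continuousM; [exact: cf|exact: cg]. Qed.

Lemma contmax f g : continuous f -> continuous g -> continuous (fun x => Num.max (f x) (g x)).
Proof. by move=> cf cg x; apply: continuous_max; [exact: cf|exact: cg]. Qed.

Lemma contmin f g : continuous f -> continuous g -> continuous (fun x => Num.min (f x) (g x)).
Proof. by move=> cf cg x; apply: continuous_min; [exact: cf|exact: cg]. Qed.

Lemma continuous_prod (I : Type) (s : seq I) (h : I -> T -> R) :
  (forall i, continuous (h i)) -> continuous (fun x => \prod_(i <- s) h i x).
Proof.
move=> ch; elim: s => [|i s IH].
  by under eq_fun do rewrite big_nil; exact: cst_continuous.
by under eq_fun do rewrite big_cons; apply: contM.
Qed.

Lemma continuous_sum (I : Type) (s : seq I) (h : I -> T -> R) :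
  (forall i, continuous (h i)) -> continuous (fun x => \sum_(i <- s) h i x).
Proof.
move=> ch; elim: s => [|i s IH].
  by under eq_fun do rewrite big_nil; exact: cst_continuous.
by under eq_fun do rewrite big_cons; apply: contD.
Qed.

End ContinuousReal.

Section MeasurableMaps.
Context {R : realType} {d : nat} {disp : measure_display} {T : measurableType disp}.
Local Notation E := 'rV[R]_d.

Lemma measurable_preimage_open (h : T -> E) (U : set E) :
  (forall i, measurable_fun [set: T] (fun t => h t 0 i)) -> open U ->
  measurable (h @^-1` U).
Proof.
move=> mh /open_bigcup_box ->; rewrite preimage_bigcup bigcup_mkcond.
apply: countable_bigcupT_measurable; first exact: countableP.
move=> q; case: ifP => // _.
set p := (_, _).
rewrite (_ : _ @^-1` _ = \big[setI/setT]_(i < d)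
    ((fun t => h t 0 i) @^-1` `]p.1 0 i, p.2 0 i])).
  apply: bigsetI_measurable => i _; rewrite -[X in measurable X]setTI.
  exact: mh.
apply/seteqP; split => x.
  by move=> px; rewrite -bigcap_seq => i _ /=; rewrite in_itv/=; exact: px.
rewrite -bigcap_seq => px i; have /= := px i.
by rewrite in_itv/= mem_index_enum; apply.
Qed.

Lemma continuous_measurable_comp (h : T -> E) (g : E -> R) :
  (forall i, measurable_fun [set: T] (fun t => h t 0 i)) -> continuous g ->
  measurable_fun [set: T] (g \o h).
Proof.
move=> mh cg; apply: (measurability _ (RGenOpens.measurableE R)).
move=> _ [_ [a [b ->]] <-]; rewrite setTI comp_preimage.
apply: measurable_preimage_open => //; apply: open_comp; last exact: interval_open.
by move=> x _; exact: cg.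
Qed.

End MeasurableMaps.

Section IterationOrder.
Context {R : realType} {d : nat}.
Local Notation E := 'rV[R]_d.
Local Notation mE := (rVlebesgue R d).
Local Notation mu := (@lebesgue_rV R d).

Lemma integ_fubini (F : E -> E -> R) (r M : R) :
  measurable_fun [set: mE * mE] (fun z : mE * mE => F z.1 z.2) ->
  (forall x y, `|F x y| <= M) ->
  (forall x y, r < `|x| \/ r < `|y| -> F x y = 0) ->
  integ (fun x => integ (F x)) = integ (fun y => integ (F ^~ y)).
Proof.
move=> mF bF sF.
have t1 x : tame (F x).
  split; last by exists r => y ry; apply: sF; right.
  split; last by move=> s; exists M => y _.
  by have := measurableT_comp mF (measurable_pair1 (x : mE)).
have t2 y : tame (F ^~ y).
  split; last by exists r => x rx; apply: sF; left.
  split; last by move=> s; exists M => x _.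
  by have := measurableT_comp mF (measurable_pair2 (y : mE)).
pose msf := [the {sigma_finite_measure set mE -> \bar R} of mu].
have mF' : measurable_fun [set: mE * mE] (fun z : mE * mE => (F z.1 z.2)%:E).
  exact/measurable_EFinP.
have /(integrable12ltyP msf msf mF').2 H : (\int[mu]_x \int[mu]_y `|(F x y)%:E| < +oo)%E.
  have M0 : 0 <= M by apply: le_trans (bF 0 0).
  have le1 x : (\int[mu]_y `|(F x y)%:E| <= (M * integ (\1_(cube r) : E -> R) * \1_(cube r) x)%:E)%E.
    have [xr|xr] := leP `|x| r; last first.
      rewrite (_ : (fun y => _) = cst 0%E); last first.
        by apply/funext => y /=; rewrite sF ?normr0//; left.
      by rewrite integral0 lee_fin !mulr_ge0// Rintegral_ge0.
    rewrite [\1_ _ x]indicE mem_set//= mulr1 -integZ; last exact: tame_cube.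
    rewrite integE; last exact: tame_norm.
    rewrite lee_fin; apply: le_integ; [exact: tame_norm|by apply: tameZ; exact: tame_cube|].
    move=> y; rewrite indicE; have [yr|yr] := leP `|y| r.
      by rewrite mem_set//= mulr1.
    by rewrite sF ?normr0 ?mulr_ge0//; right.
  apply: (@le_lt_trans _ _ (\int[mu]_x (M * integ (\1_(cube r) : E -> R) * \1_(cube r) x)%:E)%E).
    apply: (@ge0_le_integral _ mE R mu setT measurableT).
    - by move=> x _; apply: integral_ge0.
    - apply: (@measurable_fun_fubini_tonelli_F _ _ mE mE R msf (fun z : mE * mE => `|(F z.1 z.2)%:E|%E)).
        by apply: measurableT_comp.
      by move=> z; exact: abse_ge0.
    - by apply/measurable_EFinP; have [[]] := tameZ (M * integ (\1_(cube r) : E -> R)) (@tame_cube R d r).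
    - by move=> x _; exact: le1.
  rewrite (integE (tameZ _ (@tame_cube R d r))); exact: ltry.
have := Fubini H; rewrite /integ /Rintegral => FE.
transitivity (fine (\int[mu]_x \int[mu]_y (F x y)%:E)).
  by congr fine; apply: eq_integral => x _; rewrite (integE (t1 x)).
have FE' : (\int[mu]_x \int[mu]_y (F x y)%:E = \int[mu]_y \int[mu]_x (F x y)%:E)%E := FE.
by rewrite FE'; congr fine; apply: eq_integral => y _; exact: (integE (t2 y)).
Qed.

End IterationOrder.

Section OuterApproximation.
Context {R : realType} {d : nat}.
Local Notation E := 'rV[R]_d.
Local Notation mE := (rVlebesgue R d).
Local Notation mu := (@lebesgue_rV R d).

Definition obox (p : E * E) : set E := [set x | forall i, p.1 0 i < x 0 i < p.2 0 i].

Lemma continuous_coordB (i : 'I_d) (c : R) : continuous (fun x : E => x 0 i - c).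
Proof.
by move=> x; apply: continuousB; [exact: coord_continuous|exact: cst_continuous].
Qed.

(** The volume depends continuously on the upper corner, so half-open boxes can
    be replaced by slightly larger open ones. *)
Lemma box_volume_enlarge (p : E * E) (e : R) : 0 < e ->
  exists2 q : E * E, box p `<=` obox q & box_volume q <= box_volume p + e.
Proof.
move=> e0.
pose V (t : R) := \prod_(i < d) Num.max 0 (p.2 0 i + t - p.1 0 i).
have cV : continuous V.
  apply: continuous_prod => i; apply: contmax; first exact: cst_continuous.
  by apply: contB; [apply: contD; [exact: cst_continuous|by move=> ?; exact: cvg_id]|exact: cst_continuous].
have V0 : V 0 = box_volume p by apply: eq_bigr => i _; rewrite addr0.
have /cvgrPdist_lt/(_ _ e0)/nbhs_ballP[r /= r0 Hr] := cV 0.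
exists (p.1, p.2 + const_mx (r / 2)).
  move=> x px i; have /andP[p1 p2] := px i; rewrite /= !mxE p1/=.
  by rewrite (le_lt_trans p2)// ltrDl divr_gt0.
have : ball (0 : R) r (r / 2).
  by rewrite /ball/= sub0r normrN gtr0_norm ?divr_gt0// ltr_pdivrMr// mulr_natr mulr2n ltrDl.
move=> /Hr; rewrite V0 ltr_distlC => /andP[_ /ltW]; apply: le_trans.
by rewrite le_eqVlt; apply/orP; left; apply/eqP; apply: eq_bigr => i _; rewrite !mxE.
Qed.

Lemma outer_open_cover (A : set E) (e : R) : (mu A < +oo)%E -> 0 < e ->
  exists (P : pred nat) (p : nat -> E * E),
    A `<=` \bigcup_(n in [set n | P n]) obox (p n) /\
    (\sum_(n <oo | P n) (box_volume (p n))%:E <= mu A + e%:E)%E.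
Proof.
move=> Aoo e0; have A0 : (0 <= mu A)%E by exact: measure_ge0.
have Afin : mu A \is a fin_num by rewrite ge0_fin_numE.
have [|P [p [AP pA]]] := @outer_cover R d A (mu A + (e / 2)%:E)%E.
  by rewrite lteDl// lte_fin divr_gt0.
have /choice[q Hq] : forall n, exists q : E * E, box (p n) `<=` obox q /\
    box_volume q <= box_volume (p n) + e / 2 / (2 ^ n.+1)%:R.
  move=> n; have [|q ? ?] := @box_volume_enlarge (p n) (e / 2 / (2 ^ n.+1)%:R).
    by rewrite !divr_gt0// ltr0n expn_gt0.
  by exists q.
exists P, q; split.
  by move=> x /AP[n Pn /(Hq n).1 qx]; exists n.
apply: (@le_trans _ _ (\sum_(n <oo | P n) ((box_volume (p n))%:E + (e / 2 / (2 ^ n.+1)%:R)%:E))%E).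
  apply: lee_nneseries => n _ /=; first by move=> _; exact: box_volume_ge0.
  by rewrite -EFinD lee_fin; exact: (Hq n).2.
rewrite nneseriesD; last 2 first.
- by move=> n _ _; exact: box_volume_ge0.
- by move=> n _ _; rewrite lee_fin !divr_ge0// ltW.
rewrite [in leRHS](splitr e) EFinD addeA; apply: leeD; first exact: ltW.
have := @epsilon_trick R (fun=> 0%E) (e / 2) P (fun=> lexx _) (divr_ge0 (ltW e0) (ler0n _ _)).
rewrite [X in (_ <= X + _)%E]eseries0// add0e; apply: le_trans; apply: lee_nneseries => n _; first by rewrite lee_fin !divr_ge0// ltW.
by rewrite add0e.
Qed.

Definition bump_obox (p : E * E) (x : E) : R :=
  \prod_(i < d) (Num.max 0 (x 0 i - p.1 0 i) * Num.max 0 (p.2 0 i - x 0 i)).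

Lemma bump_obox_ge0 p x : 0 <= bump_obox p x.
Proof. by apply: prodr_ge0 => i _; rewrite mulr_ge0// le_max lexx. Qed.

Lemma bump_obox_gt0 p x : obox p x -> 0 < bump_obox p x.
Proof.
move=> px; apply: prodr_gt0 => i _; have /andP[p1 p2] := px i.
by rewrite mulr_gt0// lt_max subr_gt0 ?p1 ?p2 orbT.
Qed.

Lemma bump_obox_eq0 p x : ~ obox p x -> bump_obox p x = 0.
Proof.
move=> /existsNP[i /negP]; rewrite negb_and -!leNgt /bump_obox (bigD1 i)//= => /orP[h|h].
  by rewrite (max_l (_ : _ - _ <= _)) ?mul0r// subr_le0.
by rewrite [X in _ * X * _](max_l (_ : _ - _ <= _)) ?mulr0 ?mul0r// subr_le0.
Qed.

Lemma continuous_bump_obox p : continuous (bump_obox p).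
Proof.
apply: continuous_prod => i; apply: contM.
  by apply: contmax; [exact: cst_continuous|exact: continuous_coordB].
apply: contmax; first exact: cst_continuous.
by apply: contB; [exact: cst_continuous|exact: coord_continuous].
Qed.

Lemma measurable_obox p : measurable (obox p : set mE).
Proof.
rewrite (_ : obox p = bump_obox p @^-1` `]0, +oo[).
  rewrite -[X in measurable X]setTI.
  by apply: (continuous_measurable_rV (@continuous_bump_obox p)).
apply/seteqP; split => x /=; rewrite in_itv/= andbT; first exact: bump_obox_gt0.
by apply: contraTP => /bump_obox_eq0 ->; rewrite ltxx.
Qed.

Lemma lbm_indic (A : set mE) : measurable A -> lbm (\1_A : E -> R).
Proof.
move=> mA; split; first exact: measurable_indic.
by move=> r; exists 1 => x _; rewrite indicE; case: (_ \in _); rewrite ?normr1// normr0.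
Qed.

Lemma integ_indic (A : set mE) : measurable A -> (integ (\1_A : E -> R)) = fine (mu A).
Proof. by move=> mA; rewrite /integ /Rintegral integral_indic// setIT. Qed.

Lemma obox_bounded p : exists r : R, forall x, obox p x -> `|x| <= r.
Proof.
exists (`|p.1| + `|p.2|) => x px; apply: norm_le_coord; first exact: addr_ge0.
move=> i; have /andP[p1 p2] := px i.
have := le_coord_norm p.1 i; have := le_coord_norm p.2 i.
by rewrite !ler_norml => /andP[? ?] /andP[? ?]; apply/andP; split; lra.
Qed.

(** The fundamental lemma of the calculus of variations, in one-sided form.
    The indicator of the set A where g > 0 is approximated in two stages: by
    the indicator of an open set W that contains A and has almost the same
    measure, and this one by continuous functions that increase to it.  Then
    the integral of g over A, which is nonnegative, is at most 0. *)
Lemma negligible_gt0 (g : E -> R) (p : E * E) : lbm g ->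
  (forall psi : E -> R, continuous psi -> (forall x, 0 <= psi x) ->
    (forall x, ~ obox p x -> psi x = 0) -> integ (g \* psi) <= 0) ->
  mu.-negligible [set x | obox p x /\ 0 < g x].
Proof.
move=> lg test; set U := obox p; set A := [set x | _].
have mA : measurable (A : set mE).
  rewrite (_ : A = U `&` (g @^-1` `]0, +oo[)).
    apply: measurableI; first exact: measurable_obox.
    by rewrite -[X in measurable X]setTI; apply: (lbm_measurable lg).
  by apply/seteqP; split => x /=; rewrite in_itv/= andbT.
have [r Ur] := obox_bounded p.
have [M gM] := lbm_bounded lg r.
have tU (B : set mE) : measurable B -> B `<=` U -> tame (\1_B : E -> R).
  move=> mB BU; split; first exact: lbm_indic.
  by exists r => x rx; rewrite indicE memNset// => /BU/Ur; rewrite leNgt rx.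
have tA := tU _ mA (fun x h => h.1).
have muA : (mu A < +oo)%E.
  apply: le_lt_trans (@lebesgue_cube_lty R d r).
  by apply: (le_outer_measure (@lebesgue_outer R d)) => x [/Ur].
suff intA0 : integ (g \* \1_A) <= 0.
  have tgA : tame (g \* \1_A) by exact: tame_lbmM.
  have gA0 x : 0 <= (g \* \1_A) x.
    rewrite /= indicE; case: (boolP (x \in A)) => [/set_mem[_ /ltW]|]; first by rewrite mulr1.
    by rewrite mulr0.
  have mgA : measurable_fun [set: mE] (EFin \o (g \* \1_A)) by apply/measurable_EFinP; case: tgA => [[]].
  have /(ae_eq_integral_abs mu measurableT mgA).1 : (\int[mu]_x `|((g \* \1_A)%R x)%:E| = 0)%E.
    rewrite (eq_integral (fun x : mE => ((g \* \1_A) x)%:E)); last first.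
      by move=> x _; rewrite gee0_abs// lee_fin; exact: gA0.
    rewrite (integE tgA); congr EFin; apply/eqP; rewrite eq_le intA0.
    by apply: Rintegral_ge0.
  apply: negligibleS => x [Ux gx] /(_ I) /= /eqP.
  by rewrite indicE mem_set//= mulr1 eqe gt_eqF.
have M0 : 0 <= `|M| by [].
apply/ler_addgt0Pr => _/posnumP[e]; rewrite add0r.
have e1 : 0 < e%:num / (`|M| + 1) by rewrite divr_gt0// ltr_wpDl.
have [P [q [Aq qA]]] := outer_open_cover muA e1.
(* W is open, contains A and exceeds its measure by at most the chosen amount. *)
pose W := U `&` \bigcup_(n in [set n | P n]) obox (q n).
have mW : measurable (W : set mE).
  apply: measurableI; first exact: measurable_obox.
  by apply: bigcup_measurable => n _; exact: measurable_obox.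
have tW := tU _ mW (fun x h => h.1).
have AW : A `<=` W by move=> x Ax; split; [exact: Ax.1|exact: Aq].
have muW : fine (mu W) <= fine (mu A) + e%:num / (`|M| + 1).
  have Afin : mu A \is a fin_num by rewrite ge0_fin_numE.
  rewrite -lee_fin EFinD !fineK//; last first.
    rewrite ge0_fin_numE//; apply: le_lt_trans (@lebesgue_cube_lty R d r).
    by apply: (le_outer_measure (@lebesgue_outer R d)) => x [/Ur].
  apply: le_trans qA; apply: outer_le_series => x [_ [n Pn qx]].
  by exists n => // i; have /andP[-> /ltW] := qx i.
(* Continuous, between 0 and 1, positive only on W, and eventually 1 at each point of W. *)
pose psi m x := Num.min 1 (m%:R * (bump_obox p x * \sum_(n < m | P n) bump_obox (q n) x)).
have psi0 m x : 0 <= psi m x.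
  by rewrite le_min ler01/= !mulr_ge0// ?bump_obox_ge0// sumr_ge0// => *; exact: bump_obox_ge0.
have psi_out m x : ~ W x -> psi m x = 0.
  move=> nWx; rewrite /psi; have [Ux|nU] := pselect (U x); last first.
    by rewrite (bump_obox_eq0 nU) mul0r mulr0 min_r.
  rewrite big1 ?mulr0 ?min_r// => n Pn; apply: bump_obox_eq0 => qx; apply: nWx; split => //.
  by exists n.
have cpsi m : continuous (psi m).
  apply: contmin; first exact: cst_continuous.
  apply: contM; first exact: cst_continuous.
  apply: contM; first exact: continuous_bump_obox.
  under eq_fun do rewrite big_mkcond/=.
  apply: continuous_sum => n; case: (P n); first exact: continuous_bump_obox.
  exact: cst_continuous.
have cvpsi x : psi m x @[m --> \oo] --> (\1_W x : R).
  have [Wx|nWx] := pselect (W x); last first.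
    rewrite indicE memNset//; under eq_fun do rewrite psi_out//.
    exact: cvg_cst.
  rewrite indicE mem_set//; have [Ux [k /= Pk qx]] := Wx.
  apply: cvg_near_cst.
  have c0 : 0 < bump_obox p x * bump_obox (q k) x by rewrite mulr_gt0 ?bump_obox_gt0.
  near=> m; rewrite /psi min_l//.
  apply: (@le_trans _ _ (m%:R * (bump_obox p x * bump_obox (q k) x))).
    rewrite -ler_pdivrMr// mul1r; near: m; exact: nbhs_infty_ger.
  rewrite ler_wpM2l// ler_wpM2l ?bump_obox_ge0//.
  have km : (k < m)%N by near: m; exact: nbhs_infty_gt.
  rewrite (bigD1 (Ordinal km))//= lerDl sumr_ge0// => *; exact: bump_obox_ge0.
have intW : integ (g \* \1_W) <= 0.
  have tgpsi m : tame (g \* psi m).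
    apply: (tame_lbmM lg); split; first exact: continuous_lbm.
    exists r => x rx; apply: psi_out => -[/Ur]; rewrite leNgt rx//.
  have cv : integ (g \* psi m) @[m --> \oo] --> integ (g \* \1_W).
    apply: (@integ_cvg R d (fun m => g \* psi m) (g \* \1_W) r `|M| set0).
    - exact: negligible_set0.
    - by move=> m; case: (tgpsi m) => [[]].
    - by have [[]] := tame_lbmM lg tW.
    - move=> m x xr; rewrite /= normrM (ger0_norm (psi0 _ _)).
      rewrite -[leRHS]mulr1 ler_pM//; first by rewrite (le_trans (gM _ xr))// ler_norm.
      by rewrite ge_min lexx.
    - by move=> m x rx; rewrite /= psi_out ?mulr0// => -[/Ur]; rewrite leNgt rx.
    - by move=> x _; apply: cvgM; [exact: cvg_cst|exact: cvpsi].
  rewrite -(cvg_lim (@Rhausdorff R) cv); apply: limr_le; first by apply/cvg_ex; eexists; exact: cv.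
  apply: nearW => m; apply: test; [exact: cpsi|exact: psi0|].
  by move=> x nU; apply: psi_out => -[].
(* On W minus A the function g is bounded below by - |M|. *)
have le1 : integ (g \* \1_A) <= integ (fun x => g x * \1_W x + `|M| * (\1_W x - \1_A x)).
  apply: le_integ; first exact: tame_lbmM.
    by apply: tameD; [exact: tame_lbmM|apply: tameZ; exact: tameB].
  move=> x; rewrite /= !indicE; have [Ax|nAx] := pselect (A x).
    by rewrite !mem_set//=; [rewrite subrr mulr0 addr0|exact: AW].
  rewrite (memNset nAx) mulr0 subr0; have [Wx|nWx] := pselect (W x); last first.
    by rewrite memNset// !mulr0 addr0.
  rewrite mem_set//= !mulr1; have := gM x (Ur _ Wx.1).
  by rewrite ler_norml => /andP[h _]; rewrite -lerBlDr sub0r (le_trans _ h)// lerN2 ler_norm.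
apply: le_trans le1 _.
rewrite (_ : integ _ = integ (g \* \1_W) + `|M| * (fine (mu W) - fine (mu A))); last first.
  rewrite -(integ_indic mW) -(integ_indic mA) -(integB tW tA) -(integZ _ (tameB tW tA)).
  exact: (integD (tame_lbmM lg tW) (tameZ _ (tameB tW tA))).
apply: le_trans (lerD intW (_ : _ <= `|M| * (e%:num / (`|M| + 1)))) _.
  by rewrite ler_wpM2l// lerBlDl.
rewrite add0r mulrA ler_pdivrMr ?ltr_wpDl// mulrC ler_wpM2l// lerDl//.
Unshelve. all: by end_near.
Qed.

End OuterApproximation.

(** * Directional derivatives, smooth bump functions and mollifiers *)

Section DirectionalDerivatives.
Context {R : realType} {V : normedModType R}.
Implicit Types (u : V -> R) (x h : V).

Lemma is_derive_on_line u x h (s df : R) :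
  is_derive (x + s *: h) h u df <-> is_derive s (1 : R) (fun t => u (x + t *: h)) df.
Proof.
have E : (fun t : R => t^-1 *: ((u \o shift (x + s *: h)) (t *: h) - u (x + s *: h))) =
    (fun t : R => t^-1 *: (((fun t => u (x + t *: h)) \o shift s) (t *: (1 : R)) -
      u (x + s *: h))).
  apply/funext => t /=; congr (_ *: (u _ - _)).
  by rewrite /shift/= [t *: 1]mulr1 scalerDl addrCA.
by split=> -[d1 d2]; split; move: d1 d2; rewrite /derivable /derive ?E -?E.
Qed.

Lemma mvt_line u (du : V -> R) x h :
  (forall y, is_derive y h u (du y)) ->
  exists2 s : R, 0 <= s <= 1 & u (x + h) - u x = du (x + s *: h).
Proof.
move=> uE; pose g (t : R) := u (x + t *: h).
have dg (t : R) : is_derive t (1 : R) g (du (x + t *: h)).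
  by apply/is_derive_on_line; exact: uE.
have cg : {within `[0, 1], continuous g}.
  apply: continuous_subspaceT => t.
  by apply: differentiable_continuous; apply/derivable1_diffP; case: (dg t).
have [c c01 gc] := MVT_segment ler01 (fun t _ => dg t) cg.
exists c; first by move: c01; rewrite in_itv.
by move: gc; rewrite /g scale1r scale0r addr0 subr0 mulr1.
Qed.

(** A quadratic error bound survives integration with respect to a parameter,
    so it is the form in which derivatives of integrals are established. *)
Lemma is_derive_quadratic u x h (df C : R) :
  (forall t : R, `|t| <= 1 -> `|u (x + t *: h) - u x - t * df| <= C * t ^+ 2) ->
  is_derive x h u df.
Proof.
move=> H.
suff cv : t^-1 *: ((u \o shift x) (t *: h) - u x) @[t --> 0^'] --> df.
  split; first by apply/cvg_ex; exists df.
  exact/cvg_lim.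
apply/cvgrPdist_le => /= e e0.
have C1 : 0 < `|C| + 1 by rewrite ltr_wpDl.
near=> t; have t0 : t != 0 by near: t; exact: nbhs_dnbhs_neq.
have t1 : `|t| <= 1 by near: t; apply: dnbhs0_le.
have te : `|t| <= e / (`|C| + 1) by near: t; apply: dnbhs0_le; rewrite divr_gt0.
have := H t t1; rewrite /= [x + _]addrC; set D := u _ - u x => HD.
rewrite (_ : df - t^-1 *: D = - (t^-1 * (D - t * df))); last first.
  by rewrite [t^-1 *: D]/(t^-1 * D) mulrBr mulKf// opprB.
rewrite normrN normrM normfV ler_pdivrMl ?normr_gt0//.
apply: le_trans HD _; apply: le_trans (_ : (`|C| + 1) * `|t| ^+ 2 <= _).
  by rewrite real_normK ?num_real// ler_wpM2r ?sqr_ge0// ler_wpDr// ler_norm.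
by rewrite expr2 mulrCA ler_wpM2l// mulrC -ler_pdivlMr.
Unshelve. all: by end_near.
Qed.

Lemma is_derive_scale u x h (a df : R) : is_derive x h u df -> is_derive x (a *: h) u (a * df).
Proof.
move=> du; have -> : x = x + (0 : R) *: (a *: h) by rewrite scale0r addr0.
apply/is_derive_on_line.
pose g (b : R) := u (x + b *: h).
have -> : (fun b : R => u (x + b *: (a *: h))) = g \o (fun b : R => a * b).
  by apply/funext => b /=; rewrite /g scalerA mulrC.
have dl : is_derive (0 : R) (1 : R) (fun b : R => a * b) a.
  have /is_derive_eq := is_deriveZ a (is_derive_id (0 : R) (1 : R)).
  by apply; rewrite /GRing.scale/= mulr1.
have dg : is_derive (a * 0) (1 : R) g df.
  by apply/is_derive_on_line; rewrite mulr0 scale0r addr0.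
have /is_derive_eq := @is_derive1_comp R g _ 0 _ _ dg dl.
by apply; rewrite mulrC.
Qed.

Lemma mvt_quotient n u (du : V -> R) x h : (forall y, is_derive y h u (du y)) ->
  exists2 s : R, 0 <= s <= 1 &
    n.+1%:R * (u (x + n.+1%:R^-1 *: h) - u x) = du (x + s *: h).
Proof.
move=> duE.
have [y|s /andP[s0 s1] ->] := @mvt_line u (fun y => n.+1%:R^-1 * du y) x (n.+1%:R^-1 *: h).
  exact: is_derive_scale.
exists (s / n.+1%:R); last by rewrite mulrA mulfV// mul1r scalerA.
by rewrite divr_ge0//= ler_pdivrMr// mul1r (le_trans s1)// ler1n.
Qed.

Lemma cvg_difference_quotient u x h (df : R) : is_derive x h u df ->
  n.+1%:R * (u (x + n.+1%:R^-1 *: h) - u x) @[n --> \oo] --> df.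
Proof.
move=> [du <-].
have cv : (n.+1%:R^-1 : R) @[n --> \oo] --> (0 : R)^'.
  move=> A; rewrite /dnbhs/within/= => nA.
  have := cvg_harmonic nA; rewrite /harmonic !nbhs_simpl /=.
  by apply: filterS => n; apply; rewrite invr_neq0.
have := cvg_comp _ _ cv du.
apply: cvg_trans; apply: near_eq_cvg; apply: nearW => n.
by rewrite /= invrK /shift [x + _]addrC.
Qed.

End DirectionalDerivatives.

Section FlatFunctions.
Context {R : realType}.

(** The classical flat function exp(-1/t), multiplied by powers of 1/t so that
    the family is closed under differentiation up to linear combinations. *)
Definition flat (k : nat) (t : R) : R := if 0 < t then t^-1 ^+ k * expR (- t^-1) else 0.

Lemma flat_gt0 k t : 0 < t -> 0 < flat k t.
Proof. by move=> t0; rewrite /flat t0 mulr_gt0 ?expR_gt0 ?exprn_gt0 ?invr_gt0. Qed.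

Lemma flat_eq0 k t : t <= 0 -> flat k t = 0.
Proof. by rewrite /flat ltNge => ->. Qed.

Lemma flat_ge0 k t : 0 <= flat k t.
Proof. by have [/flat_eq0 ->//|/(flat_gt0 k)/ltW] := leP t 0. Qed.

(** The (k+2)-nd term of the exponential series bounds exp(1/t) from below. *)
Lemma flat_le k t : flat k t <= k.+2`!%:R * t ^+ 2.
Proof.
have [/flat_eq0 ->|t0] := leP t 0; first by rewrite mulr_ge0 ?sqr_ge0.
rewrite /flat t0 expRN ler_pdivrMr ?expR_gt0//.
have f0 : (k.+2`!%:R : R) != 0 by rewrite pnatr_eq0 -lt0n fact_gt0.
apply: le_trans (_ : k.+2`!%:R * t ^+ 2 * (t^-1 ^+ (k + 2) / k.+2`!%:R) <= _).
  rewrite exprD; set a := t^-1 ^+ k; rewrite le_eqVlt; apply/orP; left; apply/eqP.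
  by field; rewrite f0 gt_eqF.
apply: ler_wpM2l; first by rewrite mulr_ge0 ?sqr_ge0.
rewrite addn2; apply: le_trans (expR_ge1Dxn k.+1 _); last by rewrite invr_ge0 ltW.
by rewrite lerDr.
Qed.

(** At t = 0 the derivative is 0, thanks to the quadratic bound [flat_le]. *)
Lemma is_derive_flat k t :
  is_derive t (1 : R) (flat k) (flat k.+2 t - k%:R * flat k.+1 t).
Proof.
have [t0|t0|->] := ltrgt0P t.
- pose g (s : R) := s^-1 ^+ k * expR (- s^-1).
  apply: (@near_eq_is_derive _ _ _ g).
    by near=> s; rewrite /flat/g ifT//; near: s; exact: lt_nbhsr.
  have tn0 : t != 0 by rewrite gt_eqF.
  have dV : is_derive t 1 (fun s : R => s^-1) (- t ^- 2).
    by rewrite -[- _]mulr1; exact: (is_deriveV tn0 (is_derive_id t 1)).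
  have dX : is_derive t 1 (fun s : R => s^-1 ^+ k) (k%:R * t^-1 ^+ k.-1 * - t ^- 2).
    by have := is_deriveX k dV; rewrite exprfctE.
  have dE : is_derive t 1 (fun s : R => expR (- s^-1)) (t ^- 2 * expR (- t^-1)).
    have := @is_derive1_comp R expR (fun s => - s^-1) t _ _ (is_derive_expR _) (is_deriveN dV).
    rewrite opprK mulrC; exact.
  have /is_derive_eq := is_deriveM dX dE; apply.
  rewrite /flat t0 -exprVn; set u := t^-1; set e := expR _.
  rewrite /GRing.scale/= !exprS; case: k {g dX} => [|k]; rewrite /= ?exprS; ring.
- apply: (@near_eq_is_derive _ _ _ (cst 0)).
    near=> s; have s0 : s < 0 by near: s; exact: lt_nbhsl.
  by rewrite flat_eq0// ltW.
  rewrite !flat_eq0 ?ltW// mulr0 subrr; exact: is_derive_cst.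
- apply: (@is_derive_quadratic _ _ _ _ _ _ k.+2`!%:R) => s _.
  rewrite add0r [s *: 1]mulr1 !(@flat_eq0 _ 0)// !(mulr0, subr0).
  by rewrite ger0_norm ?flat_ge0// flat_le.
Unshelve. all: by end_near.
Qed.

End FlatFunctions.

Section SmoothBumps.
Context {R : realType} {d : nat}.
Local Notation E := 'rV[R]_d.
Implicit Types u v : E -> R.

(** An algebra of smooth functions that contains bump functions and is visibly
    stable under partial derivatives: by induction, its elements have partial
    derivatives of all orders. *)
Inductive Sm : (E -> R) -> Prop :=
| Sm_cst c : Sm (fun=> c)
| Sm_flat k a b (i : 'I_d) : Sm (fun x => flat k (a * x 0 i + b))
| Sm_add u v : Sm u -> Sm v -> Sm (fun x => u x + v x)
| Sm_mul u v : Sm u -> Sm v -> Sm (fun x => u x * v x).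

Lemma Sm_prod (I : Type) (s : seq I) (h : I -> E -> R) :
  (forall i, Sm (h i)) -> Sm (fun x => \prod_(i <- s) h i x).
Proof.
move=> Sh; elim: s => [|i s IH].
  by under eq_fun do rewrite big_nil; exact: Sm_cst.
by under eq_fun do rewrite big_cons; exact: Sm_mul.
Qed.

Lemma Sm_shift u a : Sm u -> Sm (fun x => u (x + a)).
Proof.
elim=> {u} [c|k b c i|u v _ IHu _ IHv|u v _ IHu _ IHv].
- exact: Sm_cst.
- by under eq_fun do rewrite mxE mulrDr -addrA; exact: Sm_flat.
- exact: Sm_add.
- exact: Sm_mul.
Qed.

Lemma Sm_derive u : Sm u -> exists g : 'I_d -> E -> R, (forall i, Sm (g i)) /\
  forall x h, is_derive x h u (\sum_(i < d) h 0 i * g i x).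
Proof.
elim=> {u} [c|k a b i|u v Su [gu [Sgu dgu]] Sv [gv [Sgv dgv]]|u v Su [gu [Sgu dgu]] Sv [gv [Sgv dgv]]].
- exists (fun _ => fun=> 0); split; first by move=> i; exact: Sm_cst.
  move=> x h; rewrite big1 => [|i _]; last by rewrite mulr0.
  exact: is_derive_cst.
- exists (fun j x => (j == i)%:R * (a * (flat k.+2 (a * x 0 i + b) +
            - k%:R * flat k.+1 (a * x 0 i + b)))); split.
    move=> j; apply: Sm_mul; first exact: Sm_cst.
    apply: Sm_mul; first exact: Sm_cst.
    by apply: Sm_add; [exact: Sm_flat|apply: Sm_mul; [exact: Sm_cst|exact: Sm_flat]].
  move=> x h; rewrite (bigD1 i)//= eqxx mul1r big1 ?addr0; last first.
    by move=> j /negbTE ->; rewrite mul0r mulr0.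
  rewrite -[x]addr0 -(scale0r h); apply/is_derive_on_line; rewrite scale0r addr0.
  have E1 : (fun t : R => flat k (a * (x + t *: h) 0 i + b)) =
      flat k \o (fun t : R => (a * h 0 i) * t + (a * x 0 i + b)).
    by apply/funext => t /=; rewrite !mxE; congr flat; ring.
  rewrite E1.
  have dl : is_derive (0 : R) (1 : R) (fun t : R => (a * h 0 i) * t + (a * x 0 i + b)) (a * h 0 i).
    have /is_derive_eq := is_deriveD (is_deriveZ (a * h 0 i) (is_derive_id (0 : R) (1 : R))) (is_derive_cst (a * x 0 i + b) (0 : R) (1 : R)).
    by apply; rewrite addr0 /GRing.scale/= mulr1.
  have /is_derive_eq := @is_derive1_comp R (flat k) _ 0 _ _ (is_derive_flat k _) dl.
  by apply; rewrite mulr0 add0r; ring.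
- exists (fun i x => gu i x + gv i x); split; first by move=> i; exact: Sm_add.
  move=> x h; under eq_bigr do rewrite mulrDr.
  by rewrite big_split/=; exact: is_deriveD.
- exists (fun i x => u x * gv i x + v x * gu i x); split.
    by move=> i; apply: Sm_add; exact: Sm_mul.
  move=> x h; have /is_derive_eq := is_deriveM (dgu x h) (dgv x h); apply.
  rewrite /GRing.scale/= !mulr_sumr -big_split/=; apply: eq_bigr => i _; ring.
Qed.

Lemma flat_continuous k : continuous (flat k : R -> R).
Proof.
move=> t; apply: differentiable_continuous; apply/derivable1_diffP.
by case: (is_derive_flat k t).
Qed.

Lemma Sm_continuous u : Sm u -> continuous u.
Proof.
elim=> {u} [c|k b c i|u v _ cu _ cv|u v _ cu _ cv].
- exact: cst_continuous.
- move=> x; apply: (@continuous_comp _ _ _ (fun x : E => b * x 0 i + c) (flat k)).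
    apply: (@contD R _ (fun x : E => b * x 0 i) (fun=> c)); last exact: cst_continuous.
    by apply: contM; [exact: cst_continuous|exact: coord_continuous].
  exact: flat_continuous.
- exact: contD.
- exact: contM.
Qed.

Lemma dot_basisv (g : 'I_d -> R) i : \sum_(j < d) (basisv i : E) 0 j * g j = g i.
Proof.
rewrite (bigD1 i)//= mxE !eqxx mul1r big1 ?addr0// => j ji.
by rewrite mxE (negbTE ji) mul0r.
Qed.

Lemma Sm_partial u i : Sm u ->
  Sm (partial i u) /\ forall x h, is_derive x h u (\sum_(j < d) h 0 j * partial j u x).
Proof.
move=> /Sm_derive[g [Sg dg]].
have E1 j : partial j u = g j.
  apply/funext => x; rewrite /partial; have [_ ->] := dg x (basisv j).
  exact: dot_basisv.
split; first by rewrite E1.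
by move=> x h; under eq_bigr do rewrite E1; exact: dg.
Qed.

Lemma Sm_iter_partial u s : Sm u -> Sm (iter_partial s u).
Proof. by move=> Su; elim: s => [//|i s IH]; exact: (Sm_partial i IH).1. Qed.

Lemma Sm_smooth u : Sm u -> smooth u.
Proof.
move=> Su s; have Ss := Sm_iter_partial s Su; split; first exact: Sm_continuous.
by move=> i x; case: ((Sm_partial i Ss).2 x (basisv i)).
Qed.

End SmoothBumps.

Section TestFunctions.
Context {R : realType} {d : nat}.
Local Notation E := 'rV[R]_d.
Implicit Types u v psi : E -> R.

Definition test psi := smooth psi /\ csupp psi.

Lemma partial_eq0 u i (r : R) : (forall x, r < `|x| -> u x = 0) ->
  forall x, r < `|x| -> partial i u x = 0.
Proof.
move=> ur x rx; rewrite /partial.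
rewrite -[RHS](derive_cst (0 : R) x (basisv i)); apply: near_eq_derive.
have : nbhs x [set y : E | r < `|y|].
  apply: open_nbhs_nbhs; split => //.
  apply: (@open_comp _ _ (fun y : E => `|y|) [set t : R | r < t]); last exact: open_gt.
  by move=> y _; exact: norm_continuous.
by apply: filterS => y /ur.
Qed.

Lemma csupp_partial u i : csupp u -> csupp (partial i u).
Proof. by move=> [r ur]; exists r; exact: partial_eq0. Qed.

Lemma test_partial psi i : test psi -> test (partial i psi).
Proof.
move=> [sp cp]; split; last exact: csupp_partial.
by move=> s; rewrite (_ : iter_partial s _ = iter_partial (rcons s i) psi) // /iter_partial foldr_rcons.
Qed.

Lemma test_continuous psi : test psi -> continuous psi.
Proof. by move=> [/(_ [::])[]]. Qed.

Lemma test_is_derive psi i x : test psi -> is_derive x (basisv i) psi (partial i psi x).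
Proof. by move=> [/(_ [::])[_ /(_ i x) h] _]; apply: derivableP. Qed.

Lemma csupp_bounded u : continuous u -> csupp u -> exists2 M : R, 0 <= M & forall x, `|u x| <= M.
Proof.
move=> cu [r ur]; have [M uM] := continuous_bounded_cube r cu.
exists `|M| => // x; have [xr|xr] := leP `|x| r.
  by rewrite (le_trans (uM _ xr))// ler_norm.
by rewrite ur// normr0.
Qed.

Lemma test_lbm psi : test psi -> lbm psi.
Proof. by move=> /test_continuous; exact: continuous_lbm. Qed.

Lemma test_tame psi : test psi -> tame psi.
Proof. by move=> tp; split; [exact: test_lbm|case: tp]. Qed.

Lemma tame_lbm_test g psi : lbm g -> test psi -> tame (g \* psi).
Proof. by move=> lg tp; apply: tame_lbmM => //; exact: test_tame. Qed.

Lemma compactly_supportedP u : compactly_supported u <-> csupp u.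
Proof.
split.
  move=> /compact_bounded[M [_ /(_ (M + 1))]]; rewrite ltrDl ltr01 => /(_ isT) H.
  exists (M + 1) => x Mx; apply/eqP; apply: contraTT Mx => ux; rewrite -leNgt.
  by apply: H; exact: subset_closure.
move=> [r ur]; apply: (@subclosed_compact _ _ (cube r)).
- exact: closed_closure.
- exact: compact_cube.
have cc : closed (cube r : set E).
  apply: (@closed_comp _ _ (fun x : E => `|x|) [set t : R | t <= r]); last exact: closed_le.
  by move=> x _; exact: norm_continuous.
rewrite [X in _ `<=` X](closure_id (cube r)).1//; apply: closure_subset => x /=.
by apply: contraNT; rewrite -ltNge => /ur ->.
Qed.

Lemma Sm_csupp_test u : Sm u -> csupp u -> test u.
Proof. by move=> /Sm_smooth. Qed.

Lemma norm_sum_coord_le (v : E) (g : 'I_d -> R) (M : 'I_d -> R) :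
  (forall i, `|g i| <= M i) -> `|\sum_(i < d) v 0 i * g i| <= `|v| * \sum_(i < d) M i.
Proof.
move=> gM; apply: le_trans (ler_norm_sum _ _ _) _; rewrite mulr_sumr.
by apply: ler_sum => i _; rewrite normrM ler_pM// le_coord_norm.
Qed.

(** In dimension 0 there is no coordinate to apply [Sm_partial] to, but then the
    direction is 0. *)
Lemma Sm_derive_sum u x h : Sm u -> is_derive x h u (\sum_(j < d) h 0 j * partial j u x).
Proof.
move=> Su; case: (posnP d) => d0; last exact: (Sm_partial (Ordinal d0) Su).2.
subst d; rewrite (_ : h = 0); last by apply/rowP => -[].
rewrite big1; first exact: is_derive0.
by move=> i _; rewrite mxE mul0r.
Qed.

Lemma Sm_lipschitz u : Sm u -> csupp u ->
  exists2 L : R, 0 <= L & forall x v : E, `|u (x + v) - u x| <= L * `|v|.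
Proof.
move=> Su cu.
have /choice[M HM] : forall i : 'I_d, exists M : R, 0 <= M /\ forall x, `|partial i u x| <= M.
  move=> i; have [M M0 HM] := csupp_bounded (Sm_continuous (Sm_partial i Su).1) (csupp_partial i cu).
  by exists M.
exists (\sum_(i < d) M i); first by apply: sumr_ge0 => i _; exact: (HM i).1.
move=> x v.
have [|s _ ->] := @mvt_line R _ u (fun y => \sum_(j < d) v 0 j * partial j u y) x v.
  by move=> y; exact: Sm_derive_sum.
by rewrite mulrC; apply: norm_sum_coord_le => i; exact: (HM i).2.
Qed.

Lemma Sm_taylor u : Sm u -> csupp u ->
  exists2 L : R, 0 <= L & forall x v : E,
    `|u (x + v) - u x - \sum_(j < d) v 0 j * partial j u x| <= L * `|v| ^+ 2.
Proof.
move=> Su cu.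
have /choice[M HM] : forall i : 'I_d, exists M : R, 0 <= M /\
    forall x v : E, `|partial i u (x + v) - partial i u x| <= M * `|v|.
  move=> i; have [M M0 HM] := Sm_lipschitz (Sm_partial i Su).1 (csupp_partial i cu).
  by exists M.
exists (\sum_(i < d) M i); first by apply: sumr_ge0 => i _; exact: (HM i).1.
move=> x v.
have [|s /andP[s0 s1] ->] := @mvt_line R _ u (fun y => \sum_(j < d) v 0 j * partial j u y) x v.
  by move=> y; exact: Sm_derive_sum.
rewrite -sumrB; under eq_bigr do rewrite -mulrBr.
apply: le_trans (@norm_sum_coord_le v _ (fun i => M i * `|v|) _) _.
  move=> i; apply: le_trans ((HM i).2 _ _) _; apply: ler_wpM2l; first exact: (HM i).1.
  by rewrite normrZ ger0_norm// ler_piMl.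
by rewrite -mulr_suml mulrCA expr2.
Qed.

End TestFunctions.

Section Mollifiers.
Context {R : realType} {d : nat}.
Local Notation E := 'rV[R]_d.

Definition bump (r : R) (x : E) : R :=
  \prod_(i < d) (flat 0 (-1 * x 0 i + r) * flat 0 (1 * x 0 i + r)).

Lemma bump_Sm r : Sm (bump r).
Proof. by apply: Sm_prod => i; apply: Sm_mul; exact: Sm_flat. Qed.

Lemma bump_ge0 r x : 0 <= bump r x.
Proof. by apply: prodr_ge0 => i _; rewrite mulr_ge0// flat_ge0. Qed.

Lemma bump_even r x : bump r (- x) = bump r x.
Proof.
apply: eq_bigr => i _; rewrite !mxE mulrC; congr (flat _ _ * flat _ _); ring.
Qed.

Lemma bump_eq0 r x : 0 <= r -> r < `|x| -> bump r x = 0.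
Proof.
move=> r0 rx; have [i xi] : exists i, r < `|x 0 i|.
  apply: contrapT => /forallNP H; move: rx; rewrite ltNge norm_le_coord// => i.
  by rewrite leNgt; exact/negP.
rewrite /bump (bigD1 i)//=; have [x0|x0] := leP 0 (x 0 i).
  rewrite ger0_norm// in xi; rewrite (@flat_eq0 _ 0 (-1 * _ + _)) ?mul0r//.
  by rewrite mulN1r addrC subr_le0 ltW.
rewrite ltr0_norm// in xi; rewrite (@flat_eq0 _ 0 (1 * _ + _)) ?mulr0 ?mul0r//.
by rewrite mul1r -lerBrDr sub0r lerNr ltW.
Qed.

Lemma flat0_ge (r t : R) : 0 < r -> r <= t -> expR (- r^-1) <= flat 0 t.
Proof.
move=> r0 rt; have t0 := lt_le_trans r0 rt.
by rewrite /flat t0 expr0 mul1r ler_expR lerN2 lef_pV2 ?posrE.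
Qed.

Lemma bump_tame r : 0 <= r -> tame (bump r).
Proof.
move=> r0; split; first exact: continuous_lbm (Sm_continuous (bump_Sm r)).
by exists r => x; exact: bump_eq0.
Qed.

(** On the cube of half the radius the bump is bounded below by a positive
    constant, and this cube has positive volume. *)
Lemma integ_bump_gt0 r : 0 < r -> 0 < integ (bump r).
Proof.
move=> r0; have r20 : 0 < r / 2 by rewrite divr_gt0.
pose p : E * E := (const_mx (- (r / 2)), const_mx (r / 2)).
pose c := (expR (- (r / 2)^-1) ^+ 2) ^+ d.
have c0 : 0 < c by rewrite !exprn_gt0 ?expR_gt0.
have tp : tame (\1_(box p) : E -> R).
  split; first by apply: lbm_indic; exact: measurable_box.
  exists (r / 2) => x; apply: contraTeq; rewrite indicE pnatr_eq0 eqb0 negbK inE -leNgt => xp.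
  apply: norm_le_coord => [|i]; first exact: ltW.
  by have := xp i; rewrite /= !mxE ler_norml => /andP[/ltW -> ->].
apply: (@lt_le_trans _ _ (integ (fun x => c * (\1_(box p) : E -> R) x))).
  rewrite integZ// integ_indic; last exact: measurable_box.
  rewrite mulr_gt0// lebesgue_box/=; last by move=> i; rewrite /= !mxE; lra.
  by apply: prodr_gt0 => i _; rewrite /= !mxE lt_max; apply/orP; right; lra.
apply: le_integ; [exact: tameZ|by apply: bump_tame; exact: ltW|].
move=> x; rewrite indicE; have [/set_mem xp|_] := boolP (x \in box p); last by rewrite mulr0 bump_ge0.
rewrite mulr1 /c /bump -[X in _ ^+ X]card_ord -prodr_const; apply: ler_prod => i _.
rewrite exprn_ge0 ?expR_ge0//= expr2; have /andP := xp i; rewrite !mxE => -[x1 x2].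
by rewrite ler_pM ?expR_ge0// flat0_ge//; move: x1 x2; rewrite /=; lra.
Qed.

Definition rho (n : nat) (x : E) : R :=
  (integ (bump n.+1%:R^-1))^-1 * bump n.+1%:R^-1 x.

Lemma rho_Sm n : Sm (rho n).
Proof. by apply: Sm_mul; [exact: Sm_cst|exact: bump_Sm]. Qed.

Lemma rho_ge0 n x : 0 <= rho n x.
Proof. by rewrite mulr_ge0 ?bump_ge0// invr_ge0 ltW// integ_bump_gt0. Qed.

Lemma rho_even n x : rho n (- x) = rho n x.
Proof. by rewrite /rho bump_even. Qed.

Lemma rho_eq0 n x : n.+1%:R^-1 < `|x| -> rho n x = 0.
Proof. by move=> nx; rewrite /rho bump_eq0 ?mulr0. Qed.

Lemma rho_csupp n : csupp (rho n).
Proof. by exists n.+1%:R^-1 => x; exact: rho_eq0. Qed.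

Lemma rho_tame n : tame (rho n).
Proof. by apply: tameZ; exact: bump_tame. Qed.

Lemma integ_rho n : integ (rho n) = 1.
Proof.
rewrite /rho integZ; last exact: bump_tame.
by rewrite mulVf// gt_eqF// integ_bump_gt0.
Qed.

End Mollifiers.

(** * Integration by parts and mollification *)

Section IntegrationByParts.
Context {R : realType} {d : nat}.
Local Notation E := 'rV[R]_d.
Local Notation mE := (rVlebesgue R d).
Local Notation mu := (@lebesgue_rV R d).
Implicit Types u v : E -> R.

Lemma tame_bounded u : tame u -> exists2 M : R, 0 <= M & forall x, `|u x| <= M.
Proof.
move=> [[_ bu] [r ur]]; have [M uM] := bu r.
exists `|M| => // x; have [xr|xr] := leP `|x| r.
  by rewrite (le_trans (uM _ xr))// ler_norm.
by rewrite ur// normr0.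
Qed.

Lemma integ_shiftM u v a : lbm u -> tame v ->
  integ (fun x => u (x + a) * v x) = integ (fun x => u x * v (x - a)).
Proof.
move=> lu tv; rewrite -(integ_shift a (tame_lbmM lu (tame_shift (- a) tv))).
by congr integ; apply/funext => x /=; rewrite addrK.
Qed.

Lemma measurable_of_tame u : tame u -> measurable_fun [set: mE] u.
Proof. by case=> [[]]. Qed.

(** Discrete integration by parts, followed by a limit: by invariance under translations, a forward difference quotient
    moves from one factor to a backward difference quotient on the other, and
    both sides converge by domination. *)
Lemma integration_by_parts u u' v v' h : lbm u -> lbm u' -> tame v -> tame v' ->
  (forall x, is_derive x h u (u' x)) -> (forall x, is_derive x h v (v' x)) ->
  integ (u \* v') = - integ (u' \* v).
Proof.
move=> lu lu' tv tv' du dv.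
pose t (n : nat) : R := n.+1%:R^-1.
have t01 n : 0 <= t n <= 1 by rewrite invr_ge0 ler0n/= invf_le1// ler1n.
have [r vr] := tame_csupp tv; have [r' vr'] := tame_csupp tv'.
have [Mv Mv0 vM] := tame_bounded tv; have [Mv' Mv'0 vM'] := tame_bounded tv'.
have lq n w : lbm w -> lbm (fun x => n.+1%:R * (w (x + t n *: h) - w x)).
  by move=> lw; exact: lbmZ (lbmB (lbm_shift _ lw) lw).
have c1 : integ (fun x => n.+1%:R * (u (x + t n *: h) - u x) * v x) @[n --> \oo] --> integ (u' \* v).
  have [M uM] := lbm_bounded lu' (r + `|h|).
  apply: (@integ_cvg _ _ _ _ r (`|M| * Mv) set0).
  - exact: negligible_set0.
  - by move=> n; apply: measurable_of_tame; exact: tame_lbmM (lq n u lu) tv.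
  - by apply: measurable_of_tame; exact: tame_lbmM lu' tv.
  - move=> n x xr; rewrite normrM ler_pM//.
    have [s /andP[s0 s1] ->] := mvt_quotient n x du.
    rewrite (le_trans (uM _ _)) ?ler_norm// (le_trans (ler_normD _ _))// lerD//.
    by rewrite normrZ ger0_norm// ler_piMl.
  - by move=> n x rx; rewrite vr ?mulr0.
  - by move=> x _; apply: cvgM; [exact: cvg_difference_quotient|exact: cvg_cst].
have c2 : integ (fun x => u x * (n.+1%:R * (v (x - t n *: h) - v x))) @[n --> \oo] --> integ (fun x => u x * - v' x).
  have [M uM] := lbm_bounded lu (r + `|h|).
  have dv' x : is_derive x (- h) v (- v' x).
    by have := is_derive_scale (-1) (dv x); rewrite scaleN1r mulN1r.
  have out n x : r + `|h| < `|x| -> v (x - t n *: h) - v x = 0.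
    move=> rx; rewrite !vr ?subrr//; first by rewrite (le_lt_trans _ rx)// lerDl.
    rewrite -ltrBrDr in rx; apply: lt_le_trans rx _; rewrite lerBlDr.
    rewrite -{1}(subrK (t n *: h) x) (le_trans (ler_normD _ _))// lerD//.
    by have /andP[? ?] := t01 n; rewrite normrZ ger0_norm// ler_piMl.
  apply: (@integ_cvg _ _ _ _ (r + `|h|) (`|M| * Mv') set0).
  - exact: negligible_set0.
  - move=> n; apply: lbm_measurable; apply: (lbmM lu); apply: lbmZ; apply: lbmB; last exact: tame_lbm.
    exact: lbm_shift (tame_lbm tv).
  - apply: lbm_measurable; exact: (lbmM lu (lbmN (tame_lbm tv'))).
  - move=> n x xr; rewrite normrM ler_pM//.
      by rewrite (le_trans (uM _ xr))// ler_norm.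
    have [s _ h2] := mvt_quotient n x dv'.
    by rewrite scalerN in h2; rewrite h2 normrN.
  - by move=> n x rx; rewrite out ?mulr0.
  - move=> x _; apply: cvgM; first exact: cvg_cst.
    have := cvg_difference_quotient (dv' x); apply: cvg_trans; apply: near_eq_cvg.
    by apply: nearW => n; rewrite scalerN.
have E1 n : integ (fun x => n.+1%:R * (u (x + t n *: h) - u x) * v x) =
   integ (fun x => u x * (n.+1%:R * (v (x - t n *: h) - v x))).
  have tvs := tame_shift (- (t n *: h)) tv.
  have := integ_shiftM (t n *: h) lu tv.
  have T1 : tame (fun x => u (x + t n *: h) * v x).
    exact: tame_lbmM (lbm_shift _ lu) tv.
  have T2 := tame_lbmM lu tv; have T3 := tame_lbmM lu tvs.
  move=> e1.
  transitivity (n.+1%:R * (integ (fun x => u (x + t n *: h) * v x) - integ (u \* v))).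
    rewrite -(integB T1 T2) -(integZ _ (tameB T1 T2)); congr integ.
    by apply/funext => x /=; ring.
  rewrite e1 -(integB T3 T2) -(integZ _ (tameB T3 T2)); congr integ.
  by apply/funext => x /=; ring.
have E2 : integ (fun x => u x * - v' x) = integ (u' \* v).
  rewrite -(cvg_lim (@Rhausdorff R) c2) -(cvg_lim (@Rhausdorff R) c1).
  by congr (lim (_ @ \oo)); apply/funext => n; rewrite E1.
rewrite -E2 -(integN (tame_lbmM lu (tameN tv'))); congr integ.
by apply/funext => x /=; rewrite mulrN opprK.
Qed.

End IntegrationByParts.

Section Convolution.
Context {R : realType} {d : nat}.
Local Notation E := 'rV[R]_d.
Local Notation mE := (rVlebesgue R d).
Local Notation mu := (@lebesgue_rV R d).
Implicit Types (g u psi : E -> R) (x h : E).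

(** Correlation rather than convolution: the mollifiers are even, so nothing is
    lost, and no reflection of the kernel has to be carried along. *)
Definition convol (u g : E -> R) (x : E) : R := integ (fun y => g y * u (y - x)).

Lemma convol_tame u g x : lbm g -> tame u -> tame (fun y => g y * u (y - x)).
Proof. by move=> lg tu; exact: tame_lbmM lg (tame_shift _ tu). Qed.

Lemma Sm_tame u : Sm u -> csupp u -> tame u.
Proof. by move=> Su cu; exact/test_tame/Sm_csupp_test. Qed.

Lemma integ_le_cube g k (r c : R) : lbm g -> tame k -> 0 <= c ->
  (forall y, `|k y| <= c) -> (forall y, r < `|y| -> k y = 0) ->
  `|integ (g \* k)| <= c * integ (fun y => `|g y| * (\1_(cube r) : E -> R) y).
Proof.
move=> lg tk c0 kc kr.
have tg : tame (fun y => `|g y| * (\1_(cube r) : E -> R) y).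
  by apply: tame_lbmM; [exact: lbm_norm|exact: tame_cube].
have tgk := tame_lbmM lg tk.
apply: le_trans (integ_abs_le tgk) _; rewrite -integZ//.
apply: le_integ; [exact: tame_norm|exact: tameZ|] => y /=.
rewrite normrM mulrCA; apply: ler_wpM2l => //.
have [yr|yr] := leP `|y| r; first by rewrite indicE mem_set//= mulr1.
by rewrite kr// normr0 mulr_ge0.
Qed.

(** The quadratic Taylor bound of the kernel is uniform, so it can be
    integrated against [g]; the constant depends only on bounds for the base
    point and the increment. *)
Lemma convol_taylor u g (a b : R) : Sm u -> csupp u -> lbm g ->
  exists2 C : R, 0 <= C & forall x v, `|x| <= a -> `|v| <= b ->
    `|convol u g (x + v) - convol u g x + \sum_(j < d) v 0 j * convol (partial j u) g x| <=
    C * `|v| ^+ 2.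
Proof.
move=> Su cu lg; have tu := Sm_tame Su cu.
have [L L0 HL] := Sm_taylor Su cu.
have tp j : tame (partial j u).
  by apply: Sm_tame; [exact: (Sm_partial j Su).1|exact: csupp_partial].
have [r ur] := cu.
(* All kernels involved vanish outside the cube of radius r'. *)
pose r' := r + a + b.
pose B := integ (fun y => `|g y| * (\1_(cube r') : E -> R) y).
have B0 : 0 <= B by apply: Rintegral_ge0 => y _; rewrite mulr_ge0.
exists (L * B); first exact: mulr_ge0.
move=> x v xa vb.
have pr j y : r < `|y| -> partial j u y = 0 by exact: partial_eq0.
pose Q y := \sum_(j < d) v 0 j * (g y * partial j u (y - x)).
have tj j : tame (fun y => g y * partial j u (y - x)) by exact: convol_tame.
have [tQ intQ] := @integ_sum R d _ (index_enum 'I_d)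
  (fun j y => v 0 j * (g y * partial j u (y - x))) (fun j => tameZ _ (tj j)).
have {}intQ : integ Q = \sum_(j < d) v 0 j * convol (partial j u) g x.
  by rewrite intQ; apply: eq_bigr => j _; rewrite (integZ _ (tj j)).
pose k y := u (y - (x + v)) - u (y - x) + \sum_(j < d) v 0 j * partial j u (y - x).
have T1 := convol_tame (x + v) lg tu; have T2 := convol_tame x lg tu.
have kE : g \* k = (fun y => g y * u (y - (x + v)) - g y * u (y - x) + Q y).
  apply/funext => y /=; rewrite /k /Q mulrDr mulrBr; congr (_ + _).
  by rewrite mulr_sumr; apply: eq_bigr => j _; rewrite mulrCA.
have tS : tame (fun y => \sum_(j < d) v 0 j * partial j u (y - x)).
  apply: (integ_sum (index_enum 'I_d) _).1.
  by move=> j; apply: tameZ; exact: tame_shift (tp j).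
have tk : tame k.
  by apply: tameD tS; apply: tameB; exact: tame_shift tu.
have -> : convol u g (x + v) - convol u g x +
    \sum_(j < d) v 0 j * convol (partial j u) g x = integ (g \* k).
  by rewrite -intQ kE -(integB T1 T2); exact: (esym (integD (tameB T1 T2) tQ)).
have ko y : k y = u (y - x - v) - u (y - x) - \sum_(j < d) (- v) 0 j * partial j u (y - x).
  rewrite /k opprD addrA; congr (_ + _); rewrite -sumrN.
  by apply: eq_bigr => j _; rewrite !mxE mulNr opprK.
apply: le_trans (@integ_le_cube g k r' (L * `|v| ^+ 2) lg tk _ _ _) _.
- by rewrite mulr_ge0 ?sqr_ge0.
- by move=> y; rewrite ko -(normrN v); exact: HL.
- move=> y ry.
  have ry1 : r < `|y - x|.
    rewrite -(ltrD2r `|x|); apply: lt_le_trans (_ : `|y| <= _).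
      apply: le_lt_trans ry; rewrite /r' -addrA lerD2l.
      by apply: le_trans xa _; rewrite lerDl; exact: le_trans vb.
    by rewrite -{1}(subrK x y) ler_normD.
  have ry2 : r < `|y - (x + v)|.
    rewrite -(ltrD2r `|x + v|); apply: lt_le_trans (_ : `|y| <= _).
      apply: le_lt_trans ry; rewrite /r' -addrA lerD2l.
      by apply: le_trans (ler_normD _ _) _; exact: lerD.
    by rewrite -{1}(subrK (x + v) y) ler_normD.
  rewrite /k ur// ur// subrr add0r big1 // => j _.
  by rewrite pr ?mulr0.
by rewrite -/B mulrAC.
Qed.

Lemma convol_derive u g x h : Sm u -> csupp u -> lbm g ->
  is_derive x h (convol u g) (- \sum_(j < d) h 0 j * convol (partial j u) g x).
Proof.
move=> Su cu lg; have [C C0 HC] := convol_taylor `|x| `|h| Su cu lg.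
apply: (@is_derive_quadratic _ _ _ _ _ _ (C * `|h| ^+ 2)) => t t1.
have th : `|t *: h| <= `|h| by rewrite normrZ ler_piMl.
have := HC x (t *: h) (lexx _) th.
rewrite normrZ exprMn real_normK ?num_real// mulrN opprK mulr_sumr => H.
rewrite mulrAC -mulrA; apply: le_trans H.
rewrite le_eqVlt; apply/orP; left; apply/eqP; congr (`| _ + _ |).
by apply: eq_bigr => j _; rewrite mxE mulrA.
Qed.

Lemma lipschitz_near_continuous u (x : E) (C s : R) : 0 < s ->
  (forall h, `|h| <= s -> `|u (x + h) - u x| <= C * `|h|) -> {for x, continuous u}.
Proof.
move=> s0 H; have : u y @[y --> x] --> u x; last by [].
move=> A /nbhs_ballP[e /= e0 eA].
have C1 : 0 < `|C| + 1 by rewrite ltr_wpDl.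
apply/nbhs_ballP; exists (Num.min s (e / (`|C| + 1))) => /=.
  by rewrite lt_min s0 divr_gt0.
move=> y; rewrite -ball_normE /= distrC lt_min => /andP[/ltW h1 h2].
apply: eA; rewrite -ball_normE /= distrC.
have -> : u y = u (x + (y - x)) by rewrite addrC subrK.
apply: le_lt_trans (H _ h1) _.
apply: le_lt_trans (_ : (`|C| + 1) * `|y - x| < _).
  by rewrite ler_wpM2r// ler_wpDr// ler_norm.
by rewrite mulrC -ltr_pdivlMr.
Qed.

Lemma convol_continuous u g : Sm u -> csupp u -> lbm g -> continuous (convol u g).
Proof.
move=> Su cu lg x; have tu := Sm_tame Su cu.
have [L L0 HL] := Sm_lipschitz Su cu; have [r ur] := cu.
pose r' := r + `|x| + 1.
pose B := integ (fun y => `|g y| * (\1_(cube r') : E -> R) y).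
apply: (@lipschitz_near_continuous _ _ (L * B) 1) => // h h1.
have T1 := convol_tame (x + h) lg tu; have T2 := convol_tame x lg tu.
pose k y := u (y - (x + h)) - u (y - x).
have tk : tame k by apply: tameB; exact: tame_shift tu.
have -> : convol u g (x + h) - convol u g x = integ (g \* k).
  rewrite -(integB T1 T2); congr integ; apply/funext => y /=.
  by rewrite /k mulrBr.
apply: le_trans (@integ_le_cube g k r' (L * `|h|) lg tk _ _ _) _.
- by rewrite mulr_ge0.
- by move=> y; rewrite /k opprD addrA -[X in _ * X]normrN; exact: HL.
- move=> y ry; rewrite /k !ur ?subrr//.
    rewrite -(ltrD2r `|x|); apply: lt_le_trans (_ : `|y| <= _).
      by apply: le_lt_trans ry; rewrite /r' lerDl.
    by rewrite -{1}(subrK x y) ler_normD.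
  rewrite -(ltrD2r `|x + h|); apply: lt_le_trans (_ : `|y| <= _).
    apply: le_lt_trans ry; rewrite /r' -addrA lerD2l (le_trans (ler_normD _ _))//.
    by rewrite lerD2l.
  by rewrite -{1}(subrK (x + h) y) ler_normD.
by rewrite -/B mulrAC.
Qed.

End Convolution.

Section Mollification.
Context {R : realType} {d : nat}.
Local Notation E := 'rV[R]_d.
Local Notation mE := (rVlebesgue R d).
Local Notation mu := (@lebesgue_rV R d).
Implicit Types (g u psi : E -> R) (x h : E).

Lemma tame_rho_shift n x : tame (fun y => rho n (y - x)).
Proof. exact: tame_shift (rho_tame n). Qed.

Lemma integ_rho_shift n x : integ (fun y => rho n (y - x)) = 1.
Proof. by rewrite (integ_shift (- x) (rho_tame n)) integ_rho. Qed.

(** The mollifiers are probability densities supported in small cubes, so a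
    mollification is an average of nearby values. *)
Lemma convol_rho_le n g x (c : R) (N : set mE) : lbm g -> mu.-negligible N ->
  (forall y, ~ N y -> `|y - x| <= n.+1%:R^-1 -> g y <= c) -> convol (rho n) g x <= c.
Proof.
move=> lg nN gc; rewrite -[leRHS]mulr1 -(integ_rho_shift n x).
rewrite -(integZ _ (tame_rho_shift n x)).
apply: (ae_le_integ nN); [exact: convol_tame lg (rho_tame n)|exact: tameZ (tame_rho_shift n x)|].
move=> y Ny; have [yx|yx] := leP `|y - x| n.+1%:R^-1.
  by rewrite ler_wpM2r ?rho_ge0// gc.
by rewrite rho_eq0// !mulr0.
Qed.

Lemma convolN u g x : lbm g -> tame u -> convol u (\- g) x = - convol u g x.
Proof.
move=> lg tu; rewrite -(integN (convol_tame x lg tu)); congr integ.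
by apply/funext => y /=; rewrite mulNr.
Qed.

Lemma convol_rho_norm_le n g x (c : R) : lbm g ->
  (forall y, `|y - x| <= n.+1%:R^-1 -> `|g y| <= c) -> `|convol (rho n) g x| <= c.
Proof.
move=> lg gc; have n0 := @negligible_set0 _ mE R mu.
rewrite ler_norml lerNl -(convolN x lg (rho_tame n)); apply/andP; split.
  apply: (convol_rho_le (lbmN lg) n0) => y _ /gc; rewrite ler_norml => /andP[h _].
  by rewrite lerNl.
by apply: (convol_rho_le lg n0) => y _ /gc; rewrite ler_norml => /andP[].
Qed.

Lemma convol_rho_dist_le n g x (a e : R) : lbm g ->
  (forall y, `|y - x| <= n.+1%:R^-1 -> `|g y - a| <= e) -> `|convol (rho n) g x - a| <= e.
Proof.
move=> lg gc.
have -> : convol (rho n) g x - a = convol (rho n) (fun y => g y - a) x.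
  have T2 := tameZ a (tame_rho_shift n x).
  rewrite -[X in _ - X]mulr1 -(integ_rho_shift n x) -(integZ _ (tame_rho_shift n x)).
  rewrite -(integB (convol_tame x lg (rho_tame n)) T2); congr integ.
  by apply/funext => y /=; rewrite mulrBl.
exact: (convol_rho_norm_le (lbmB lg (lbm_cst a))) gc.
Qed.

Lemma invS_lt (e : R) : 0 < e -> \forall n \near \oo, n.+1%:R^-1 < e.
Proof.
move=> e0; have := @cvg_harmonic R => /cvgrPdist_lt/(_ _ e0).
by apply: filterS => n; rewrite sub0r normrN ger0_norm// invr_ge0.
Qed.

Lemma convol_rho_cvg g x : lbm g -> {for x, continuous g} ->
  convol (rho n) g x @[n --> \oo] --> g x.
Proof.
move=> lg cg; apply/cvgrPdist_le => /= e e0.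
have /nbhs_ballP[r /= r0 Hr] := cg _ (nbhsx_ballx (g x) e e0).
near=> n; rewrite distrC; apply: convol_rho_dist_le => // y yx.
have : ball x r y.
  rewrite -ball_normE /= distrC; apply: le_lt_trans yx _.
  by near: n; exact: invS_lt.
by move=> /Hr; rewrite -ball_normE /= distrC => /ltW.
Unshelve. all: by end_near.
Qed.

Lemma invS_le1 n : (n.+1%:R^-1 : R) <= 1.
Proof. by rewrite invf_le1// ler1n. Qed.

(** Fubini, the kernel being even. *)
Lemma convol_rho_symm n g psi : lbm g -> continuous psi -> csupp psi ->
  integ (convol (rho n) g \* psi) = integ (g \* convol (rho n) psi).
Proof.
move=> lg cpsi [r rpsi].
have lpsi := continuous_lbm cpsi.
have [M gM] := lbm_bounded lg (r + 1).
have [P P0 HP] := csupp_bounded cpsi (ex_intro _ r rpsi).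
have [Q Q0 HQ] := csupp_bounded (Sm_continuous (rho_Sm n)) (@rho_csupp R d n).
have near1 x y : rho n (y - x) != 0 -> `|y - x| <= 1.
  move=> h; apply: le_trans (invS_le1 n); rewrite leNgt; apply/negP => /rho_eq0 h0.
  by rewrite h0 eqxx in h.
pose F x y := psi x * (g y * rho n (y - x)).
have Fxy x y : F x y != 0 -> `|x| <= r /\ `|y| <= r + 1.
  move=> F0; have xr : `|x| <= r.
    by rewrite leNgt; apply: contra F0 => /rpsi px; rewrite /F px mul0r.
  split => //; rewrite -(subrK x y) (le_trans (ler_normD _ _))// addrC lerD// near1//.
  by apply: contra F0 => /eqP p0; rewrite /F p0 !mulr0.
transitivity (integ (fun x => integ (F x))).
  congr integ; apply/funext => x /=; rewrite mulrC -(integZ _ (convol_tame x lg (rho_tame n))).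
  by [].
rewrite (@integ_fubini R d F (r + 1) (P * (`|M| * Q))); first last.
- move=> x y rxy; apply/eqP; apply: contraT => /Fxy[h1 h2]; exfalso; case: rxy.
    by apply/negP; rewrite -leNgt (le_trans h1) ?lerDl ?ler01.
  by apply/negP; rewrite -leNgt h2.
- move=> x y; have [->|/Fxy[h1 h2]] := eqVneq (F x y) 0.
    by rewrite normr0 !mulr_ge0.
  rewrite normrM [X in _ * X]normrM; apply: ler_pM; rewrite ?mulr_ge0 ?normr_ge0 ?HP//.
  apply: ler_pM; rewrite ?normr_ge0 ?HQ//.
  exact: le_trans (gM _ h2) (ler_norm M).
- apply: measurable_funM.
    exact: (measurableT_comp (lbm_measurable lpsi) measurable_fst).
  apply: measurable_funM.
    exact: (measurableT_comp (lbm_measurable lg) measurable_snd).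
  apply: (@continuous_measurable_comp R d _ (mE * mE)%type (fun z => (z.2 : E) - (z.1 : E)) (rho n)).
    move=> i; under eq_fun do rewrite !mxE.
    apply: measurable_funB.
      exact: (measurableT_comp (@measurable_coord R d i) measurable_snd).
    exact: (measurableT_comp (@measurable_coord R d i) measurable_fst).
  exact: Sm_continuous (rho_Sm n).
congr integ; apply/funext => y /=; rewrite /convol.
rewrite -(integZ _ (convol_tame y lpsi (rho_tame n))); congr integ.
by apply/funext => x; rewrite /F -(rho_even n (x - y)) opprB; ring.
Qed.

Lemma convol_rho_eq0 n g (r : R) x : (forall y, r < `|y| -> g y = 0) ->
  r + 1 < `|x| -> convol (rho n) g x = 0.
Proof.
move=> gr rx; rewrite -[RHS](@integ0 R d); congr integ; apply/funext => y /=.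
have [ry|yr] := ltP r `|y|; first by rewrite gr ?mul0r.
rewrite rho_eq0 ?mulr0//; apply: le_lt_trans (invS_le1 n) _.
rewrite distrC -(ltrD2l r) ; apply: lt_le_trans rx _.
by rewrite -{1}(subrK y x) addrC (le_trans (ler_normD _ _))// lerD2r.
Qed.

(** By symmetry the mollification can be moved to the continuous function
    [psi], where it converges pointwise. *)
Lemma convol_rho_weak_cvg g psi : lbm g -> continuous psi -> csupp psi ->
  integ (convol (rho n) g \* psi) @[n --> \oo] --> integ (g \* psi).
Proof.
move=> lg cpsi [r rpsi].
have spsi : csupp psi by exists r.
have lpsi := continuous_lbm cpsi.
have [P P0 HP] := csupp_bounded cpsi spsi.
have [M gM] := lbm_bounded lg (r + 1).
under eq_fun do rewrite (convol_rho_symm _ lg cpsi spsi).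
apply: (@integ_cvg _ _ _ _ (r + 1) (`|M| * P) set0).
- exact: negligible_set0.
- move=> n; apply: lbm_measurable; apply: (lbmM lg); apply: continuous_lbm.
  exact: convol_continuous (rho_Sm n) (@rho_csupp _ _ n) lpsi.
- by apply: lbm_measurable; exact: lbmM lg lpsi.
- move=> n x xr; rewrite normrM ler_pM//.
    by rewrite (le_trans (gM _ xr))// ler_norm.
  by apply: (convol_rho_norm_le lpsi) => y _; exact: HP.
- by move=> n x rx; rewrite /= (convol_rho_eq0 n rpsi rx) mulr0.
- move=> x _; apply: cvgM; first exact: cvg_cst.
  exact: convol_rho_cvg lpsi (cpsi x).
Qed.

End Mollification.

(** * Convex separation and difference quotients for the Clarke derivative *)

Section EuclideanGeometry.
Context {R : realType} {d : nat}.
Local Notation E := 'rV[R]_d.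
Implicit Types (u v w h x : E) (A C : set E).

Lemma dotvDl u v h : dotv (u + v) h = dotv u h + dotv v h.
Proof. by rewrite /dotv -big_split/=; apply: eq_bigr => i _; rewrite mxE mulrDl. Qed.

Lemma dotvZl (a : R) v h : dotv (a *: v) h = a * dotv v h.
Proof. by rewrite /dotv mulr_sumr; apply: eq_bigr => i _; rewrite mxE mulrA. Qed.

Lemma dotvC u v : dotv u v = dotv v u.
Proof. by apply: eq_bigr => i _; rewrite mulrC. Qed.

Lemma dotvNl v h : dotv (- v) h = - dotv v h.
Proof. by rewrite -scaleN1r dotvZl mulN1r. Qed.

Lemma dotvBl u v h : dotv (u - v) h = dotv u h - dotv v h.
Proof. by rewrite dotvDl dotvNl. Qed.

Lemma dotvZr (a : R) v h : dotv v (a *: h) = a * dotv v h.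
Proof. by rewrite dotvC dotvZl dotvC. Qed.

Lemma dotvBr u v h : dotv h (u - v) = dotv h u - dotv h v.
Proof. by rewrite dotvC dotvBl !(dotvC h). Qed.

Lemma dotv_sqB (t : R) u v :
  dotv (t *: u - v) (t *: u - v) = dotv v v - t * (dotv u v + dotv u v - t * dotv u u).
Proof. rewrite dotvBl !dotvBr !dotvZl !dotvZr (dotvC v u); ring. Qed.

Lemma dotvv_ge0 v : 0 <= dotv v v.
Proof. by apply: sumr_ge0 => i _; rewrite -expr2 sqr_ge0. Qed.

Lemma coord_sqr_le_dotv v i : (v 0 i) ^+ 2 <= dotv v v.
Proof.
rewrite /dotv (bigD1 i)//= -expr2 lerDl.
by apply: sumr_ge0 => j _; rewrite -expr2 sqr_ge0.
Qed.

Lemma dotvv_gt0 v : v != 0 -> 0 < dotv v v.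
Proof.
move=> v0; rewrite lt_neqAle dotvv_ge0 andbT eq_sym; apply: contra v0 => /eqP v0.
apply/eqP/rowP => i; rewrite mxE; apply/eqP; rewrite -sqrf_eq0 eq_le sqr_ge0 andbT.
by rewrite -v0 coord_sqr_le_dotv.
Qed.

Lemma continuous_dotvl h : continuous (fun v => dotv v h).
Proof.
apply: continuous_sum => i; apply: contM; [exact: coord_continuous|exact: cst_continuous].
Qed.

Lemma continuous_sqdist w : continuous (fun v => dotv (v - w) (v - w)).
Proof.
apply: continuous_sum => i.
have c1 : continuous (fun v : E => (v - w) 0 i).
  by under eq_fun do rewrite !mxE; exact: continuous_coordB.
exact: contM.
Qed.

Lemma coord_le_enorm v i : `|v 0 i| <= enorm v.
Proof.
rewrite -(ler_pXn2r (_ : 0 < 2)%N) ?nnegrE ?sqrtr_ge0// sqr_sqrtr ?dotvv_ge0//.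
by rewrite real_normK ?num_real// coord_sqr_le_dotv.
Qed.

Lemma norm_le_enorm v : `|v| <= enorm v.
Proof. by apply: norm_le_coord => [|i]; [exact: sqrtr_ge0|exact: coord_le_enorm]. Qed.

Lemma nbhs_eball x (r : R) : 0 < r -> nbhs x (eball x r).
Proof.
move=> r0; apply: open_nbhs_nbhs; split; last first.
  by rewrite /eball/= subrr /enorm /dotv big1 ?sqrtr0// => i _; rewrite !mxE mul0r.
apply: (@open_comp _ _ (fun y : E => enorm (y - x)) [set t : R | t < r]); last exact: open_lt.
move=> y _; apply: (@continuous_comp _ _ _ (fun y : E => dotv (y - x) (y - x)) Num.sqrt).
  exact: continuous_sqdist.
exact: sqrt_continuous.
Qed.

Lemma eball_norm x y (r : R) : eball x r y -> `|y - x| < r.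
Proof. exact: le_lt_trans (norm_le_enorm _). Qed.

Lemma nbhs_norm_lt x (U : set E) : nbhs x U -> exists2 r : R, 0 < r & forall y, `|y - x| < r -> U y.
Proof.
move=> /nbhs_ballP[r /= r0 rU]; exists r => // y yx; apply: rU.
by rewrite -ball_normE /= distrC.
Qed.

Lemma norm_lt_nbhs x (r : R) : 0 < r -> nbhs x [set y : E | `|y - x| < r].
Proof.
move=> r0; apply/nbhs_ballP; exists r => // y.
by rewrite -ball_normE /= distrC.
Qed.

Lemma convex_halfspace h (c : R) : convex_set [set w : E | dotv w h <= c].
Proof.
move=> x y l; rewrite !inE /= => xc yc.
have l0 : 0 <= (l%:num : R) by exact: ge0.
have l1 : (l%:num : R) <= 1 by exact: le1.
rewrite [convex.conv _ _ _](_ : _ = l%:num *: (x : E) + (1 - l%:num) *: (y : E))//.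
rewrite dotvDl !dotvZl.
rewrite (_ : c = l%:num * c + (1 - l%:num) * c); last by ring.
by apply: lerD; apply: ler_wpM2l => //; rewrite subr_ge0.
Qed.

(** Together with [separation], this describes closed convex hulls by the
    half-spaces that contain the set. *)
Lemma hull_halfspace A h (c : R) : (forall w, A w -> dotv w h <= c) ->
  forall v, closed_convex_hull A v -> dotv v h <= c.
Proof.
move=> Ac v; apply: (@smallest_sub _ _ A [set w : E | dotv w h <= c]) => //.
split; last exact: convex_halfspace.
apply: (@closed_comp _ _ (fun v => dotv v h) [set t : R | t <= c]); last exact: closed_le.
by move=> w _; exact: continuous_dotvl.
Qed.

Lemma closed_hull A : closed (closed_convex_hull A).
Proof. by apply: closed_bigI => C [[]]. Qed.

Lemma convex_hull A : convex_set (closed_convex_hull A : set E).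
Proof.
move=> x y l; rewrite !inE => xA yA C [[clC cvC] AC].
have := cvC x y l; rewrite !inE; apply; [exact: xA|exact: yA].
Qed.

Lemma sub_hull A : A `<=` closed_convex_hull A.
Proof. exact: sub_smallest. Qed.

(** The hyperplane through the point of [C] nearest to [v], orthogonal to the
    segment joining them. *)
Lemma separation C v : closed C -> convex_set (C : set E) -> ~ C v ->
  exists h (c : R), (forall w, C w -> dotv w h <= c) /\ c < dotv v h.
Proof.
move=> clC cvC nCv; have [C0|/set0P[w0 Cw0]] := eqVneq C set0.
  (* The zero functional separates every point from the empty set. *)
  exists 0, (-1); rewrite C0; split => //.
  by rewrite /dotv big1 ?ltrN10// => i _; rewrite mxE mulr0.
pose q w := dotv (w - v) (w - v).
(* The minimum of the distance is taken over the bounded part of C. *)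
pose K := C `&` [set w | q w <= q w0].
have cK : compact K.
  apply: bounded_closed_compact.
    exists (`|v| + Num.sqrt (q w0)); split; first exact: num_real.
    move=> M MM w [_ /= qw]; apply: le_trans (ltW MM).
    rewrite -(subrK v w) addrC (le_trans (ler_normD _ _))// lerD2l.
    by rewrite (le_trans (norm_le_enorm _))// ler_wsqrtr.
  apply: closedI => //.
  apply: (@closed_comp _ _ q [set t : R | t <= q w0]); last exact: closed_le.
  by move=> w _; exact: continuous_sqdist.
have [||p /set_mem[Cp qp] pmin] := @EVT_min_rV R d q K _ cK.
- by exists w0; split => /=.
- by apply: continuous_subspaceT; exact: continuous_sqdist.
have {}pmin w : C w -> q p <= q w.
  move=> Cw; have [qw|qw] := leP (q w) (q w0); first by apply: pmin; apply/mem_set.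
  by rewrite (le_trans qp)// ltW.
have h0 : v - p != 0 by apply: contra_not_neq nCv => /eqP; rewrite subr_eq0 => /eqP ->.
exists (v - p), (dotv p (v - p)); split; last first.
  by rewrite -subr_gt0 -dotvBl dotvv_gt0.
move=> w Cw; rewrite -subr_le0 -dotvBl; rewrite leNgt; apply/negP => a0.
set a := dotv (w - p) (v - p) in a0; set b := dotv (w - p) (w - p).
have b0 : 0 <= b := dotvv_ge0 _.
have b1 : 0 < b + a by rewrite ltr_wpDl.
(* If a > 0, a step of this length from p towards w stays in C and comes closer to v. *)
pose t := a / (b + a).
have t01 : 0 < t <= 1 by rewrite divr_gt0//= ler_pdivrMr// mul1r lerDr.
have Ct : C (p + t *: (w - p)).
  have t0' : 0 <= t by have /andP[/ltW] := t01.
  have t1' : t <= 1 by have /andP[_] := t01.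
  have := cvC w p (Itv01 t0' t1'); rewrite !inE => /(_ Cw Cp).
  rewrite [convex.conv _ _ _](_ : _ = t *: w + (1 - t) *: p)//.
  congr C; rewrite scalerBl scale1r scalerBr; exact: addrCA.
have := pmin _ Ct; rewrite /q.
have -> : dotv (p + t *: (w - p) - v) (p + t *: (w - p) - v) =
    dotv (p - v) (p - v) - t * (a + a - t * b).
  have -> : p + t *: (w - p) - v = t *: (w - p) - (v - p) by rewrite opprB addrCA addrA addrC addrA.
  rewrite -(opprB v p) dotvNl (dotvC (v - p)) dotvNl opprK.
  by rewrite dotv_sqB.
rewrite lerBrDr gerDl leNgt => /negP; apply.
have /andP[t0 t1] := t01; rewrite mulr_gt0// subr_gt0.
apply: le_lt_trans (_ : _ <= a) _; last by rewrite ltrDl.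
by rewrite /t mulrAC ler_pdivrMr// ler_wpM2l ?(ltW a0)// lerDl ltW.
Qed.

End EuclideanGeometry.

Section ClarkeDerivative.
Context {R : realType} {d : nat}.
Local Notation E := 'rV[R]_d.
Implicit Types (phi : E -> R) (x h : E).

(** Bounds on the Clarke derivative and bounds on difference quotients near the
    point and at small positive times are equivalent up to strictness; this lemma
    and [clarke_derivative_lt] are the two directions. *)
Lemma clarke_derivative_le phi x h (c r : R) : 0 < r ->
  (forall y (t : R), `|y - x| < r -> 0 < t < r -> phi (y + t *: h) - phi y <= c * t) ->
  (clarke_derivative phi x h <= c%:E)%E.
Proof.
move=> r0 H.
pose A := [set p : E * R | `|p.1 - x| < r /\ 0 < p.2 < r].
rewrite /clarke_derivative /limf_esup; set f := (fun p : E * R => _); apply: (@le_trans _ _ (ereal_sup (f @` A))).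
  apply: ereal_inf_lbound; exists A => //.
  exists ([set y : E | `|y - x| < r], [set t : R | 0 < t < r]) => /=.
    split; first exact: norm_lt_nbhs.
    apply/nbhs_ballP; exists r => // t; rewrite /ball/= sub0r normrN => tr t0.
    by rewrite t0 (le_lt_trans (ler_norm t)).
  by move=> [y t] /= [].
apply: ge_ereal_sup => _ [[y t] /= [yr tr] <-]; rewrite /f/= lee_fin.
by have /andP[t0 _] := tr; rewrite ler_pdivrMr//; exact: H.
Qed.

Lemma clarke_derivative_lt phi x h (c : R) : (clarke_derivative phi x h < c%:E)%E ->
  exists2 r : R, 0 < r &
    forall y (t : R), `|y - x| < r -> 0 < t < r -> phi (y + t *: h) - phi y <= c * t.
Proof.
move=> /ereal_inf_lt[_ [A [[P Q] /= [xP Q0] PQA] <-] Ac].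
have [r r0 rP] := nbhs_norm_lt xP.
have /nbhs_ballP[s /= s0 sQ] := Q0.
exists (Num.min r s); first by rewrite lt_min r0.
move=> y t; rewrite !lt_min => /andP[yr _] /and3P[t0 tr ts].
rewrite -ler_pdivrMr// -lee_fin; apply: le_trans (ltW Ac); apply: ereal_sup_ubound.
exists (y, t) => //; apply: PQA; split => /=; first exact: rP.
by apply: sQ => //=; rewrite /ball/= sub0r normrN gtr0_norm.
Qed.

End ClarkeDerivative.

(** * Weak gradients and difference quotients *)

Section WeakGradient.
Context {R : realType} {d : nat}.
Local Notation E := 'rV[R]_d.
Local Notation mE := (rVlebesgue R d).
Local Notation mu := (@lebesgue_rV R d).
Implicit Types (f : E -> E) (phi psi : E -> R) (x h : E).

Definition lbmv f := forall i, lbm (fun x => f x 0 i).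

Definition weak_grad f phi := forall i psi, test psi ->
  integ (phi \* partial i psi) = - integ ((fun x => f x 0 i) \* psi).

Lemma lbm_dotv f h : lbmv f -> lbm (fun x => dotv (f x) h).
Proof.
move=> lf; apply: lbm_sum => i.
by under eq_fun do rewrite mulrC; exact: lbmZ (lf i).
Qed.

Lemma convol_dotv f h u x : lbmv f -> tame u ->
  convol u (fun y => dotv (f y) h) x = \sum_(j < d) h 0 j * convol u (fun y => f y 0 j) x.
Proof.
move=> lf tu.
have tj j : tame (fun y => f y 0 j * u (y - x)) by exact: convol_tame.
have [_ E1] := @integ_sum R d _ (index_enum 'I_d)
  (fun j y => h 0 j * (f y 0 j * u (y - x))) (fun j => tameZ _ (tj j)).
transitivity (integ (fun y => \sum_(j < d) h 0 j * (f y 0 j * u (y - x)))).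
  congr integ; apply/funext => y; rewrite /dotv mulr_suml.
  by apply: eq_bigr => j _; rewrite mulrA [h 0 j * _]mulrC.
by rewrite E1; apply: eq_bigr => j _; rewrite (integZ _ (tj j)).
Qed.

Lemma partial_shift i psi x y : partial i (fun z => psi (z - x)) y = partial i psi (y - x).
Proof.
have E1 : (fun t : R => t^-1 *: (((fun z => psi (z - x)) \o shift y) (t *: basisv i) - psi (y - x))) =
    (fun t : R => t^-1 *: ((psi \o shift (y - x)) (t *: basisv i) - psi (y - x))).
  by apply/funext => t /=; rewrite /shift addrA.
by rewrite /partial /derive E1.
Qed.

Lemma test_rho_shift n x : test (fun y => rho n (y - x)).
Proof.
apply: Sm_csupp_test; first exact: Sm_shift (rho_Sm n).
exact: csupp_shift (@rho_csupp R d n).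
Qed.

(** The gradient of a mollification is the mollification of the weak gradient:
    translates of the mollifier are test functions. *)
Lemma weak_grad_convol_derive n f phi x h : lbm phi -> lbmv f -> weak_grad f phi ->
  is_derive x h (convol (rho n) phi) (convol (rho n) (fun y => dotv (f y) h) x).
Proof.
move=> lp lf wg; have := convol_derive x h (rho_Sm n) (@rho_csupp R d n) lp.
congr (is_derive _ _ _ _); rewrite (convol_dotv _ _ lf (rho_tame n)) -sumrN.
apply: eq_bigr => j _; rewrite -mulrN; congr (_ * _).
have E1 := wg j _ (test_rho_shift n x).
have E2 : convol (rho n) (fun y => f y 0 j) x = - integ (phi \* partial j (fun y => rho n (y - x))).
  exact: (esym (etrans (congr1 -%R E1) (opprK _))).
have E3 : partial j (fun y => rho n (y - x)) = (fun y => partial j (rho n) (y - x)).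
  by apply/funext => y; exact: partial_shift.
rewrite E3 in E2; exact: (esym E2).
Qed.

Lemma derive_le_quotient u x h (D c r : R) : 0 < r -> is_derive x h u D ->
  (forall t : R, 0 < t < r -> u (x + t *: h) - u x <= c * t) -> D <= c.
Proof.
move=> r0 dD H; have cv := cvg_difference_quotient dD.
rewrite -(cvg_lim (@Rhausdorff R) cv); apply: limr_le; first by apply/cvg_ex; eexists; exact: cv.
near=> n; rewrite -ler_pdivlMl ?ltr0n// mulrC; apply: H.
rewrite invr_gt0 ltr0n/=; near: n; exact: invS_lt.
Unshelve. all: by end_near.
Qed.

Lemma convol_rho_quotient_le n phi x h (c t : R) : lbm phi ->
  (forall y, `|y - x| <= n.+1%:R^-1 -> phi (y + t *: h) - phi y <= c * t) ->
  convol (rho n) phi (x + t *: h) - convol (rho n) phi x <= c * t.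
Proof.
move=> lp H; have ls := lbm_shift (t *: h) lp.
have -> : convol (rho n) phi (x + t *: h) = convol (rho n) (fun y => phi (y + t *: h)) x.
  rewrite /convol -(integ_shift (t *: h) (convol_tame (x + t *: h) lp (rho_tame n))).
  by congr integ; apply/funext => y /=; rewrite opprD addrACA subrr addr0.
rewrite -(integB (convol_tame x ls (rho_tame n)) (convol_tame x lp (rho_tame n))).
rewrite (_ : _ \- _ = (fun y => (phi (y + t *: h) - phi y) * rho n (y - x))); last first.
  by apply/funext => y /=; rewrite mulrBl.
by apply: (convol_rho_le (lbmB ls lp) (@negligible_set0 _ mE R mu)) => y _; exact: H.
Qed.

Lemma convol_rho_derive n phi x h : lbm phi ->
  is_derive x h (convol (rho n) phi) (dotv (\row_j - convol (partial j (rho n)) phi x) h).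
Proof.
move=> lp; have := convol_derive x h (rho_Sm n) (@rho_csupp R d n) lp.
congr (is_derive _ _ _ _); rewrite /dotv -sumrN; apply: eq_bigr => j _.
by rewrite mxE mulNr mulrC.
Qed.

Lemma convol_rho_grad_le n phi x h (c r : R) : 0 < r -> lbm phi ->
  (forall y (t : R), `|y - x| <= n.+1%:R^-1 -> 0 < t < r -> phi (y + t *: h) - phi y <= c * t) ->
  dotv (\row_j - convol (partial j (rho n)) phi x) h <= c.
Proof.
move=> r0 lp H; apply: (derive_le_quotient r0 (convol_rho_derive n x h lp)) => t t0.
by apply: convol_rho_quotient_le => // y yx; exact: H.
Qed.

(** For the mollifications this is the mean value theorem, since averaging
    preserves the bound on the directional derivative on a slightly smaller
    ball; then the mollifications converge.  The hypothesis that both end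
    points lie in the ball suffices because balls are convex. *)
Lemma ae_le_difference_quotient f phi x0 h (c r : R) (N : set mE) : continuous phi -> lbmv f ->
  weak_grad f phi -> mu.-negligible N ->
  (forall y, ~ N y -> `|y - x0| < r -> dotv (f y) h <= c) ->
  forall y (t : R), 0 <= t -> `|y - x0| < r -> `|y + t *: h - x0| < r ->
    phi (y + t *: h) - phi y <= c * t.
Proof.
move=> cp lf wg nN H y t t0 yr ytr; have lp := continuous_lbm cp.
have ld := lbm_dotv h lf.
(* The segment stays at a positive distance e from the boundary of the ball. *)
have [e e0 He] : exists2 e : R, 0 < e & forall s : R, 0 <= s <= 1 -> `|y + s *: (t *: h) - x0| < r - e.
  pose m := Num.max `|y - x0| `|y + t *: h - x0|.
  have mr : m < r by rewrite gt_max yr.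
  exists ((r - m) / 2); first by rewrite divr_gt0// subr_gt0.
  move=> s /andP[s0 s1].
  have -> : y + s *: (t *: h) - x0 = (1 - s) *: (y - x0) + s *: (y + t *: h - x0).
    by apply/rowP => i; rewrite !mxE; ring.
  apply: (@le_lt_trans _ _ m); last by lra.
  apply: le_trans (ler_normD _ _) _; rewrite !normrZ ger0_norm ?subr_ge0// (ger0_norm s0).
  rewrite (_ : m = (1 - s) * m + s * m); last by ring.
  by apply: lerD; apply: ler_wpM2l; rewrite ?subr_ge0// le_max lexx ?orbT.
have key : \forall n \near \oo,
    convol (rho n) phi (y + t *: h) - convol (rho n) phi y <= c * t.
  near=> n.
  have [z|s s01 ->] := @mvt_line R _ (convol (rho n) phi)
      (fun z => t * convol (rho n) (fun y => dotv (f y) h) z) y (t *: h).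
    by apply: is_derive_scale; exact: weak_grad_convol_derive.
  rewrite mulrC; apply: ler_wpM2r => //.
  apply: (convol_rho_le ld nN) => z Nz zn; apply: H => //.
  rewrite -(subrK (y + s *: (t *: h)) z) -addrA; apply: le_lt_trans (ler_normD _ _) _.
  have en : n.+1%:R^-1 < e by near: n; exact: invS_lt.
  by apply: lt_trans (ler_ltD zn (He s s01)) _; rewrite addrCA gtrDl subr_lt0.
have c1 := convol_rho_cvg lp (cp (y + t *: h)); have c2 := convol_rho_cvg lp (cp y).
have c3 : convol (rho n) phi (y + t *: h) - convol (rho n) phi y @[n --> \oo] -->
    phi (y + t *: h) - phi y by exact: cvgB.
rewrite -(cvg_lim (@Rhausdorff R) c3); apply: limr_le => //.
by apply/cvg_ex; eexists; exact: c3.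
Unshelve. all: by end_near.
Qed.

(** Averaging preserves bounds on difference quotients, so the directional
    derivatives of the mollifications, which are the mollifications of f.h,
    are at most [c].  Integrated against nonnegative functions supported near
    [x0] this passes to the weak limit, and [negligible_gt0] turns it into a
    pointwise bound almost everywhere. *)
Lemma difference_quotient_le_ae f phi x0 h (c r : R) : 0 < r -> continuous phi -> lbmv f ->
  weak_grad f phi ->
  (forall y (t : R), `|y - x0| < r -> 0 < t < r -> phi (y + t *: h) - phi y <= c * t) ->
  exists2 N : set mE, mu.-negligible N &
    forall y, ~ N y -> `|y - x0| < r / 2 -> dotv (f y) h <= c.
Proof.
move=> r0 cp lf wg H; have lp := continuous_lbm cp.
have ld := lbm_dotv h lf.
pose g y := dotv (f y) h - c.
have lg : lbm g by exact: lbmB ld (lbm_cst c).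
(* The open cube of radius r / 2 around x0. *)
pose p : E * E := (x0 - const_mx (r / 2), x0 + const_mx (r / 2)).
have pE y : `|y - x0| < r / 2 -> obox p y.
  move=> yr i; rewrite /= !mxE; have := le_lt_trans (le_coord_norm (y - x0) i) yr.
  by rewrite !mxE ltr_norml => /andP[? ?]; apply/andP; split; lra.
have pE' y : obox p y -> `|y - x0| <= r / 2.
  move=> py; apply: norm_le_coord => [|i]; first by rewrite divr_ge0// ltW.
  have /andP := py i; rewrite /= !mxE => -[? ?].
  by rewrite ler_norml; apply/andP; split; lra.
exists [set y | obox p y /\ 0 < g y]; last first.
  move=> y Ny yr; rewrite leNgt; apply/negP => cf; apply: Ny.
  by split; [exact: pE|rewrite /g subr_gt0].
apply: negligible_gt0 => // psi cpsi psi0 psio.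
have [rr prr] := obox_bounded p.
have spsi : csupp psi by exists rr => y ry; apply: psio => /prr; rewrite leNgt ry.
have cv := convol_rho_weak_cvg lg cpsi spsi.
rewrite -(cvg_lim (@Rhausdorff R) cv); apply: limr_le; first by apply/cvg_ex; eexists; exact: cv.
have tpsi : tame psi by split; [exact: continuous_lbm|].
near=> n.
rewrite -(@integ0 R d); apply: le_integ; [|exact: tame0|].
  apply: (tame_lbmM _ tpsi); apply: continuous_lbm.
  exact: convol_continuous (rho_Sm n) (@rho_csupp R d n) lg.
move=> y /=; have [py|npy] := pselect (obox p y); last by rewrite psio ?mulr0.
apply: mulr_le0_ge0; last exact: psi0.
have -> : convol (rho n) g y = convol (rho n) (fun y => dotv (f y) h) y - c.
  rewrite -[X in _ - X]mulr1 -(integ_rho_shift n y) -(integZ _ (tame_rho_shift n y)).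
  rewrite -(integB (convol_tame y ld (rho_tame n)) (tameZ c (tame_rho_shift n y))).
  by congr integ; apply/funext => z /=; rewrite /g mulrBl.
rewrite subr_le0.
apply: (derive_le_quotient r0 (weak_grad_convol_derive n y h lp lf wg)) => t t0.
apply: convol_rho_quotient_le => // z zy; apply: H => //.
rewrite -(subrK y z) -addrA; apply: le_lt_trans (ler_normD _ _) _.
have en : n.+1%:R^-1 < r / 2 by near: n; apply: invS_lt; rewrite divr_gt0.
by apply: le_lt_trans (lerD zy (pE' _ py)) _; rewrite [ltRHS](splitr r) ltrD2r.
Unshelve. all: by end_near.
Qed.

End WeakGradient.

(** * Local bounds, near-minimizing sequences and almost everywhere convergence *)

Section LocalBounds.
Context {R : realType} {d : nat}.
Local Notation E := 'rV[R]_d.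
Implicit Types (phi : E -> R) (x y h : E).

Lemma locally_lipschitz_ball phi x : locally_lipschitz phi -> exists2 e : R, 0 < e &
  exists2 k : R, 0 <= k & forall y z, `|y - x| < e -> `|z - x| < e -> `|phi y - phi z| <= k * `|y - z|.
Proof.
move=> /(_ x)[U xU [k kU]]; have [e e0 eU] := nbhs_norm_lt xU.
exists e => //; exists `|k| => // y z ye ze.
have := kU (y, z) (conj (eU _ ye) (eU _ ze)).
by move=> /le_trans; apply; rewrite ler_wpM2r// ler_norm.
Qed.

Lemma locally_lipschitz_continuous phi : locally_lipschitz phi -> continuous phi.
Proof.
move=> lphi x; have [e e0 [k k0 H]] := locally_lipschitz_ball x lphi.
apply: (@lipschitz_near_continuous _ _ _ _ k (e / 2)); first by rewrite divr_gt0.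
move=> h he; have := H (x + h) x; rewrite addrAC subrr add0r; apply.
  by apply: le_lt_trans he _; rewrite ltr_pdivrMr// mulr_natr mulr2n ltrDl.
by rewrite normr0.
Qed.

(** Nearby points are handled by compactness of the cube, distant ones by the
    boundedness of [phi] on it. *)
Lemma lipschitz_cube phi : locally_lipschitz phi -> forall r : R,
  exists2 L : R, 0 <= L & forall x y, `|x| <= r -> `|y| <= r -> `|phi x - phi y| <= L * `|x - y|.
Proof.
move=> lphi r; have cphi := locally_lipschitz_continuous lphi.
have [M phiM] := continuous_bounded_cube r cphi.
have /compact_near_coveringP := @compact_cube R d r.
move=> /(_ nat \oo (fun n x => forall y, `|y - x| < n.+1%:R^-1 -> `|phi x - phi y| <= n%:R * `|x - y|)).
case.
  move=> x xr; have [e e0 [k k0 H]] := locally_lipschitz_ball x lphi.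
  have e20 : 0 < e / 2 by rewrite divr_gt0.
  exists ([set y | `|y - x| < e / 2], [set n : nat | n.+1%:R^-1 < e / 2 /\ k <= n%:R]).
    split; first exact: norm_lt_nbhs.
    by apply: filterI; [exact: invS_lt|exact: nbhs_infty_ger].
  move=> [y n] /= [ye [ne kn]] z zn; apply: le_trans (_ : k * `|y - z| <= _); last by rewrite ler_wpM2r.
  apply: H; first by apply: lt_le_trans ye _; rewrite ler_pdivrMr// mulr_natr mulr2n lerDl ltW.
  rewrite -(subrK y z) -addrA; apply: le_lt_trans (ler_normD _ _) _.
  by rewrite [ltRHS](splitr e) ltrD// (lt_trans zn).
move=> N _ HN; pose L : R := Num.max N%:R (2 * `|M| * N.+1%:R).
exists L; first by rewrite le_max ler0n.
move=> x y xr yr; have [h|h] := ltP `|y - x| N.+1%:R^-1.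
  apply: le_trans (HN N (leqnn N) x xr y h) _.
  by rewrite ler_wpM2r// le_max lexx.
apply: (@le_trans _ _ (2 * `|M|)).
  rewrite mulr_natl mulr2n (le_trans (ler_normB _ _))// lerD//.
    by rewrite (le_trans (phiM _ xr))// ler_norm.
  by rewrite (le_trans (phiM _ yr))// ler_norm.
apply: (@le_trans _ _ (2 * `|M| * N.+1%:R * `|x - y|)); last by rewrite ler_wpM2r// le_max lexx orbT.
rewrite -mulrA ler_peMr ?mulr_ge0// -ler_pdivrMl ?ltr0n// mulr1.
by rewrite distrC.
Qed.

(** A compact value lies in an open ball, which contains the neighbouring values
    by upper semicontinuity; then the cube is compact. *)
Lemma cusco_locally_bounded (Phi : E -> set E) : cusco Phi -> forall r : R,
  exists M : R, forall x v, `|x| <= r -> Phi x v -> `|v| <= M.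
Proof.
move=> [usc cpt] r.
have /compact_near_coveringP := @compact_cube R d r.
move=> /(_ nat \oo (fun n x => forall v, Phi x v -> `|v| <= n%:R)).
case.
  move=> x xr; have [_ /compact_bounded[M [_ HM]] _] := cpt x.
  have HMM : Phi x `<=` [set v | `|v| < `|M| + 2].
    move=> v xv /=; apply: (@le_lt_trans _ _ (`|M| + 1)); last by rewrite ltrD2l ltr1n.
    by apply: HM => //; rewrite ltr_pwDr// ler_norm.
  have oV : open [set v : E | `|v| < `|M| + 2].
    apply: (@open_comp _ _ (fun v : E => `|v|) [set t : R | t < `|M| + 2]); last exact: open_lt.
    by move=> v _; exact: norm_continuous.
  have nx := usc x _ oV HMM.
  exists ([set y | Phi y `<=` [set v | `|v| < `|M| + 2]], [set n : nat | `|M| + 2 <= n%:R]).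
    by split => //=; exact: nbhs_infty_ger.
  move=> [y n] /= [yV Mn] v yv; apply: le_trans Mn; apply: ltW; exact: yV.
move=> n _ Hn; exists n%:R => x v xr xv; exact: (Hn n (leqnn n) x xr v xv).
Qed.

End LocalBounds.

Section NearMinimizers.
Context {R : realType}.

Lemma nneseries_geometric_le (c z : R) : 0 <= c -> 0 <= z < 1 ->
  (\sum_(j <oo) (c * z ^+ j)%:E <= (c / (1 - z))%:E)%E.
Proof.
move=> c0 /andP[z0 z1]; have cz j : 0 <= c * z ^+ j by rewrite mulr_ge0 ?exprn_ge0.
apply: lime_le; first by apply: is_cvg_nneseries => j _ _; rewrite lee_fin.
apply: nearW => n; rewrite sumEFin lee_fin -mulr_sumr ler_wpM2l// big_mkord.
have z1' : 0 < 1 - z by rewrite subr_gt0.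
rewrite -[leRHS]mul1r ler_pdivlMr// mulrC -[1 - z]opprB mulNr -subrX1 opprB.
by rewrite gerBl exprn_ge0.
Qed.

(** The infima of [Q] over the decreasing sets [C n] increase to a finite limit.
    Choosing elements of [C n] whose values of [Q] and whose midpoints both
    have almost that limiting value, the parallelogram identity bounds their
    distance [D].  This replaces completeness of a Hilbert space and weak
    compactness. *)
Lemma near_minimizers (T : Type) (C : nat -> set T) (mid : T -> T -> T)
    (Q : T -> R) (D : T -> T -> R) (e : nat -> R) :
  (forall n, C n !=set0) -> (forall n m, (n <= m)%N -> C m `<=` C n) ->
  (forall n u v, C n u -> C n v -> C n (mid u v)) ->
  (exists M, forall u, C 0%N u -> 0 <= Q u <= M) ->
  (forall u v, C 0%N u -> C 0%N v -> D u v + 4 * Q (mid u v) <= 2 * Q u + 2 * Q v) ->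
  (forall n, 0 < e n) -> (forall n, e n.+1 <= e n) ->
  exists u : nat -> T, forall j, C j (u j) /\ D (u j) (u j.+1) <= e j.
Proof.
move=> C0 Cdec Cmid [M Q0M] Qpar e0 edec.
have Q0 u : C 0%N u -> 0 <= Q u by move=> /Q0M/andP[].
have QM u : C 0%N u -> Q u <= M by move=> /Q0M/andP[].
pose m n := inf [set Q u | u in C n].
have hasinf n : has_inf [set Q u | u in C n].
  split; first by have [u Cu] := C0 n; exists (Q u), u.
  by exists 0 => _ [u Cu <-]; apply: Q0; exact: Cdec (leq0n n) _ Cu.
have mle n u : C n u -> m n <= Q u.
  by move=> Cu; apply: ge_inf; [exact: (hasinf n).2|exists u].
have mmono n k : (n <= k)%N -> m n <= m k.
  move=> nk; apply: lb_le_inf; first exact: (hasinf k).1.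
  by move=> _ [u Cu <-]; apply: mle; exact: Cdec nk _ Cu.
pose ml := sup (range m).
have hassup : has_sup (range m).
  split; first by exists (m 0%N), 0%N.
  exists M => _ [n _ <-]; have [u Cu] := C0 n.
  by apply: le_trans (mle _ _ Cu) _; apply: QM; exact: Cdec (leq0n n) _ Cu.
have mml n : m n <= ml by apply: ub_le_sup; [exact: hassup.2|exists n].
(* From stage N j on, all infima are within e j / 8 of their limit. *)
have /choice[N HN] : forall j, exists n, (j <= n)%N /\ ml - e j / 8 <= m n.
  move=> j; have [_ [n _ <-] /ltW H] := sup_adherent (divr_gt0 (e0 j) (ltr0n _ 8)) hassup.
  exists (maxn j n); split; first exact: leq_maxl.
  by apply: le_trans H _; apply: mmono; exact: leq_maxr.
have /choice[u Hu] : forall j, exists u, C (N j) u /\ Q u <= ml + e j / 8.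
  move=> j; have [_ [u Cu <-] H] := inf_adherent (divr_gt0 (e0 j) (ltr0n _ 8)) (hasinf (N j)).
  exists u; split => //; apply: le_trans (ltW H) _; rewrite lerD2r; exact: mml.
exists u => j; split; first exact: Cdec (HN j).1 _ (Hu j).1.
have C0u i : C 0%N (u i) by exact: Cdec (leq0n _) _ (Hu i).1.
have := Qpar _ _ (C0u j) (C0u j.+1).
have : ml - e j / 8 <= Q (mid (u j) (u j.+1)).
  have [h|h] := leqP (N j) (N j.+1).
    apply: le_trans (HN j).2 _; apply: mle; apply: Cmid; first exact: (Hu j).1.
    exact: Cdec h _ (Hu j.+1).1.
  apply: (@le_trans _ _ (m (N j.+1))).
    apply: le_trans (HN j.+1).2; rewrite lerD2l lerN2 ler_pM2r ?invr_gt0//.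
  apply: mle; apply: Cmid; last exact: (Hu j.+1).1.
  exact: Cdec (ltnW h) _ (Hu j).1.
have := (Hu j).2; have := (Hu j.+1).2; have := edec j; have := e0 j.
set a := Q _; set b := Q _; set c := Q _; set dd := D _ _.
lra.
Qed.

(** Countably many quadratic energies are handled at once by summing them with
    summable weights, here already included in [q]. *)
Lemma near_minimizers_series (T : Type) (C : nat -> set T) (mid : T -> T -> T)
    (q : nat -> T -> R) (D : nat -> T -> T -> R) (e : nat -> R) :
  (forall n, C n !=set0) -> (forall n m, (n <= m)%N -> C m `<=` C n) ->
  (forall n u v, C n u -> C n v -> C n (mid u v)) ->
  (forall k u, C 0%N u -> 0 <= q k u <= 2^-1 ^+ k) ->
  (forall k u v, C 0%N u -> C 0%N v -> 0 <= D k u v) ->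
  (forall k u v, C 0%N u -> C 0%N v ->
    D k u v + 4 * q k (mid u v) = 2 * q k u + 2 * q k v) ->
  (forall n, 0 < e n) -> (forall n, e n.+1 <= e n) ->
  exists u : nat -> T, forall j, C j (u j) /\ forall k, D k (u j) (u j.+1) <= e j.
Proof.
move=> C0 Cdec Cmid qb D0 par e0 edec.
pose Q u := limn (series (q^~ u)).
pose DD u v := limn (series (fun k => D k u v)).
have cq u : C 0%N u -> cvgn (series (q^~ u)).
  move=> Cu; apply: (@series_le_cvg _ _ (geometric 1 2^-1)) => [k|k|k|].
  - by have /andP[] := qb k u Cu.
  - by rewrite /= mul1r exprn_ge0// invr_ge0.
  - by rewrite /= mul1r; have /andP[] := qb k u Cu.
  - by apply: is_cvg_geometric_series; rewrite ger0_norm// invf_lt1// ltr1n.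
have DE u v : C 0%N u -> C 0%N v -> series (fun k => D k u v) =
    (fun n => 2 * series (q^~ u) n + 2 * series (q^~ v) n - 4 * series (q^~ (mid u v)) n).
  move=> Cu Cv; apply/funext => n; rewrite /series/= !mulr_sumr -big_split/= -sumrB.
  by apply: eq_bigr => k _; rewrite -(par k u v Cu Cv) addrK.
have cD u v : C 0%N u -> C 0%N v ->
    series (fun k => D k u v) n @[n --> \oo] --> 2 * Q u + 2 * Q v - 4 * Q (mid u v).
  move=> Cu Cv; rewrite (DE u v Cu Cv).
  by apply: cvgB; [apply: cvgD|]; (apply: cvgM; [exact: cvg_cst|]);
    [exact: cq|exact: cq|apply: cq; exact: Cmid].
have [||u Hu] := @near_minimizers T C mid Q DD e C0 Cdec Cmid _ _ e0 edec.
- exists (limn (series (geometric (1 : R) 2^-1))) => u Cu; apply/andP; split.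
    by apply: limr_ge; [exact: cq|apply: nearW => n; apply: sumr_ge0 => k _; have /andP[] := qb k u Cu].
  apply: ler_lim; [exact: cq| |].
    by apply: is_cvg_geometric_series; rewrite ger0_norm// invf_lt1// ltr1n.
  apply: nearW => n; apply: ler_sum => k _; rewrite /= mul1r; by have /andP[] := qb k u Cu.
- move=> u v Cu Cv; rewrite /DD (cvg_lim (@Rhausdorff R) (cD u v Cu Cv)).
  by rewrite subrK.
exists u => j; have [Cj Dj] := Hu j; split => // k; apply: le_trans Dj.
have Cu i : C 0%N (u i) by apply: Cdec (leq0n i) _ (Hu i).1.
have DD0 l : 0 <= D l (u j) (u j.+1) by exact: D0.
apply: le_trans (_ : series (fun k => D k (u j) (u j.+1)) k.+1 <= _).
  by rewrite /series/= big_nat_recr//= lerDr sumr_ge0.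
apply: nondecreasing_cvgn_le; first by apply: nondecreasing_series => l _ _.
by apply/cvg_ex; eexists; exact: cD.
Qed.

Lemma cvg_of_geometric_steps (v : nat -> R) (S : R) :
  (forall j, `|v j.+1 - v j| <= S * 2^-1 ^+ j) -> cvgn v.
Proof.
move=> H.
have c1 : cvgn (series (fun j => v j.+1 - v j)).
  apply: normed_cvg; apply: (@series_le_cvg _ _ (geometric S 2^-1)).
  - by move=> n; exact: normr_ge0.
  - by move=> n; exact: le_trans (normr_ge0 _) (H n).
  - by move=> n; exact: H.
  - by apply: is_cvg_geometric_series; rewrite ger0_norm// invf_lt1// ltr1n.
suff -> : v = (fun n => v 0%N + series (fun j => v j.+1 - v j) n).
  by apply: is_cvgD => //; exact: is_cvg_cst.
apply/funext => n; rewrite /series/= telescope_sumr// addrC subrK//.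
Qed.

End NearMinimizers.

Section FastCauchy.
Context {R : realType} {d : nat}.
Local Notation E := 'rV[R]_d.
Local Notation mE := (rVlebesgue R d).
Local Notation mu := (@lebesgue_rV R d).

(** If the squared L^2 norms decay like 16^-j, the sum of 4^j (D j)^2 is
    integrable, hence finite almost everywhere, and D j decays like 2^-j there. *)
Lemma ae_geometric_bound (D : nat -> E -> R) (r c : R) : (forall j, lbm (D j)) ->
  (forall j, integ (fun x => (D j x) ^+ 2 * (\1_(cube r) : E -> R) x) <= c * 16^-1 ^+ j) ->
  exists2 N : set mE, mu.-negligible N &
    forall x, ~ N x -> `|x| <= r -> exists S : R, forall j, `|D j x| <= S * 2^-1 ^+ j.
Proof.
move=> lD H.
(* The factor 4 ^ j still leaves a convergent geometric series, of ratio 4 / 16. *)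
pose F j x := 4 ^+ j * ((D j x) ^+ 2 * (\1_(cube r) : E -> R) x).
have t0 j : tame (fun x => (D j x) ^+ 2 * (\1_(cube r) : E -> R) x).
  exact: tame_lbmM (lbmM (lD j) (lD j)) (tame_cube r).
have tF j : tame (F j) by exact: tameZ (t0 j).
have F0 j x : 0 <= F j x by apply: mulr_ge0; [exact: exprn_ge0|rewrite mulr_ge0 ?sqr_ge0].
pose S (x : mE) : \bar R := (\sum_(j <oo) (F j x)%:E)%E.
have mS : measurable_fun [set: mE] S.
  apply: ge0_emeasurable_sum => [j x _ _|j _]; first by rewrite lee_fin.
  by apply/measurable_EFinP; exact: measurable_of_tame (tF j).
have S0 x : (0 <= S x)%E by apply: nneseries_ge0 => j _ _; rewrite lee_fin.
have iS : mu.-integrable [set: mE] S.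
  apply/integrableP; split => //.
  rewrite (eq_integral S); last by move=> x _; rewrite gee0_abs.
  rewrite /S (integral_nneseries mu measurableT); last 2 first.
  - by move=> j; apply/measurable_EFinP; exact: measurable_of_tame (tF j).
  - by move=> j x _; rewrite lee_fin.
  apply: (@le_lt_trans _ _ (\sum_(j <oo) (`|c| * 4^-1 ^+ j)%:E)%E).
    apply: lee_nneseries => j _; first by move=> _; apply: integral_ge0 => x _; rewrite lee_fin.
    rewrite (integE (tF j)) lee_fin /F (integZ _ (t0 j)).
    apply: le_trans (_ : 4 ^+ j * (`|c| * 16^-1 ^+ j) <= _).
      rewrite ler_wpM2l// (le_trans (H j))// ler_wpM2r ?ler_norm//.
    rewrite mulrCA -exprMn (_ : 4 * 16^-1 = 4^-1 :> R)//.
    by field.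
  have := @nneseries_geometric_le R `|c| 4^-1 (normr_ge0 c).
  by rewrite invr_ge0 ler0n/= invf_lt1 ?ltr1n// => /(_ isT) /le_lt_trans; apply; exact: ltry.
have := integrable_ae measurableT iS.
move=> [N [mN N0 NS]]; exists N; first by exists N; split.
move=> x Nx xr; have Sfin : S x \is a fin_num.
  by apply: contrapT => h; apply: Nx; apply: NS => /= /(_ I).
exists (Num.sqrt (fine (S x))) => j.
have h : F j x <= fine (S x).
  rewrite -lee_fin fineK//.
  apply: le_trans (nneseries_lim_ge j.+1 _); last by move=> k _ _; rewrite lee_fin.
  by rewrite big_mkord big_ord_recr/= leeDr// sume_ge0// => k _; rewrite lee_fin.
rewrite -sqrtr_sqr.
have -> : (2^-1 : R) ^+ j = Num.sqrt (4^-1 ^+ j).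
  have e4 : 4^-1 = 2^-1 ^+ 2 :> R by field.
  by rewrite e4 -exprM mulnC exprM sqrtr_sqr ger0_norm// exprn_ge0 ?invr_ge0.
rewrite -sqrtrM ?fine_ge0//; apply: ler_wsqrtr.
move: h; rewrite /F indicE mem_set//= mulr1 exprVn => h.
by rewrite ler_pdivlMr ?exprn_gt0// mulrC.
Qed.

End FastCauchy.

(** * A weak gradient selected from the Clarke subdifferential *)

Section GradientConstruction.
Context {R : realType} {d : nat}.
Local Notation E := 'rV[R]_d.
Local Notation mE := (rVlebesgue R d).
Local Notation mu := (@lebesgue_rV R d).
Variable phi : E -> R.
Hypothesis lphi : locally_lipschitz phi.

Let cphi : continuous phi := locally_lipschitz_continuous lphi.
Let lbphi : lbm phi := continuous_lbm cphi.

(** Field [u] is a gradient of [phi] at scale 1/(n+1): wherever the difference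
    quotients of [phi] in direction [h] are at most [c] on the ball of radius
    1/(n+1) around [x] and for small times, [u x] respects this bound; and the
    weak gradient equation holds for [u] up to the error made by replacing
    [phi] by its mollifications of index at least [n].  Both conditions are
    convex in [u], become stronger as [n] grows, and hold for the gradient of
    the [n]-th mollification. *)
Definition approx_grad (n : nat) (u : E -> E) : Prop :=
  [/\ lbmv u,
   forall x h (c r : R), 0 < r ->
     (forall y (t : R), `|y - x| <= n.+1%:R^-1 -> 0 < t < r -> phi (y + t *: h) - phi y <= c * t) ->
     dotv (u x) h <= c &
   forall i psi (e : R), test psi ->
     (forall k, (n <= k)%N ->
        `|integ (convol (rho k) phi \* partial i psi) - integ (phi \* partial i psi)| <= e) ->
     `|integ (phi \* partial i psi) + integ ((fun x => u x 0 i) \* psi)| <= e ].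

Lemma approx_grad_mono n m : (n <= m)%N -> approx_grad m `<=` approx_grad n.
Proof.
move=> nm u [lu qu wu]; split => //.
  move=> x h c r r0 H; apply: (qu x h c r r0) => y t yx; apply: H.
  by apply: le_trans yx _; rewrite lef_pV2 ?posrE ?ltr0n// ler_nat.
by move=> i psi e tp H; apply: wu => // k mk; apply: H; exact: leq_trans nm mk.
Qed.

Definition mollified_grad (n : nat) (x : E) : E := \row_j - convol (partial j (rho n)) phi x.

Lemma dotv_basisv (v : E) i : dotv v (basisv i) = v 0 i.
Proof. by rewrite dotvC /dotv dot_basisv. Qed.

Lemma approx_grad_mollified n : approx_grad n (mollified_grad n).
Proof.
have lg : lbmv (mollified_grad n).
  move=> i; under eq_fun do rewrite mxE; apply: lbmN; apply: continuous_lbm.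
  apply: convol_continuous lbphi; first exact: (Sm_partial i (rho_Sm n)).1.
  exact: csupp_partial (@rho_csupp R d n).
split => //; first by move=> x h c r r0 H; exact: (convol_rho_grad_le r0 lbphi H).
move=> i psi e tp /(_ n (leqnn n)).
have lc : lbm (convol (rho n) phi).
  by apply: continuous_lbm; exact: convol_continuous (rho_Sm n) (@rho_csupp R d n) lbphi.
have dc x : is_derive x (basisv i) (convol (rho n) phi) (mollified_grad n x 0 i).
  by rewrite -dotv_basisv; exact: convol_rho_derive.
have dpsi x : is_derive x (basisv i) psi (partial i psi x) by exact: test_is_derive.
rewrite (integration_by_parts lc (lg i) (test_tame tp) (test_tame (test_partial i tp)) dc dpsi).
set a := integ _; set b := integ _.
by move=> H; rewrite -normrN opprD addrC.
Qed.

Definition midpoint (u v : E -> E) (x : E) : E := 2^-1 *: (u x + v x).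

Lemma approx_grad_mid n u v : approx_grad n u -> approx_grad n v -> approx_grad n (midpoint u v).
Proof.
move=> [lu qu wu] [lv qv wv]; split.
- move=> i; rewrite (_ : (fun x => _) = (fun x => 2^-1 * (u x 0 i + v x 0 i))); last first.
    by apply/funext => x; rewrite !mxE.
  exact: lbmZ (lbmD (lu i) (lv i)).
- move=> x h c r r0 H; rewrite dotvZl dotvDl ler_pdivrMl// mulr2n mulrDl mul1r.
  by apply: lerD; [exact: qu H|exact: qv H].
- move=> i psi e tp H.
  have Tu := tame_lbm_test (lu i) tp; have Tv := tame_lbm_test (lv i) tp.
  have -> : integ ((fun x => midpoint u v x 0 i) \* psi) =
      2^-1 * (integ ((fun x => u x 0 i) \* psi) + integ ((fun x => v x 0 i) \* psi)).
    rewrite -(integD Tu Tv) -(integZ _ (tameD Tu Tv)); congr integ.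
    by apply/funext => x /=; rewrite !mxE -mulrDl mulrA.
  have := wu i psi e tp H; have := wv i psi e tp H.
  set a := integ (phi \* _); set b := integ _; set c := integ _.
  rewrite !ler_norml => /andP[? ?] /andP[? ?]; apply/andP; split; lra.
Qed.

Lemma norm_basisv i : `|basisv i : E| <= 1.
Proof.
apply: norm_le_coord => // j; rewrite mxE eqxx /=.
by case: (j == i); rewrite ?normr1 ?normr0.
Qed.

(** Already at the coarsest scale the directions plus and minus a basis vector
    bound the coordinates of the field by a local Lipschitz constant. *)
Lemma approx_grad_bound : exists b : nat -> R, forall k, 0 <= b k /\
  forall u x i, approx_grad 0 u -> `|x| <= k%:R -> `|u x 0 i| <= b k.
Proof.
suff H k : exists b : R, 0 <= b /\ forall u x i, approx_grad 0 u -> `|x| <= k%:R -> `|u x 0 i| <= b.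
  by have [b Hb] := choice H; exists b.
have [L L0 HL] := lipschitz_cube lphi (k%:R + 2); exists L; split => // u x i [_ qu _] xk.
have bound (h : E) : `|h| <= 1 -> dotv (u x) h <= L.
  move=> h1; apply: (qu x h L 1 ltr01) => y t; rewrite invr1 => yx /andP[t0 t1].
  have yk : `|y| <= k%:R + 1.
    by rewrite -(subrK x y) addrC (le_trans (ler_normD _ _))// lerD.
  have th : `|t *: h| <= t by rewrite normrZ gtr0_norm// ler_piMr// ltW.
  apply: le_trans (ler_norm _) _; apply: le_trans (HL _ _ _ _) _.
  - apply: le_trans (ler_normD _ _) _.
    have -> : k%:R + 2 = (k%:R + 1) + 1 :> R by rewrite -addrA.
    by apply: lerD => //; apply: le_trans th _; exact: ltW.
  - by rewrite (le_trans yk)// lerD2l ler1n.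
  - by rewrite addrAC subrr add0r ler_wpM2l.
rewrite ler_norml lerNl; apply/andP; split.
  by rewrite -dotv_basisv -mulN1r -dotvZr; apply: bound; rewrite scaleN1r normrN norm_basisv.
by rewrite -dotv_basisv; apply: bound; exact: norm_basisv.
Qed.

End GradientConstruction.

Section LocalEnergy.
Context {R : realType} {d : nat}.
Local Notation E := 'rV[R]_d.

Definition energy (k : nat) (u : E -> E) : R :=
  integ (fun x => dotv (u x) (u x) * (\1_(cube k%:R) : E -> R) x).

Lemma energy_tame k (u : E -> E) : lbmv u ->
  tame (fun x => dotv (u x) (u x) * (\1_(cube k%:R) : E -> R) x).
Proof.
move=> lu; apply: (tame_lbmM (v := \1_(cube k%:R))); last exact: tame_cube.
by apply: lbm_sum => i; exact: lbmM (lu i) (lu i).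
Qed.

Lemma energy_ge0 k u : 0 <= energy k u.
Proof. by apply: Rintegral_ge0 => x _; rewrite mulr_ge0 ?dotvv_ge0. Qed.

(** The identity for the Euclidean norm, integrated. *)
Lemma energy_parallelogram k u v : lbmv u -> lbmv v ->
  energy k (fun x => u x - v x) + 4 * energy k (midpoint u v) = 2 * energy k u + 2 * energy k v.
Proof.
move=> lu lv.
have ls : lbmv (fun x => u x - v x).
  by move=> i; under eq_fun do rewrite !mxE; exact: lbmB (lu i) (lv i).
have lm : lbmv (midpoint u v).
  move=> i; rewrite (_ : (fun x => _) = (fun x => 2^-1 * (u x 0 i + v x 0 i))); last first.
    by apply/funext => x; rewrite !mxE.
  exact: lbmZ (lbmD (lu i) (lv i)).
have T1 := energy_tame k ls; have T2 := energy_tame k lm.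
have T3 := energy_tame k lu; have T4 := energy_tame k lv.
rewrite /energy -(integZ 4 T2) -(integZ 2 T3) -(integZ 2 T4).
rewrite -(integD T1 (tameZ 4 T2)) -(integD (tameZ 2 T3) (tameZ 2 T4)); congr integ.
apply/funext => x /=; rewrite /midpoint dotvZl dotvZr dotvBl !dotvBr dotvDl.
rewrite !(dotvC _ (u x + v x)) !dotvDl (dotvC (v x) (u x)).
set I := \1__ _; set a := dotv _ _; set b := dotv _ _; set c := dotv _ _.
by field.
Qed.

Lemma energy_coord k u i : lbmv u ->
  integ (fun x => (u x 0 i) ^+ 2 * (\1_(cube k%:R) : E -> R) x) <= energy k u.
Proof.
move=> lu; apply: le_integ.
- exact: tame_lbmM (lbmM (lu i) (lu i)) (tame_cube _).
- exact: energy_tame.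
- by move=> x; rewrite ler_wpM2r// coord_sqr_le_dotv.
Qed.

Lemma energy_le k u (b : R) : lbmv u -> (forall x i, `|x| <= k%:R -> `|u x 0 i| <= b) ->
  energy k u <= d%:R * b ^+ 2 * integ (\1_(cube k%:R) : E -> R).
Proof.
move=> lu ub; rewrite -(integZ _ (tame_cube _)); apply: le_integ.
- exact: energy_tame.
- exact: tameZ (tame_cube _).
- move=> x; rewrite indicE; have [/set_mem xk|_] := boolP (x \in _); last by rewrite !mulr0.
  rewrite !mulr1 mulr_natl -[X in _ *+ X]card_ord -sumr_const; apply: ler_sum => i _.
  by rewrite -expr2 -real_normK ?num_real// ler_sqr ?nnegrE// ?ub// (le_trans _ (ub x i _)).
Qed.

End LocalEnergy.

Section ClarkeSelection.
Context {R : realType} {d : nat}.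
Local Notation E := 'rV[R]_d.
Local Notation mE := (rVlebesgue R d).
Local Notation mu := (@lebesgue_rV R d).

(** Modifying the sequence on the null set is harmless, the measure being
    complete. *)
Lemma measurable_ae_limit (u : nat -> E -> R) (g : E -> R) (N : set mE) :
  mu.-negligible N -> (forall j, measurable_fun [set: mE] (u j)) ->
  (forall x, ~ N x -> u j x @[j --> \oo] --> g x) -> measurable_fun [set: mE] g.
Proof.
move=> nN mu_ ug.
pose v j (x : mE) : R := if x \in N then g x else u j x.
have mv j : measurable_fun [set: mE] (v j).
  move=> _ A mA; rewrite setTI.
  have -> : v j @^-1` A = (N `&` g @^-1` A) `|` (~` N `&` u j @^-1` A).
    apply/seteqP; split => x; rewrite /v /preimage /=.
      by case: ifPn => [/set_mem|/negP Nx] h; [left|right; split => // /mem_set].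
    by case=> [[Nx gx]|[Nx ux]]; [rewrite mem_set|rewrite memNset].
  apply: measurableU.
    by apply: negligible_measurable; apply: negligibleS nN => x [].
  apply: measurableI; first exact/measurableC/negligible_measurable.
  by rewrite -[X in measurable X]setTI; exact: mu_.
apply: (measurable_fun_cvg mv) => x _.
have [Nx|Nx] := pselect (N x).
  have -> : v ^~ x = cst (g x) by apply/funext => j; rewrite /v mem_set.
  exact: cvg_cst.
have -> : v ^~ x = u ^~ x by apply/funext => j; rewrite /v memNset.
exact: ug.
Qed.

Lemma negligible_bigcup_ord (N : nat -> 'I_d -> set mE) :
  (forall k i, mu.-negligible (N k i)) -> mu.-negligible (\bigcup_k \bigcup_i N k i).
Proof.
move=> nN; apply: negligible_bigcup => k.
have -> : \bigcup_i N k i = \bigcup_n (if insub n is Some i then N k i else set0).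
  apply/seteqP; split => [x [i _ Nx]|x [n _]].
    by exists (val i) => //; rewrite valK.
  by case: insubP => // i _ _ Nx; exists i.
apply: negligible_bigcup => n; case: insubP => [i _ _|_]; first exact: nN.
exact: negligible_set0.
Qed.

(** Near-minimizers of the weighted sum of the energies on all cubes of integer
    radius; the weights [a k] make the series converge uniformly on
    [approx_grad phi 0]. *)
Lemma fast_gradients (phi : E -> R) : locally_lipschitz phi ->
  exists2 u : nat -> E -> E, (forall j, approx_grad phi j (u j)) &
  exists2 N : set mE, mu.-negligible N &
    forall x, ~ N x -> forall i, cvgn (fun j => u j x 0 i).
Proof.
move=> lphi; have [b Hb] := approx_grad_bound lphi.
have Ak k : {a : R | 0 < a & a * (1 + d%:R * b k ^+ 2 * integ (\1_(cube k%:R) : E -> R)) = 2^-1 ^+ k}.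
  set I := integ _; have I0 : 0 <= I by apply: Rintegral_ge0.
  have p : 0 < 1 + d%:R * b k ^+ 2 * I.
    by apply: ltr_pwDl => //; do 2 apply: mulr_ge0 => //; exact: sqr_ge0.
  exists (2^-1 ^+ k / (1 + d%:R * b k ^+ 2 * I)).
    by rewrite divr_gt0// exprn_gt0// invr_gt0.
  by rewrite divfK// gt_eqF.
pose a k := sval (Ak k).
have a0 k : 0 < a k by rewrite /a; case: (Ak k).
have aE k : a k * (1 + d%:R * b k ^+ 2 * integ (\1_(cube k%:R) : E -> R)) = 2^-1 ^+ k.
  by rewrite /a; case: (Ak k).
have [| | | | | | | |u Hu] := @near_minimizers_series R (E -> E) (approx_grad phi) (@midpoint R d)
   (fun k u => a k * energy k u) (fun k u v => a k * energy k (fun x => u x - v x))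
   (fun j => 16^-1 ^+ j).
- by move=> n; exists (mollified_grad phi n); exact: approx_grad_mollified.
- by move=> n m nm; exact: approx_grad_mono.
- by move=> n u v; exact: approx_grad_mid.
- move=> k u Cu; apply/andP; split; first by apply: mulr_ge0; [exact: ltW|exact: energy_ge0].
  rewrite -aE; apply: ler_wpM2l; first exact: ltW.
  have [lu _ _] := Cu.
  have := @energy_le _ _ k u (b k) lu (fun x i xk => (Hb k).2 u x i Cu xk).
  by move=> /le_trans; apply; rewrite lerDr.
- by move=> k u v _ _; apply: mulr_ge0; [exact: ltW|exact: energy_ge0].
- move=> k u v [lu _ _] [lv _ _].
  have := energy_parallelogram k lu lv.
  set e1 := energy _ _; set e2 := energy _ _; set e3 := energy _ _; set e4 := energy _ _ => ep.
  by transitivity (a k * (e1 + 4 * e2)); [ring|rewrite ep; ring].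
- by move=> n; rewrite exprn_gt0// invr_gt0.
- move=> n; rewrite exprS ler_piMl ?exprn_ge0 ?invr_ge0// invf_le1//.
  by rewrite ler1n.
exists u => [j|]; first by have [] := Hu j.
have lD j : lbmv (fun x => u j x - u j.+1 x).
  move=> i; have [[lu _ _] _] := Hu j; have [[lv _ _] _] := Hu j.+1.
  under eq_fun do rewrite !mxE; exact: lbmB (lu i) (lv i).
have /choice[N0 HN0] : forall ki : nat * 'I_d, exists N : set mE, mu.-negligible N /\
    forall x, ~ N x -> `|x| <= ki.1%:R -> exists S : R, forall j,
      `|(u j x - u j.+1 x) 0 ki.2| <= S * 2^-1 ^+ j.
  move=> [k i]; have [||N nN HN] := @ae_geometric_bound R d
    (fun j x => (u j x - u j.+1 x) 0 i) k%:R (a k)^-1; [| |by exists N].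
    by move=> j; exact: lD.
  move=> j; apply: le_trans (energy_coord k i (lD j)) _.
  by rewrite ler_pdivlMl//; have [_] := Hu j; exact.
exists (\bigcup_k \bigcup_i N0 (k, i)).
  apply: (@negligible_bigcup_ord (fun k i => N0 (k, i))) => k i.
  by have [] := HN0 (k, i).
move=> x Nx i; have [k xk] : exists k : nat, `|x| <= k%:R.
  by exists (Num.truncn `|x|).+1; apply: ltW; rewrite truncnS_gt.
have [_ /(_ x) H] := HN0 (k, i).
have [|//|S HS] := H; first by move=> Nx'; apply: Nx; exists k => //; exists i.
apply: (@cvg_of_geometric_steps _ _ S) => j.
by rewrite distrC; have := HS j; rewrite !mxE.
Qed.

(** Lets one compare with a possibly infinite Clarke derivative through real
    upper bounds only. *)
Lemma le_ereal_of_gt_fin (x : \bar R) (a : R) : (forall c : R, (x < c%:E)%E -> a <= c) -> (a%:E <= x)%E.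
Proof.
case: x => [r| |] H; last 2 first.
- exact: leey.
- by have := H (a - 1) (ltNyr _); rewrite lerBrDr gerDl ler10.
rewrite lee_fin; apply/ler_addgt0Pr => e e0; apply: H.
by rewrite lte_fin ltrDl.
Qed.

(** The limit of [fast_gradients] lies in the subdifferential off a null set,
    where it is replaced by the given selection [g].  It is a weak gradient
    because the error allowed at scale [n] tends to 0. *)
Lemma clarke_measurable_selection (phi : E -> R) (g : E -> E) : locally_lipschitz phi ->
  (forall x, clarke_subdifferential phi x (g x)) ->
  (forall r, exists M : R, forall x v, `|x| <= r -> clarke_subdifferential phi x v -> `|v| <= M) ->
  exists f, [/\ lbmv f, weak_grad f phi & forall x, clarke_subdifferential phi x (f x)].
Proof.
move=> lphi gphi bphi; have cphi := locally_lipschitz_continuous lphi.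
have lbphi := continuous_lbm cphi.
have [u Cu [N nN uN]] := fast_gradients lphi.
pose f (x : E) : E := if x \in (N : set E) then g x else \row_i limn (fun j => u j x 0 i).
have uf x : ~ N x -> forall i, u j x 0 i @[j --> \oo] --> f x 0 i.
  by move=> Nx i; rewrite /f memNset// mxE; exact: uN.
have fphi x : clarke_subdifferential phi x (f x).
  have [Nx|Nx] := pselect (N x); first by rewrite /f mem_set.
  move=> h; apply: le_ereal_of_gt_fin => c /clarke_derivative_lt[r r0 Hr].
  have cv : dotv (u j x) h @[j --> \oo] --> dotv (f x) h.
    apply: (cvg_big (@add_continuous R^o)) => // i _; apply: cvgM; [exact: uf|exact: cvg_cst].
  rewrite -(cvg_lim (@Rhausdorff R) cv); apply: limr_le; first by apply/cvg_ex; eexists; exact: cv.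
  near=> j; have [_ Hj _] := Cu j; apply: (Hj x h c r r0) => y t yx t0; apply: Hr => //.
  by apply: le_lt_trans yx _; near: j; exact: invS_lt.
have mf i : measurable_fun [set: mE] (fun x => f x 0 i).
  apply: (measurable_ae_limit nN (u := fun j x => u j x 0 i)).
    by move=> j; have [lu _ _] := Cu j; exact: lbm_measurable (lu i).
  by move=> x Nx; exact: uf.
have lf : lbmv f.
  move=> i; split => // r; have [M HM] := bphi r; exists M => x xr.
  exact: le_trans (le_coord_norm _ _) (HM x _ xr (fphi x)).
exists f; split => // i psi tpsi.
have Tf := tame_lbm_test (lf i) tpsi.
have [b Hb] := approx_grad_bound lphi.
have [M M0 HM] := tame_bounded (test_tame tpsi).
have [_ [r ur]] := tpsi; pose k := (Num.truncn r).+1.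
have rk : r < k%:R by rewrite /k truncnS_gt.
(* The fields are bounded on the support of psi, uniformly in j. *)
have cu : integ ((fun x => u j x 0 i) \* psi) @[j --> \oo] --> integ ((fun x => f x 0 i) \* psi).
  apply: (@integ_cvg _ _ _ _ k%:R (b k * M) _ nN).
  - move=> j; have [lu _ _] := Cu j; exact: measurable_of_tame (tame_lbm_test (lu i) tpsi).
  - exact: measurable_of_tame Tf.
  - move=> j x xk; rewrite /= normrM; apply: ler_pM => //.
    by apply: (Hb k).2 xk; exact: approx_grad_mono (leq0n j) _ (Cu j).
  - by move=> j x xk; rewrite /= ur ?mulr0// (lt_trans rk).
  - by move=> x Nx; apply: cvgM; [exact: uf|exact: cvg_cst].
apply/eqP; rewrite -subr_eq0 opprK -normr_le0; apply/ler_addgt0Pr => e e0; rewrite add0r.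
have tp := test_partial i tpsi.
have cr := convol_rho_weak_cvg lbphi (test_continuous tp) tp.2.
have [n0 _ Hn0] : \forall n \near \oo,
   `|integ (convol (rho n) phi \* partial i psi) - integ (phi \* partial i psi)| <= e.
  by move/cvgrPdist_le : cr => /(_ e e0); apply: filterS => n; rewrite distrC.
have cl : `|integ (phi \* partial i psi) + integ ((fun x => u j x 0 i) \* psi)| @[j --> \oo] -->
    `|integ (phi \* partial i psi) + integ ((fun x => f x 0 i) \* psi)|.
  by apply: cvg_norm; apply: cvgD => //; exact: cvg_cst.
rewrite -(cvg_lim (@Rhausdorff R) cl); apply: limr_le; first by apply/cvg_ex; eexists; exact: cl.
exists n0 => // j n0j; have [_ _ wj] := Cu j; apply: wj => // k' jk.
exact: Hn0 (leq_trans n0j jk).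
Unshelve. all: by end_near.
Qed.

End ClarkeSelection.

(** * Filippov regularization of a weak gradient *)

Section MixedPartials.
Context {R : realType} {d : nat}.
Local Notation E := 'rV[R]_d.
Implicit Types (psi : E -> R).

Lemma is_derive_shift psi (x a h : E) (df : R) :
  is_derive (x + a) h psi df -> is_derive x h (fun z => psi (z + a)) df.
Proof.
have E1 : (fun t : R => t^-1 *: (((fun z => psi (z + a)) \o shift x) (t *: h) - psi (x + a))) =
    (fun t : R => t^-1 *: ((psi \o shift (x + a)) (t *: h) - psi (x + a))).
  by apply/funext => t /=; rewrite /shift addrA.
by case=> d1 d2; split; move: d1 d2; rewrite /derivable /derive E1.
Qed.

(** The second difference over a parallelogram, computed by two applications of
    the mean value theorem. *)
Lemma mixed_difference psi (x : E) (t : R) (i j : 'I_d) : test psi -> 0 < t ->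
  exists2 z : E, `|z - x| <= 2 * t &
    psi (x + t *: basisv i + t *: basisv j) - psi (x + t *: basisv i) -
    (psi (x + t *: basisv j) - psi x) = t * (t * partial j (partial i psi) z).
Proof.
move=> tp t0; pose g z := psi (z + t *: basisv j) - psi z.
pose dg z := t * (partial i psi (z + t *: basisv j) - partial i psi z).
have dgE z : is_derive z (t *: basisv i) g (dg z).
  apply: is_derive_scale; apply: is_deriveB; last exact: test_is_derive.
  apply: is_derive_shift; exact: test_is_derive.
have [s /andP[s0 s1] E1] := mvt_line x dgE.
have dp z : is_derive z (t *: basisv j) (partial i psi) (t * partial j (partial i psi) z).
  by apply: is_derive_scale; apply: test_is_derive; exact: test_partial.
have [s' /andP[s'0 s'1] E2] := mvt_line (x + s *: (t *: basisv i)) dp.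
exists (x + s *: (t *: basisv i) + s' *: (t *: basisv j)).
  rewrite -[x + _ + _]addrA [x + _]addrC addrK; apply: le_trans (ler_normD _ _) _.
  rewrite mulr2n mulrDl !mul1r !normrZ (gtr0_norm t0) !ger0_norm//.
  have b k (s'' : R) : 0 <= s'' <= 1 -> s'' * (t * `|basisv k : E|) <= t.
    move=> /andP[a0 a1]; apply: (@le_trans _ _ (1 * (t * 1))); last by rewrite mul1r mulr1.
    by apply: ler_pM => //; [exact: mulr_ge0 (ltW t0) _|rewrite ler_wpM2l ?norm_basisv// ltW].
  by apply: lerD; apply: b; apply/andP.
rewrite -E2 -/(dg _) -E1 /g; ring.
Qed.

(** The second difference is symmetric in the two directions; let the side of
    the square tend to 0. *)
Lemma partial_commute psi (i j : 'I_d) (x : E) : test psi ->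
  partial i (partial j psi) x = partial j (partial i psi) x.
Proof.
move=> tp; apply/eqP; rewrite -subr_eq0 -normr_le0; apply/ler_addgt0Pr => e e0; rewrite add0r.
have near_x k l : \forall z \near x, `|partial k (partial l psi) x - partial k (partial l psi) z| <= e / 2.
  have c := test_continuous (test_partial k (test_partial l tp)).
  by move: (c x) => /cvgrPdist_le; apply; rewrite divr_gt0.
have [r r0 Hr] := nbhs_norm_lt (filterI (near_x i j) (near_x j i)).
pose t := r / 4; have t0 : 0 < t by rewrite divr_gt0.
have tr : 2 * t < r by rewrite /t; lra.
have [y yx Ey] := mixed_difference x i j tp t0.
have [z zx Ez] := mixed_difference x j i tp t0.
have yz : partial j (partial i psi) y = partial i (partial j psi) z.
  have tn : t != 0 by rewrite gt_eqF.
  have e3 : t * (t * partial j (partial i psi) y) = t * (t * partial i (partial j psi) z).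
    apply: etrans (esym Ey) (etrans _ Ez); rewrite (addrAC x (t *: basisv j)).
    set a1 := psi _; set a2 := psi _; set a3 := psi _; set a4 := psi _; ring.
  exact: (mulfI tn (mulfI tn e3)).
have [_ h1] := Hr y (le_lt_trans yx tr); have [h2 _] := Hr z (le_lt_trans zx tr).
rewrite yz in h1.
rewrite [e]splitr; apply: le_trans (lerD h2 h1).
rewrite [X in _ <= _ + X]distrC; apply: le_trans (ler_normD _ _).
by rewrite addrA subrK.
Qed.

End MixedPartials.

Section FilippovClarke.
Context {R : realType} {d : nat}.
Local Notation E := 'rV[R]_d.
Local Notation mE := (rVlebesgue R d).
Local Notation mu := (@lebesgue_rV R d).

(** All integrands are tame, so the extended integrals are real. *)
Lemma nonsmooth_poincareP (f : E -> E) : lbmv f ->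
  nonsmooth_poincare f <-> forall i j psi, test psi ->
    integ ((fun x => f x 0 j) \* partial i psi) = integ ((fun x => f x 0 i) \* partial j psi).
Proof.
move=> lf; have T i j psi : test psi -> tame ((fun x => f x 0 j) \* partial i psi).
  by move=> tp; exact: tame_lbm_test (lf j) (test_partial i tp).
split=> [pf i j psi tp|H i j psi sp /compactly_supportedP cp].
  have e0 := pf i j psi tp.1 (iffRL (compactly_supportedP psi) tp.2).
  exact: EFin_inj (etrans (esym (integE (T i j psi tp))) (etrans e0 (integE (T j i psi tp)))).
have tp : test psi by [].
have e0 := congr1 (@EFin R) (H i j psi tp).
exact: (etrans (integE (T i j psi tp)) (etrans e0 (esym (integE (T j i psi tp))))).
Qed.

Lemma weak_grad_poincare (f : E -> E) (phi : E -> R) : lbmv f -> weak_grad f phi ->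
  nonsmooth_poincare f.
Proof.
move=> lf wg; apply/(nonsmooth_poincareP lf) => i j psi tp.
have e1 := wg j _ (test_partial i tp); have e2 := wg i _ (test_partial j tp).
have e3 : partial j (partial i psi) = partial i (partial j psi).
  by apply/funext => x; exact: partial_commute.
have e4 := congr1 (fun u => integ (phi \* u)) e3.
exact: oppr_inj (etrans (esym e1) (etrans e4 e2)).
Qed.

Lemma lbmv_lebesgue_measurable (f : E -> E) : lbmv f -> lebesgue_measurable f.
Proof.
move=> lf; apply: (@measurability _ _ mE (g_sigma_algebraType (@open E)) setT f (@open E) erefl) => _ [U oU <-]; rewrite setTI.
apply: (measurable_preimage_open _ oU) => i; exact: lbm_measurable (lf i).
Qed.

Lemma lebesgue_measurable_coord (f : E -> E) i : lebesgue_measurable f ->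
  measurable_fun [set: mE] (fun x => f x 0 i).
Proof.
move=> mf; apply: (measurability _ (RGenOInfty.measurableE R)) => _ [_ [a ->] <-].
have -> : (fun x : mE => f x 0 i) @^-1` `]a, +oo[ = f @^-1` [set v | a < v 0 i].
  by apply/seteqP; split => x /=; rewrite in_itv/= andbT.
apply: mf => //; apply: sub_sigma_algebra.
apply: (@open_comp _ _ (fun v : E => v 0 i) [set t : R | a < t]); last exact: open_gt.
by move=> v _; exact: coord_continuous.
Qed.

(** If [v] lies outside [Phi x], an open half-space contains [Phi x] but not [v],
    and by upper semicontinuity it contains all values of [f] near [x]. *)
Lemma usc_filippov_sub (Phi : E -> set E) (f : E -> E) : cusco Phi -> (forall x, Phi x (f x)) ->
  forall x, filippov f x `<=` Phi x.
Proof.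
move=> [usc cv] fPhi x v fv; apply: contrapT => nv; have [_ cpx cvx] := cv x.
have [h [c [Hc cv']]] := separation (compact_closed (@norm_hausdorff _ _) cpx) cvx nv.
pose c' := (c + dotv v h) / 2.
have oV : open [set w : E | dotv w h < c'].
  apply: (@open_comp _ _ (fun w : E => dotv w h) [set t : R | t < c']); last exact: open_lt.
  by move=> w _; exact: continuous_dotvl.
have : Phi x `<=` [set w | dotv w h < c'].
  by move=> w /Hc; rewrite /c' /=; move: cv'; lra.
move=> /(usc x _ oV)/nbhs_norm_lt[r r0 rV].
have := fv set0 (negligible_set0 _) r r0.
suff H : forall w, (f @` (eball x r `\` set0)) w -> dotv w h <= c'.
  by move=> /(hull_halfspace H); rewrite /c'; move: cv'; lra.
move=> _ [y [yr _] <-]; apply: ltW; apply: (rV y (eball_norm yr)); exact: fPhi.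
Qed.

(** If [v] is not in one of the closed convex hulls, separation gives a direction
    in which almost all values of [f] near [x] are at most [c] while [v] exceeds
    [c]; so the Clarke derivative in that direction is at most [c]. *)
Lemma weak_grad_clarke_sub_filippov (f : E -> E) (phi : E -> R) : continuous phi -> lbmv f ->
  weak_grad f phi -> forall x, clarke_subdifferential phi x `<=` filippov f x.
Proof.
move=> cphi lf wg x v xv N nN r r0; apply: contrapT => nv.
have [h [c [Hc cv]]] := separation (@closed_hull _ _ _) (@convex_hull _ _ _) nv.
have [s s0 sr] := nbhs_norm_lt (nbhs_eball x r0).
have H := @ae_le_difference_quotient _ _ f phi x h c s N cphi lf wg nN.
have {}H : forall y (t : R), 0 <= t -> `|y - x| < s -> `|y + t *: h - x| < s ->
    phi (y + t *: h) - phi y <= c * t.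
  by apply: H => y Ny ys; apply: Hc; apply: sub_hull; exists y => //; split => //; exact: sr.
(* Small enough for y + t *: h to stay in the ball of radius s when t < s'. *)
pose s' := s / (2 * (1 + `|h|)).
have h1 : 0 < 1 + `|h| by rewrite ltr_pwDl.
have s'0 : 0 < s' by rewrite divr_gt0// mulr_gt0.
have s'h : s' * (1 + `|h|) = s / 2 by rewrite /s'; field; rewrite gt_eqF.
have le1 : (clarke_derivative phi x h <= c%:E)%E.
  apply: (clarke_derivative_le s'0) => y t ys /andP[t0 ts].
  have sh0 : 0 <= s' * `|h| by rewrite mulr_ge0// ltW.
  have s's : s' < s by rewrite mulrDr mulr1 in s'h; lra.
  apply: H; [exact: ltW|exact: lt_trans ys s's|].
  rewrite addrAC; apply: le_lt_trans (ler_normD _ _) _; rewrite normrZ gtr0_norm//.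
  have : t * `|h| <= s' * `|h| by rewrite ler_wpM2r// ltW.
  rewrite mulrDr mulr1 in s'h; lra.
have := le_trans (xv h) le1; rewrite lee_fin leNgt cv; exact/negP.
Qed.

(** Every real bound above the Clarke derivative bounds almost all values of [f]
    near [x], hence their closed convex hull. *)
Lemma weak_grad_filippov_sub_clarke (f : E -> E) (phi : E -> R) : continuous phi -> lbmv f ->
  weak_grad f phi -> forall x, filippov f x `<=` clarke_subdifferential phi x.
Proof.
move=> cphi lf wg x v fv h; apply: le_ereal_of_gt_fin => c /clarke_derivative_lt[r r0 Hr].
have [N nN HN] := difference_quotient_le_ae r0 cphi lf wg Hr.
have r20 : 0 < r / 2 by rewrite divr_gt0.
apply: (hull_halfspace _ (fv N nN (r / 2) r20)) => _ [y [yr Ny] <-].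
by apply: HN => //; exact: eball_norm.
Qed.

End FilippovClarke.

Section FirstImplication.
Context {R : realType} {d : nat}.
Local Notation E := 'rV[R]_d.

Lemma clarke_to_filippov (Phi : E -> set E) (phi : E -> R) : cusco Phi ->
  locally_lipschitz phi -> (forall x, Phi x = clarke_subdifferential phi x) ->
  exists f : E -> E, [/\ lebesgue_measurable f, forall x, Phi x (f x),
    forall x, Phi x = filippov f x & nonsmooth_poincare f].
Proof.
move=> cP lphi PE.
have /choice[g Hg] : forall x, exists v, clarke_subdifferential phi x v.
  by move=> x; rewrite -PE; have [[v xv] _ _] := cP.2 x; exists v.
have [|f [lf wg fphi]] := clarke_measurable_selection lphi Hg.
  move=> r; have [M HM] := cusco_locally_bounded cP r.
  by exists M => x v xr; rewrite -PE; exact: HM.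
have fP x : Phi x (f x) by rewrite PE.
exists f; split.
- exact: lbmv_lebesgue_measurable.
- exact: fP.
- move=> x; apply/seteqP; split; last exact: (usc_filippov_sub cP fP).
  rewrite PE; apply: (weak_grad_clarke_sub_filippov _ lf wg).
  exact: locally_lipschitz_continuous.
- exact: weak_grad_poincare lf wg.
Qed.

End FirstImplication.

(** * Potentials of closed fields and of their weak limits *)

Section Potentials.
Context {R : realType} {d : nat}.
Local Notation E := 'rV[R]_d.
Implicit Types (x y h v : E).

(** The lower end of integration is -1, so that all of the unit interval is
    interior to the domain. *)
Lemma antiderivative (g : R -> R) : continuous g ->
  exists P : R -> R, forall s : R, 0 <= s <= 1 -> is_derive s (1 : R) P (g s).
Proof.
move=> cg; pose P (x : R) := (\int[lebesgue_measure]_(t in [set` `[-1, x]]) g t)%R.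
exists P => s /andP[s0 s1].
have s2 : s < 2 by apply: le_lt_trans s1 _; rewrite ltr1n.
have sm1 : -1 < s by apply: lt_le_trans s0; rewrite oppr_lt0.
have ig : lebesgue_measure.-integrable `[(-1 : R), 2] (EFin \o g).
  apply: continuous_compact_integrable; first exact: segment_compact.
  exact: continuous_subspaceT.
have [dP PE] := continuous_FTC1_closed s2 ig sm1 (cg s).
by rewrite -PE derive1E; exact: derivableP.
Qed.

Lemma increment_le (q dq : R -> R) (C : R) :
  (forall s : R, 0 <= s <= 1 -> is_derive s (1 : R) q (dq s)) ->
  (forall s, 0 <= s <= 1 -> `|dq s| <= C) -> `|q 1 - q 0| <= C.
Proof.
move=> dqE dqC.
have oc (s : R) : s \in `]0, 1[ -> 0 <= s <= 1.
  by rewrite in_itv/= => /andP[s0 s1]; rewrite !ltW.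
have cq : {within `[0, 1], continuous q}.
  apply: derivable_within_continuous => s; rewrite in_itv/= => s01.
  by case: (dqE s s01).
have [c + ->] := MVT_segment ler01 (fun s s01 => dqE s (oc s s01)) cq.
by rewrite in_itv/= subr0 mulr1 => c01; exact: dqC.
Qed.

Section ClosedField.
Variables (F : 'I_d -> E -> R) (G : 'I_d -> 'I_d -> E -> R).
Hypothesis cF : forall j, continuous (F j).
Hypothesis cG : forall i j, continuous (G i j).
Hypothesis FG : forall j (a b : R), exists2 C : R, 0 <= C &
  forall x v, `|x| <= a -> `|v| <= b ->
    `|F j (x + v) - F j x - \sum_(i < d) v 0 i * G i j x| <= C * `|v| ^+ 2.
Hypothesis Gsym : forall i j x, G i j x = G j i x.

Lemma is_derive_taylor j x h : is_derive x h (F j) (\sum_(i < d) h 0 i * G i j x).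
Proof.
have [C C0 HC] := FG j `|x| `|h|.
apply: (@is_derive_quadratic _ _ _ _ _ _ (C * `|h| ^+ 2)) => t t1.
have th : `|t *: h| <= `|h| by rewrite normrZ ler_piMl.
have := HC x (t *: h) (lexx _) th.
rewrite normrZ exprMn real_normK ?num_real// mulr_sumr => H.
rewrite mulrAC -mulrA; apply: le_trans H.
rewrite le_eqVlt; apply/orP; left; apply/eqP; congr (`| _ - _ |).
by apply: eq_bigr => i _; rewrite mxE mulrA.
Qed.

Lemma lipschitz_taylor j (a b : R) : exists2 L : R, 0 <= L &
  forall x v, `|x| <= a -> `|v| <= b -> `|F j (x + v) - F j x| <= L * `|v|.
Proof.
have [C C0 HC] := FG j a b.
have /choice[M HM] : forall i, exists M : R, forall x, `|x| <= a -> `|G i j x| <= M.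
  by move=> i; exact: continuous_bounded_cube.
exists (C * `|b| + `|\sum_i M i|) => [|x v xa vb]; first by rewrite addr_ge0 ?mulr_ge0.
rewrite -[X in `|X|](subrK (\sum_(i < d) v 0 i * G i j x)) mulrDl.
apply: le_trans (ler_normD _ _) _; apply: lerD.
  apply: le_trans (HC x v xa vb) _; rewrite expr2 mulrA; apply: ler_wpM2r => //.
  by apply: ler_wpM2l => //; exact: le_trans vb (ler_norm b).
apply: le_trans (norm_sum_coord_le v (fun i => HM i x xa)) _.
by rewrite mulrC; apply: ler_wpM2r => //; exact: ler_norm.
Qed.

(** The potential is the integral of x.F(sx) over the unit interval, represented
    by the increment of an antiderivative [P x].  To differentiate it in
    direction [h], compare the increments of [P (x + th)] and [P x] over the
    unit interval with that of t s (h.F(sx)), which is t (h.F(x)).  By the symmetry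
    of the Jacobian the derivative in [s] of the difference is a sum of Taylor
    remainders, of order t^2 uniformly in [s], and the mean value theorem
    concludes. *)
Lemma closed_field_potential : exists Phi : E -> R,
  Phi 0 = 0 /\ forall x h, is_derive x h Phi (\sum_(j < d) h 0 j * F j x).
Proof.
have cFray j x : continuous (fun s : R => F j (s *: x)).
  move=> s; apply: (@continuous_comp _ _ _ (fun s : R => s *: x) (F j)); last exact: cF.
  exact: scalel_continuous.
have /choice[P HP] : forall x, exists P : R -> R, forall s : R, 0 <= s <= 1 ->
    is_derive s (1 : R) P (\sum_(j < d) x 0 j * F j (s *: x)).
  move=> x; apply: antiderivative; apply: continuous_sum => j.
  by apply: contM; [exact: cst_continuous|exact: cFray].
suff [Phi HPhi] : exists Phi : E -> R, forall x h, is_derive x h Phi (\sum_(j < d) h 0 j * F j x).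
  exists (fun x => Phi x - Phi 0); split=> [|x h]; first by rewrite subrr.
  have dc : is_derive x h (fun=> Phi 0) 0 by exact: is_derive_cst.
  by have := is_deriveB (HPhi x h) dc; rewrite subr0.
exists (fun x => P x 1 - P x 0) => x h.
have /choice[C HC] : forall j, exists C : R, 0 <= C /\ forall y v, `|y| <= `|x| -> `|v| <= `|h| ->
    `|F j (y + v) - F j y - \sum_(i < d) v 0 i * G i j y| <= C * `|v| ^+ 2.
  by move=> j; have [C C0 H] := FG j `|x| `|h|; exists C.
have /choice[L HL] : forall j, exists L : R, 0 <= L /\ forall y v, `|y| <= `|x| -> `|v| <= `|h| ->
    `|F j (y + v) - F j y| <= L * `|v|.
  by move=> j; have [L L0 H] := lipschitz_taylor j `|x| `|h|; exists L.
apply: (@is_derive_quadratic _ _ _ _ _ _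
  (\sum_(j < d) (`|x| * (C j * `|h| ^+ 2) + `|h| * (L j * `|h|)))) => t t1.
pose q s := P (x + t *: h) s - P x s - t * (s * \sum_(j < d) h 0 j * F j (s *: x)).
pose B s := \sum_(j < d) h 0 j * \sum_(i < d) x 0 i * G i j (s *: x).
pose dq s := \sum_(j < d) (x + t *: h) 0 j * F j (s *: (x + t *: h)) -
  \sum_(j < d) x 0 j * F j (s *: x) -
  t * (\sum_(j < d) h 0 j * F j (s *: x) + s * B s).
have -> : P (x + t *: h) 1 - P (x + t *: h) 0 - (P x 1 - P x 0) -
    t * (\sum_(j < d) h 0 j * F j x) = q 1 - q 0.
  rewrite /q scale1r mul1r mul0r mulr0 subr0.
  set a := \sum_(_ < _) _; ring.
apply: (@increment_le q dq) => [s s01|s /andP[s0 s1]].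
  have dF j : is_derive s (1 : R) (fun s => F j (s *: x)) (\sum_(i < d) x 0 i * G i j (s *: x)).
    have := is_derive_taylor j (0 + s *: x) x.
    move=> /is_derive_on_line; rewrite add0r; congr (is_derive _ _ _ _).
    by apply/funext => s'; rewrite add0r.
  have dS : is_derive s (1 : R) (fun s => \sum_(j < d) h 0 j * F j (s *: x)) (B s).
    rewrite (_ : (fun s => _) = \sum_(j < d) (fun s => h 0 j * F j (s *: x))); last first.
      by apply/funext => s'; rewrite fct_sumE.
    by apply: is_derive_sum.
  have dm : is_derive s (1 : R) (fun s => s * \sum_(j < d) h 0 j * F j (s *: x))
      (\sum_(j < d) h 0 j * F j (s *: x) + s * B s).
    have /is_derive_eq := is_deriveM (@is_derive_id _ _ s 1) dS; apply.
    by rewrite addrC /GRing.scale/= mulr1.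
  have dt : is_derive s (1 : R) (fun s => t * (s * \sum_(j < d) h 0 j * F j (s *: x)))
      (t * (\sum_(j < d) h 0 j * F j (s *: x) + s * B s)).
    have /is_derive_eq := @is_deriveZ _ _ _ _ t s 1 _ dm; exact.
  exact: is_deriveB (is_deriveB (HP (x + t *: h) s s01) (HP x s s01)) dt.
pose y := s *: x; pose v := s *: (t *: h).
have tE : `|t| ^+ 2 = t ^+ 2 by rewrite real_normK// num_real.
have vE : `|v| = s * (`|t| * `|h|) by rewrite !normrZ ger0_norm.
have v1 : `|v| <= `|t| * `|h|.
  by rewrite vE ler_piMl// mulr_ge0.
have vh : `|v| <= `|h| by apply: le_trans v1 _; rewrite ler_piMl.
have yx : `|y| <= `|x| by rewrite normrZ ger0_norm// ler_piMl.
(* The symmetry of the Jacobian enters here. *)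
have AE : t * (s * B s) = \sum_(j < d) x 0 j * \sum_(i < d) v 0 i * G i j y.
  rewrite /B !mulr_sumr; under [RHS]eq_bigr do rewrite mulr_sumr.
  rewrite [RHS]exchange_big/=; apply: eq_bigr => j _; rewrite !mulr_sumr.
  apply: eq_bigr => i _; rewrite (Gsym j i) /y !mxE; ring.
have -> : dq s = \sum_(j < d) (x 0 j * (F j (y + v) - F j y - \sum_(i < d) v 0 i * G i j y) +
    t * (h 0 j * (F j (y + v) - F j y))).
  rewrite /dq scalerDr -/y -/v mulrDr AE !mulr_sumr opprD addrA -!sumrB.
  apply: eq_bigr => j _; rewrite !mxE; set e := \sum_(_ < _) _; ring.
rewrite mulr_suml; apply: le_trans (ler_norm_sum _ _ _) _; apply: ler_sum => j _.
have [C0 HCj] := HC j; have [L0 HLj] := HL j.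
rewrite mulrDl; apply: le_trans (ler_normD _ _) _; apply: lerD.
  rewrite normrM -!mulrA; apply: ler_pM => //; first exact: le_coord_norm.
  apply: le_trans (HCj y v yx vh) _; apply: ler_wpM2l => //.
  rewrite (_ : `|h| * (`|h| * t ^+ 2) = (`|t| * `|h|) ^+ 2); last by rewrite -tE; ring.
  by rewrite ler_sqr ?nnegrE// mulr_ge0.
rewrite !normrM (_ : _ * _ * t ^+ 2 = `|t| * (`|h| * (L j * (`|t| * `|h|)))); last by rewrite -tE; ring.
apply: ler_wpM2l => //; apply: ler_pM => //; first exact: le_coord_norm.
by apply: le_trans (HLj y v yx vh) _; apply: ler_wpM2l.
Qed.

End ClosedField.

End Potentials.

Section LimitOfPotentials.
Context {R : realType} {d : nat}.
Local Notation E := 'rV[R]_d.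
Local Notation mE := (rVlebesgue R d).
Local Notation mu := (@lebesgue_rV R d).

(** The limit is the supremum of the numbers that the sequence eventually
    exceeds; for an ultrafilter the failure to exceed eventually means to stay
    below eventually. *)
Lemma ultra_bounded_cvg (U : set_system nat) (u : nat -> R) (B : R) : UltraFilter U ->
  (forall n, `|u n| <= B) -> exists l : R, u n @[n --> U] --> l.
Proof.
move=> UU uB; pose S := [set a : R | U [set n | a <= u n]].
have hS : has_sup S.
  split; first by exists (- B); apply: filterE => n /=; move: (uB n); rewrite ler_norml => /andP[].
  exists B => a /filter_ex[n /= an]; apply: le_trans an _.
  exact: le_trans (ler_norm _) (uB n).
exists (sup S); apply/cvgrPdist_le => e e0.
have [a Sa ae] := sup_adherent e0 hS.
have Sb : U (~` [set n | sup S + e <= u n]).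
  have [Sb|//] := in_ultra_setVsetC [set n | sup S + e <= u n] UU.
  by have := ub_le_sup hS.2 Sb; rewrite gerDl leNgt e0.
near=> n.
have h1 : a <= u n by near: n; exact: Sa.
have h2 : u n < sup S + e by rewrite ltNge; apply/negP; near: n; exact: Sb.
rewrite ler_distlC; apply/andP; split; first exact: le_trans (ltW ae) h1.
exact: ltW.
Unshelve. all: by end_near.
Qed.

Definition equilipschitz (Phi : nat -> E -> R) := forall r : R,
  exists2 L : R, 0 <= L & forall n x y, `|x| <= r -> `|y| <= r -> `|Phi n x - Phi n y| <= L * `|x - y|.

(** Arzela and Ascoli with an ultrafilter instead of a diagonal sequence: the
    limit is taken pointwise, and equicontinuity makes it uniform on cubes by
    compactness. *)
Lemma equilipschitz_limit (Phi : nat -> E -> R) : (forall n, Phi n 0 = 0) -> equilipschitz Phi ->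
  exists (U : set_system nat) (phi : E -> R),
    [/\ ProperFilter U, \oo `<=` U, locally_lipschitz phi &
        forall r e : R, 0 < e ->
          \forall n \near U, forall x, `|x| <= r -> `|Phi n x - phi x| <= e].
Proof.
move=> Phi0 PhiL; have [U [UU ooU]] := @ultraFilterLemma nat \oo _.
have /choice[phi cphi] : forall x, exists l : R, Phi n x @[n --> U] --> l.
  move=> x; have [L L0 HL] := PhiL `|x|.
  apply: (@ultra_bounded_cvg U _ (L * `|x|)) => n.
  by have := HL n x 0; rewrite Phi0 !subr0; apply; rewrite ?normr0.
have phiL r : exists2 L : R, 0 <= L & (forall n x y, `|x| <= r -> `|y| <= r ->
      `|Phi n x - Phi n y| <= L * `|x - y|) /\
    (forall x y, `|x| <= r -> `|y| <= r -> `|phi x - phi y| <= L * `|x - y|).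
  have [L L0 HL] := PhiL r; exists L => //; split => // x y xr yr.
  have c : `|Phi n x - Phi n y| @[n --> U] --> `|phi x - phi y|.
    by apply: cvg_norm; apply: cvgB; exact: cphi.
  by apply: (cvgr_to_le c); apply: nearW => n; exact: HL.
exists U, phi; split; [exact: ultra_proper|exact: ooU| |].
  move=> x; have [L L0 [_ HL]] := phiL (`|x| + 1).
  exists [set y | `|y - x| < 1]; first exact: norm_lt_nbhs.
  have inr y : `|y - x| < 1 -> `|y| <= `|x| + 1.
    move=> yx; rewrite -(subrK x y) addrC; apply: le_trans (ler_normD _ _) _.
    by rewrite lerD2l ltW.
  by exists L => -[y z] /= [yx zx]; apply: HL; exact: inr.
move=> r e e0; have [L L0 [HL Hphi]] := phiL (r + 1).
have /compact_near_coveringP := @compact_cube R d r.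
move=> /(_ nat U (fun n x => `|Phi n x - phi x| <= e)); apply => x xr.
have L1 : 0 < L + 1 by rewrite ltr_wpDl.
pose dl := Num.min 1 (e / 3 / (L + 1)).
have dl0 : 0 < dl by rewrite lt_min ltr01/= !divr_gt0.
exists ([set y | `|y - x| < dl], [set n | `|Phi n x - phi x| <= e / 3]).
  split; first exact: norm_lt_nbhs.
  have e3 : 0 < e / 3 by rewrite divr_gt0.
  by have /cvgrPdist_le/(_ _ e3) := cphi x; apply: filterS => n /=; rewrite distrC.
move=> [y n] /= [ydl nx].
have y1 : `|y - x| < 1 by apply: lt_le_trans ydl _; rewrite ge_min lexx.
have yr : `|y| <= r + 1.
  rewrite -(subrK x y) addrC; apply: le_trans (ler_normD _ _) _.
  by apply: lerD => //; exact: ltW.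
have xr1 : `|x| <= r + 1 by apply: le_trans xr _; rewrite lerDl.
have Lyx : L * `|y - x| <= e / 3.
  apply: le_trans (_ : (L + 1) * dl <= _).
    by apply: ler_pM => //; [rewrite lerDl|exact: ltW].
  by rewrite mulrC -ler_pdivlMr// ge_min lexx orbT.
have h1 := le_trans (HL n y x yr xr1) Lyx; have h2 := le_trans (Hphi y x yr xr1) Lyx.
rewrite (_ : Phi n y - phi y = (Phi n y - Phi n x) + (Phi n x - phi x) - (phi y - phi x)); last by ring.
apply: le_trans (ler_normB _ _) _; apply: le_trans (lerD (ler_normD _ _) (lexx _)) _.
by apply: le_trans (lerD (lerD h1 nx) h2) _; rewrite le_eqVlt; apply/orP; left; apply/eqP; field.
Qed.

End LimitOfPotentials.

Section WeakPoincare.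
Context {R : realType} {d : nat}.
Local Notation E := 'rV[R]_d.
Local Notation mE := (rVlebesgue R d).
Local Notation mu := (@lebesgue_rV R d).
Implicit Types (f : E -> E) (phi psi : E -> R) (x h : E).

(** The distributional condition, tested on translates of the mollifier. *)
Lemma mollified_symmetric f n i j x : lbmv f -> nonsmooth_poincare f ->
  convol (partial i (rho n)) (fun y => f y 0 j) x = convol (partial j (rho n)) (fun y => f y 0 i) x.
Proof.
move=> lf /(nonsmooth_poincareP lf) H.
have e0 := H i j _ (test_rho_shift n x).
have E3 k : partial k (fun y => rho n (y - x)) = (fun y => partial k (rho n) (y - x)).
  by apply/funext => y; exact: partial_shift.
by rewrite !E3 in e0.
Qed.

Lemma mollified_potential f n : lbmv f -> nonsmooth_poincare f ->
  exists Phi : E -> R, Phi 0 = 0 /\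
    forall x h, is_derive x h Phi (\sum_(j < d) h 0 j * convol (rho n) (fun y => f y 0 j) x).
Proof.
move=> lf pf; pose G i j x := - convol (partial i (rho n)) (fun y : E => f y 0 j) x.
apply: (@closed_field_potential R d (fun j => convol (rho n) (fun y => f y 0 j)) G).
- move=> j; exact: convol_continuous (rho_Sm n) (@rho_csupp R d n) (lf j).
- move=> i j x.
  have c : continuous (convol (partial i (rho n)) (fun y : E => f y 0 j)).
    apply: convol_continuous (lf j); first exact: (Sm_partial i (rho_Sm n)).1.
    exact: csupp_partial (@rho_csupp R d n).
  by apply: continuousN; exact: c.
- move=> j a b; have [C C0 HC] := convol_taylor a b (rho_Sm n) (@rho_csupp R d n) (lf j).
  exists C => // x v xa vb; have := HC x v xa vb.
  congr (`| _ + _ | <= _); rewrite -sumrN; apply: eq_bigr => i _.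
  by rewrite /G mulrN opprK.
- by move=> i j x; exact: (congr1 -%R (mollified_symmetric n i j x lf pf)).
Qed.

(** The potentials of the mollified fields are equi-Lipschitz on cubes because
    [f] is locally bounded.  In the weak gradient equation for the mollified
    field the left side converges along the ultrafilter by local uniform
    convergence, and the right side along the whole sequence. *)
Lemma weak_potential f : lbmv f -> nonsmooth_poincare f ->
  exists2 phi : E -> R, locally_lipschitz phi & weak_grad f phi.
Proof.
move=> lf pf.
pose F n j x := convol (rho n) (fun y : E => f y 0 j) x.
have /choice[Phi HPhi] : forall n, exists Phi : E -> R, Phi 0 = 0 /\
    forall x h, is_derive x h Phi (\sum_(j < d) h 0 j * F n j x).
  by move=> n; exact: mollified_potential.
have dPhi n x h : is_derive x h (Phi n) (\sum_(j < d) h 0 j * F n j x) by apply: (HPhi n).2.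
have eqL : equilipschitz Phi.
  move=> r; have /choice[M HM] : forall j, exists M : R, forall x, `|x| <= r + 1 -> `|f x 0 j| <= M.
    by move=> j; exact: lbm_bounded (lf j) (r + 1).
  have FM n j x : `|x| <= r -> `|F n j x| <= M j.
    move=> xr; apply: (convol_rho_norm_le (lf j)) => y yx; apply: HM.
    rewrite -(subrK x y) addrC; apply: le_trans (ler_normD _ _) _.
    by apply: lerD => //; apply: le_trans yx (invS_le1 n).
  exists (`|\sum_(j < d) M j|) => // n x y xr yr.
  have [s /andP[s0 s1]] := mvt_line y (fun z => dPhi n z (x - y)).
  rewrite [y + (x - y)]addrC subrK => ->.
  have zr : `|y + s *: (x - y)| <= r.
    have -> : y + s *: (x - y) = (1 - s) *: y + s *: x.
      by apply/rowP => i; rewrite !mxE; ring.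
    apply: le_trans (ler_normD _ _) _; rewrite !normrZ ger0_norm ?subr_ge0// (ger0_norm s0).
    rewrite (_ : r = (1 - s) * r + s * r); last by ring.
    by apply: lerD; apply: ler_wpM2l => //; rewrite subr_ge0.
  apply: le_trans (norm_sum_coord_le (x - y) (fun j => FM n j _ zr)) _.
  by rewrite mulrC; apply: ler_wpM2r => //; exact: ler_norm.
have [U [phi [PU ooU lphi Hphi]]] := equilipschitz_limit (fun n => (HPhi n).1) eqL.
exists phi => // i psi tp; have tpi := test_partial i tp.
have lbphi := continuous_lbm (locally_lipschitz_continuous lphi).
have cPhi n : continuous (Phi n).
  move=> x; have [L L0 HL] := eqL (`|x| + 1).
  apply: (@lipschitz_near_continuous _ _ _ _ L 1) => // h h1.
  have := HL n (x + h) x; rewrite [x + h - x]addrAC subrr add0r; apply.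
    by apply: le_trans (ler_normD _ _) _; rewrite lerD2l.
  by rewrite lerDl.
have lPhi n := continuous_lbm (cPhi n).
have lF n j : lbm (F n j).
  by apply: continuous_lbm; exact: convol_continuous (rho_Sm n) (@rho_csupp R d n) (lf j).
have ibp n : integ (Phi n \* partial i psi) = - integ (F n i \* psi).
  apply: (integration_by_parts (lPhi n) (lF n i) (test_tame tp) (test_tame tpi) (h := basisv i)).
    by move=> x; have := dPhi n x (basisv i); rewrite dot_basisv.
  by move=> x; exact: test_is_derive.
have [r ur] := tpi.2.
have T0 := tame_norm (test_tame tpi).
pose J := integ (fun x => `|partial i psi x|).
have J0 : 0 <= J by apply: Rintegral_ge0.
have Tphi := tame_lbm_test lbphi tpi.
have c2 := convol_rho_weak_cvg (lf i) (test_continuous tp) tp.2.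
apply/eqP; rewrite -subr_eq0 -normr_le0; apply/ler_addgt0Pr => e e0; rewrite add0r.
have e2 : 0 < e / 2 by rewrite divr_gt0.
have J1 : 0 < J + 1 by rewrite ltr_wpDl.
have e3 : 0 < e / 2 / (J + 1) by rewrite divr_gt0.
have n1 : U [set n | `|integ (F n i \* psi) - integ ((fun y => f y 0 i) \* psi)| <= e / 2].
  apply: ooU; move/cvgrPdist_le : c2 => /(_ _ e2); apply: filterS => n.
  by rewrite /= distrC.
(* A single index for which both sides are within e / 2 of their limits. *)
have [n [Hn1 Hn2]] := filter_ex (filterI n1 (Hphi r _ e3)).
have Tn := tame_lbm_test (lPhi n) tpi.
have key : `|integ (Phi n \* partial i psi) - integ (phi \* partial i psi)| <= e / 2.
  rewrite -(integB Tn Tphi); apply: le_trans (integ_abs_le (tameB Tn Tphi)) _.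
  apply: (@le_trans _ _ (e / 2 / (J + 1) * J)); last first.
    rewrite -[leRHS]mulr1 -mulrA; apply: ler_wpM2l; first exact: ltW.
    by rewrite mulrC ler_pdivrMr// mul1r lerDl.
  rewrite -(integZ _ T0); apply: le_integ; [exact: tame_norm (tameB Tn Tphi)|exact: tameZ T0|].
  move=> x /=; rewrite -mulrBl normrM.
  have [xr|xr] := leP `|x| r; first by apply: ler_wpM2r => //; exact: Hn2.
  by rewrite (ur x xr) normr0 !mulr0.
have tri (a b c : R) : `|- a - b| <= e / 2 -> `|a - c| <= e / 2 -> `|b - - c| <= e.
  rewrite !ler_norml => /andP[? ?] /andP[? ?]; apply/andP; split; lra.
by rewrite (ibp n) in key; exact: tri key Hn1.
Qed.

End WeakPoincare.

Section SecondImplication.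
Context {R : realType} {d : nat}.
Local Notation E := 'rV[R]_d.

Lemma filippov_to_clarke (Phi : E -> set E) (f : E -> E) : cusco Phi ->
  lebesgue_measurable f -> (forall x, Phi x (f x)) -> (forall x, Phi x = filippov f x) ->
  nonsmooth_poincare f ->
  exists phi : E -> R, locally_lipschitz phi /\
    forall x, Phi x = clarke_subdifferential phi x.
Proof.
move=> cP mf fP PE pf.
have lf : lbmv f.
  move=> i; split; first exact: lebesgue_measurable_coord.
  move=> r; have [M HM] := cusco_locally_bounded cP r; exists M => x xr.
  exact: le_trans (le_coord_norm _ _) (HM x _ xr (fP x)).
have [phi lphi wg] := weak_potential lf pf.
have cphi := locally_lipschitz_continuous lphi.
exists phi; split => // x; rewrite PE; apply/seteqP; split.
  exact: weak_grad_filippov_sub_clarke cphi lf wg x.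
exact: weak_grad_clarke_sub_filippov cphi lf wg x.
Qed.

End SecondImplication.

Theorem theorem5p2 (R : realType) (d : nat)
    (Phi : 'rV[R]_d -> set 'rV[R]_d) (cuscoPhi : cusco Phi) :
  (exists phi : 'rV[R]_d -> R,
     locally_lipschitz phi /\
     forall x, Phi x = clarke_subdifferential phi x)
  <->
  (exists f : 'rV[R]_d -> 'rV[R]_d,
     [/\ lebesgue_measurable f,
         forall x, Phi x (f x),
         forall x, Phi x = filippov f x &
         nonsmooth_poincare f]).
Proof.
split=> [[phi [lphi PE]]|[f [mf fPhi PE pf]]]; first exact: clarke_to_filippov lphi PE.
exact: filippov_to_clarke mf fPhi PE pf.
Qed.
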